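(* Let $k$ be an algebraically closed field of characteristic $2$. (1) If $L\subset T_{\mathbb{P}^2}$ is an invertible $1$-foliation of the projective plane $\mathbb{P}^2=\mathbb{P}^2_k$ with $\deg L=1$ and $Y=\mathbb{P}^2/L$ is the quotient of $\mathbb{P}^2$ by $L$, then the configuration of the singular points of $Y$ is of type $A_1$ after suitable coordinate changes. (2) There does not exist an invertible $1$-foliation $L$ of $\mathbb{P}^2$ of degree $0$. (3) If $L\subset T_{\mathbb{P}^2}$ is an invertible $1$-foliation of $\mathbb{P}^2$ with $\deg L=-1$ and $Y=\mathbb{P}^2/L$ is the quotient of $\mathbb{P}^2$ by $L$, then the configuration of the singular points of $Y$ is of type $7A_1$, $D_4^0+3A_1$, $D_6^0+A_1$ or $E_7^0$.
   Context: $k$ is an algebraically closed field of characteristic $p=2$, and $T_X$ denotes the tangent bundle of a smooth variety $X$ over $k$. **1-foliations.** A $1$-foliation of $X$ is a saturated subsheaf $L\subset T_X$ that is closed under Lie brackets and $p$-closed, where $p$-closed means that $\delta^p\in L$ for all local sections $\delta\in L$ ($\delta^p$ is the $p$-fold composite of $\delta$ as a derivation of $\mathcal{O}_X$). It is invertible if $L$ is an invertible sheaf. An invertible $1$-foliation $L$ of $\mathbb{P}^2$ has degree $n$, written $\deg L=n$, if $L\cong\mathcal{O}_{\mathbb{P}^2}(n)$. **Quotient.** The quotient $Y=X/L$ is the normal variety with the same underlying topological space as $X$ and structure sheaf $\mathcal{O}_Y=\{f\in\mathcal{O}_X \mid \delta(f)=0 \text{ for all } \delta\in L\}$. The quotient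 morphism $\pi:X\to Y$ is finite, purely inseparable of degree $p$, and a homeomorphism; points of $Y$ are identified with points of $X$ via $\pi$. **Singularities.** A point $y\in Y$ of the surface $Y$ is a singularity of type $A_1$, $D_{2n}^0$ ($n\ge 2$), or $E_7^0$ if the completed local ring $\widehat{\mathcal{O}}_{Y,y}$ is isomorphic to $k[[X,Y,Z]]/(f)$ with, respectively, $f=Z^2+XY$, $f=Z^2+X^2Y+XY^n$, or $f=Z^2+X^3+XY^3$ (Artin's notation for rational double points in characteristic $2$). **Configuration types.** Let $X_0,X_1,X_2$ be homogeneous coordinates of $\mathbb{P}^2$. The configuration of the singular points of $Y$ is of a given type if, after a suitable change of the homogeneous coordinates of $\mathbb{P}^2$ (and identifying points of $Y$ with points of $\mathbb{P}^2$ via $\pi$), the singular points of $Y$ are exactly the following. - Type $A_1$: a single singularity, of type $A_1$, at $[1:0:0]$. - Type $7A_1$: seven singularities, all of type $A_1$: the three points $[1:0:0]$, $[0:1:0]$, $[0:0:1]$; one point on each of the three lines $X_0=0$, $X_1=0$, $X_2=0$ different from the three coordinate points; and one point lying on none of these three lines. - Type $D_4^0+3A_1$: a $D_4^0$-singularity at $[1:0:0]$ and three $A_1$-singularities on the line $X_0=0$, namely at $[0:1:0]$, at $[0:0:1]$ and at one further point of the line $X_0=0$. - Type $D_6^0+A_1$: a $D_6^0$-singularity at $[1:0:0]$ and an $A_1$-singularity at $[0:1:0]$. - Type $E_7^0$: a single singularity, of type $E_7^0$, at $[1:0:0]$. *)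

(* Defs.v *)
From HB Require Import structures.
From mathcomp Require Import all_boot all_order all_algebra.
From mathcomp Require Import boolp classical_sets functions.
From mathcomp Require Import mpoly.

Set Implicit Arguments.
Unset Strict Implicit.
Unset Printing Implicit Defensive.
Import GRing.Theory.

Local Open Scope classical_set_scope.
Local Open Scope ring_scope.

(* The projective plane over an algebraically closed field [k] is handled as a
   classical variety.  A point is given by a nonzero vector of homogeneous
   coordinates, and a subset of P^2 is represented by the set of all homogeneous
   coordinate vectors of its points.  Since P^2 is integral, the sheaves below
   (O_X, its twists, T_X and its submodules) are described as subsheaves of
   constant sheaves of rational objects: restriction maps are inclusions, and
   only nonempty open sets have to be considered. *)

Section Subfield.
Variables (F : fieldType) (S : divringClosed F).

Record subfield_of := SubfieldOf { sfval : F; _ : sfval \in S }.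

HB.instance Definition _ := [isSub for sfval].
HB.instance Definition _ := [Choice of subfield_of by <:].
HB.instance Definition _ := [SubChoice_isSubComUnitRing of subfield_of by <:].
HB.instance Definition _ :=
  [SubComUnitRing_isSubIntegralDomain of subfield_of by <:].
HB.instance Definition _ := [SubIntegralDomain_isSubField of subfield_of by <:].

End Subfield.

Section FunctionField.
Variable k : closedFieldType.

Definition hfield : fieldType := {fraction {mpoly k[3]}}.

Definition hfrac (p : {mpoly k[3]}) : hfield := FracField.tofrac p.
HB.instance Definition _ := GRing.RMorphism.copy hfrac
  (@FracField.tofrac {mpoly k[3]}).

Lemma hfrac_eq0 (p : {mpoly k[3]}) : (hfrac p == 0) = (p == 0).
Proof. exact: tofrac_eq0. Qed.

Definition hquot (n : int) (s : hfield) (p q : {mpoly k[3]}) : Prop :=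
  exists d e : nat, [/\ p \is d.-homog, q \is e.-homog, q != 0,
    d%:Z = e%:Z + n & s = hfrac p / hfrac q].

Definition hdeg0 : {pred hfield} := fun s => `[< exists p q, hquot 0 s p q >].

Lemma subf_div (F : fieldType) (x1 y1 x2 y2 : F) : y1 != 0 -> y2 != 0 ->
  x1 / y1 - x2 / y2 = (x1 * y2 - x2 * y1) / (y1 * y2).
Proof. by move=> y10 y20; rewrite -mulNr addf_div // mulNr. Qed.

Lemma hdeg0_divring_closed : divring_closed hdeg0.
Proof.
split=> [|s t|s t].
- apply/asboolP; exists 1, 1, 0%N, 0%N; split=> //.
  + exact: dhomog1.
  + exact: dhomog1.
  + exact: oner_neq0.
  + by rewrite divr1 rmorph1.
- move=> /asboolP[p [q [d [e [hp hq q0 de ->]]]]].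
  move=> /asboolP[p' [q' [d' [e' [hp' hq' q0' de' ->]]]]].
  move: de de'; rewrite !addr0 => -[?] [?]; subst d d'.
  apply/asboolP; exists (p * q' - p' * q), (q * q'), (e + e')%N, (e + e')%N.
  split; rewrite ?addr0 ?mulf_neq0 //.
  + by apply: rpredB; [exact: dhomogM | rewrite addnC; exact: dhomogM].
  + exact: dhomogM.
  + have fq : hfrac q != 0 by rewrite hfrac_eq0.
    have fq' : hfrac q' != 0 by rewrite hfrac_eq0.
    by rewrite subf_div // rmorphB !rmorphM.
- move=> /asboolP[p [q [d [e [hp hq q0 de ->]]]]].
  move=> /asboolP[p' [q' [d' [e' [hp' hq' q0' de' ->]]]]].
  move: de de'; rewrite !addr0 => -[?] [?]; subst d d'.
  have [->|p0'] := eqVneq p' 0.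
    rewrite rmorph0 mul0r invr0 mulr0; apply/asboolP.
    exists 0, 1, 0%N, 0%N; split; rewrite ?oner_neq0 ?rmorph0 ?mul0r //.
    + exact: dhomog0.
    + exact: dhomog1.
  apply/asboolP; exists (p * q'), (q * p'), (e + e')%N, (e + e')%N.
  split; rewrite ?addr0 ?mulf_neq0 //.
  + exact: dhomogM.
  + exact: dhomogM.
  + by rewrite invf_div mulf_div !rmorphM.
Qed.

HB.instance Definition _ :=
  GRing.isDivringClosed.Build hfield hdeg0 hdeg0_divring_closed.

(* The function field of P^2. *)
Definition ratfun : fieldType := subfield_of hdeg0.

Definition hval (f : ratfun) : hfield := sfval f.
HB.instance Definition _ := GRing.RMorphism.copy hval
  (val : subfield_of hdeg0 -> hfield).

Lemma ratC_subproof (c : k) : hfrac c%:MP_[3] \in hdeg0.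
Proof.
apply/asboolP; exists c%:MP_[3], 1, 0%N, 0%N; split=> //.
- by rewrite -[c%:MP_[3]]mulr1 mul_mpolyC dhomogZ // dhomog1.
- exact: dhomog1.
- exact: oner_neq0.
- by rewrite rmorph1 divr1.
Qed.

Definition ratC (c : k) : ratfun := SubfieldOf (ratC_subproof c).

End FunctionField.

Section Sheaves.
Variable k : closedFieldType.
Implicit Types (U V W : set 'rV[k]_3) (v : 'rV[k]_3).
Local Notation K := (ratfun k).

Definition heval (p : {mpoly k[3]}) (v : 'rV[k]_3) : k := p.@[fun i => v 0 i].

Definition P2 : set 'rV[k]_3 := [set v | v != 0].

Definition same_point (v w : 'rV[k]_3) : Prop :=
  exists2 c : k, c != 0 & v = c *: w.

Definition zariski_open U : Prop :=
  exists2 S : set {mpoly k[3]}, (forall p, S p -> exists d, p \is d.-homog) &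
    U = [set v | P2 v /\ exists2 p, S p & heval p v != 0].

Definition open_ne U : Prop := zariski_open U /\ U !=set0.

(* Sections over [U] of the twisting sheaf O(n). *)
Definition twist (n : int) U : set (hfield k) :=
  [set s | forall v, U v -> exists p q, hquot n s p q /\ heval q v != 0].

Definition OX U : set K := [set f | twist 0 U (hval f)].

Definition OX_stalk v : set K :=
  [set f | exists U, [/\ open_ne U, U v & OX U f]].

Definition derivation (D : K -> K) : Prop :=
  [/\ forall f g, D (f + g) = D f + D g,
      forall f g, D (f * g) = f * D g + g * D f &
      forall c, D (ratC c) = 0].

(* Sections over [U] of the tangent bundle: rational vector fields that are
   regular at every point of [U]. *)
Definition TX U : set (K -> K) :=
  [set D | derivation D /\
    forall v, U v -> forall f, OX_stalk v f -> OX_stalk v (D f)].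

(* Sheaves of O_X-submodules of T_X. *)
Record subsheafT := SubsheafT {
  sec :> set 'rV[k]_3 -> set (K -> K);
  sec_sub : forall U, open_ne U -> sec U `<=` TX U;
  sec_zero : forall U, open_ne U -> sec U (fun=> 0);
  sec_add : forall U, open_ne U ->
    forall D E, sec U D -> sec U E -> sec U (fun g => D g + E g);
  sec_scale : forall U, open_ne U ->
    forall f D, OX U f -> sec U D -> sec U (fun g => f * D g);
  sec_res : forall U V, open_ne U -> open_ne V -> V `<=` U ->
    sec U `<=` sec V;
  sec_glue : forall U, open_ne U -> forall D,
    (forall v, U v -> exists V, [/\ open_ne V, V `<=` U, V v & sec V D]) ->
    sec U D }.

Implicit Type L : subsheafT.

(* T_X / L is torsion free. *)
Definition saturated L : Prop :=
  forall U, open_ne U -> forall f D,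
    OX U f -> f != 0 -> TX U D -> L U (fun g => f * D g) -> L U D.

Definition bracket_closed L : Prop :=
  forall U, open_ne U -> forall D E, L U D -> L U E ->
    L U (fun g => D (E g) - E (D g)).

(* The characteristic is p = 2. *)
Definition p_closed L : Prop :=
  forall U, open_ne U -> forall D, L U D -> L U (iter 2%N D).

Definition one_foliation L : Prop :=
  [/\ saturated L, bracket_closed L & p_closed L].

(* An isomorphism of sheaves of O_X-modules between O(n)|W and L|W. *)
Definition iso_twist_on (n : int) L W : Prop :=
  exists phi : set 'rV[k]_3 -> hfield k -> K -> K,
    forall U, open_ne U -> U `<=` W ->
    [/\ set_bij (twist n U) (L U) (phi U),
        forall s t, twist n U s -> twist n U t ->
          phi U (s + t) = (fun g => phi U s g + phi U t g),
        forall f s, OX U f -> twist n U s ->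
          phi U (hval f * s) = (fun g => f * phi U s g) &
        forall V, open_ne V -> V `<=` U -> forall s, twist n U s ->
          phi V s = phi U s].

Definition invertible L : Prop :=
  forall v, P2 v -> exists W, [/\ open_ne W, W v & iso_twist_on 0 L W].

Definition has_degree L (n : int) : Prop := iso_twist_on n L P2.

(* The quotient Y = X/L has the same underlying space as X. *)
Definition OY L U : set K :=
  [set f | OX U f /\
    forall V, open_ne V -> V `<=` U -> forall D, L V D -> D f = 0].

Definition OY_stalk L v : set K :=
  [set f | exists U, [/\ open_ne U, U v & OY L U f]].

End Sheaves.

Section LocalRings.
Variable k : closedFieldType.
Local Notation K := (ratfun k).
Implicit Types R : set K.

Definition max_ideal R : set K :=
  [set f | R f /\ ~ exists2 g, R g & f * g = 1].

(* The local rings of Y at closed points have dimension 2, Y being a surface. *)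
Definition regular2 R : Prop :=
  exists a b : K, [/\ max_ideal R a, max_ideal R b &
    forall f, max_ideal R f -> exists g h, [/\ R g, R h & f = g * a + h * b]].

Definition ideal_mul (I J : set K) : set K :=
  [set f | exists (n : nat) (a b : 'I_n -> K),
    [/\ forall i, I (a i), forall i, J (b i) & f = \sum_i a i * b i]].

Definition max_pow R (n : nat) : set K := iter n (ideal_mul (max_ideal R)) R.

(* Elements of the completion lim_n R/m^n are represented by coherent sequences
   of representatives, and compared modulo [null_seq]. *)
Definition coherent_seq R (r : nat -> K) : Prop :=
  forall n, R (r n) /\ max_pow R n (r n.+1 - r n).

Definition null_seq R (r : nat -> K) : Prop := forall n, max_pow R n (r n).

(* The ring k[[X,Y,Z]]: families of coefficients indexed by monomials. *)
Definition pseries := 'X_{1..3} -> k.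

Definition ps_add (a b : pseries) : pseries := fun m => a m + b m.

Definition ps_mul (a b : pseries) : pseries := fun m =>
  \sum_(u : 'X_{1..3 < (mdeg m).+1, (mdeg m).+1} | m == (u.1 + u.2)%MM)
    a u.1 * b u.2.

Definition ps_of_poly (p : {mpoly k[3]}) : pseries := fun m => p@_m.

(* The completion of [R] is isomorphic to k[[X,Y,Z]]/(f) as a k-algebra: there
   is a surjective homomorphism of k-algebras [phi] from k[[X,Y,Z]] onto the
   completion with kernel (f). *)
Definition completion_iso R (f : {mpoly k[3]}) : Prop :=
  exists phi : pseries -> nat -> K,
  [/\ (forall a, coherent_seq R (phi a)),
      (forall a b, null_seq R (fun n => phi (ps_add a b) n - (phi a n + phi b n)))
      /\ (forall a b, null_seq R (fun n => phi (ps_mul a b) n - phi a n * phi b n)),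
      forall c : k, null_seq R (fun n => phi (ps_of_poly c%:MP) n - ratC c),
      forall r, coherent_seq R r ->
        exists a, null_seq R (fun n => phi a n - r n) &
      forall a, null_seq R (phi a) <-> exists b, a = ps_mul (ps_of_poly f) b].

(* [D0 n] is the type D_{2n}^0. *)
Inductive rdp := A1 | D0 of nat | E70.

Definition rdp_eqn (t : rdp) : {mpoly k[3]} :=
  let x := 'X_0 in let y := 'X_1 in let z := 'X_2 in
  match t with
  | A1 => z ^+ 2 + x * y
  | D0 n => z ^+ 2 + x ^+ 2 * y + x * y ^+ n
  | E70 => z ^+ 2 + x ^+ 3 + x * y ^+ 3
  end.

End LocalRings.

Section Configurations.
Variable k : closedFieldType.
Implicit Type L : subsheafT k.

Definition singular L (v : 'rV[k]_3) : Prop := ~ regular2 (OY_stalk L v).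

Definition sing_of_type L (v : 'rV[k]_3) (t : rdp) : Prop :=
  completion_iso (OY_stalk L v) (rdp_eqn k t).

Definition pt (a b c : k) : 'rV[k]_3 := \row_(j < 3) [:: a; b; c]`_j.

(* In the coordinates given by the invertible matrix [A], the singular points of
   P^2/L are exactly those listed in [s], with the listed types. *)
Definition sing_config L (s : set ('rV[k]_3 * rdp)) : Prop :=
  exists2 A : 'M[k]_3, A \in unitmx &
    (forall v, P2 v -> (singular L v <->
       exists2 wt, s wt & same_point v (wt.1 *m A))) /\
    (forall wt, s wt -> sing_of_type L (wt.1 *m A) wt.2).

Definition config_A1 L : Prop := sing_config L [set (pt 1 0 0, A1)].

Definition config_7A1 L : Prop :=
  exists a0 b0 a1 b1 a2 b2 a3 b3 c3 : k,
    all (fun x : k => x != 0) [:: a0; b0; a1; b1; a2; b2; a3; b3; c3] /\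
    sing_config L
      [set (pt 1 0 0, A1); (pt 0 1 0, A1); (pt 0 0 1, A1);
           (pt 0 a0 b0, A1); (pt a1 0 b1, A1); (pt a2 b2 0, A1);
           (pt a3 b3 c3, A1)].

Definition config_D4_3A1 L : Prop :=
  exists a b : k, [/\ a != 0, b != 0 &
    sing_config L
      [set (pt 1 0 0, D0 2%N); (pt 0 1 0, A1); (pt 0 0 1, A1); (pt 0 a b, A1)]].

Definition config_D6_A1 L : Prop :=
  sing_config L [set (pt 1 0 0, D0 3%N); (pt 0 1 0, A1)].

Definition config_E7 L : Prop := sing_config L [set (pt 1 0 0, E70)].

End Configurations.

(* Main.v *)
From HB Require Import structures.
Require Import Defs.
From mathcomp Require Import all_boot all_order all_algebra perm.
From mathcomp Require Import boolp classical_sets functions.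
From mathcomp Require Import mpoly ring zify.

(** Let [L] be an invertible 1-foliation of degree [n].  Its sections are the
    multiples of one rational vector field D of the plane, and p-closedness gives
    D^2 = alpha D.  The function field K has the basis 1, x, y, xy over its subfield
    of squares.  As D kills the slope Dx/Dy, expanding this slope in the basis
    shows ([p_closed_form]) that D is proportional to a field sum_i b_i^2 d/dX_i,
    with forms b_i of the same degree m that can be taken without common factor
    ([primitive_form]).

    The factor of proportionality is then a constant.  It has no poles, because the
    forms b_i^2 X_j + b_j^2 X_i have no common prime factor: the derivation
    attached to a prime would show that the prime divides its own derivatives, as
    only squares do ([prime_cross]).  It has no zeros, because [L] is saturated.
    Comparing degrees gives n = 1 - 2m ([foliation_form]).  So n = 0 is impossible,
    n = 1 means that the b_i are constants and n = -1 that they are linear forms.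

    In affine coordinates x, y at a point, the local ring of the quotient is
    generated over the squares by f = b_0^2 xy + b_1^2 y + b_2^2 x ([Rloc_eq]).  If
    f is the sum of monomials in the equation of a rational double point, then the
    completion is k[[X,Y,Z]]/(Z^2 + f(X,Y)), with X = x^2, Y = y^2 and Z = f
    ([double_cover_completion]).  At a point v where (b_i(v)^2) is not
    proportional to v, f has a linear term and the quotient is regular; if it is a
    nonzero multiple of v, then f is xy in suitable coordinates and up to squares,
    and the point is of type A1.

    For constant b_i, the only singular point is the direction of the field.  For
    linear b_i, the map phi : v |-> (b_i(v)^2) is Frobenius-semilinear of rank at
    least 2, as the b_i have no common factor.  Over an algebraically closed field
    such maps have four normal forms ([semilinear_normal_form]), according to the
    size of their nilpotent part.  In each case the equation phi v = l v is solved
    by inspection: the solutions with l nonzero give the points of type A1, and the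
    kernel of phi, if any, gives the point of type D_4^0, D_6^0 or E_7^0. *)

Set Implicit Arguments.
Unset Strict Implicit.
Unset Printing Implicit Defensive.
Import GRing.Theory.
Local Open Scope ring_scope.

(** * Unique factorisation *)

Section Divisibility.
Variable R : idomainType.
Implicit Types a b c p q : R.

Definition divides p a : Prop := exists c, a = c * p.

Definition prime_elt p : Prop :=
  [/\ p != 0, p \isn't a GRing.unit &
      forall a b, divides p (a * b) -> divides p a \/ divides p b].

Definition factorial_ring : Prop :=
  forall a, a != 0 -> exists u (s : seq R),
    [/\ u \is a GRing.unit, {in s, forall p, prime_elt p} &
        a = u * \prod_(p <- s) p].

Lemma divides0 p : divides p 0.
Proof. by exists 0; rewrite mul0r. Qed.

Lemma divides_refl p : divides p p.
Proof. by exists 1; rewrite mul1r. Qed.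

Lemma dividesD p a b : divides p a -> divides p b -> divides p (a + b).
Proof. by move=> [c ->] [d ->]; exists (c + d); rewrite mulrDl. Qed.

Lemma dividesN p a : divides p a -> divides p (- a).
Proof. by move=> [c ->]; exists (- c); rewrite mulNr. Qed.

Lemma dividesB p a b : divides p a -> divides p b -> divides p (a - b).
Proof. by move=> pa pb; apply: dividesD => //; apply: dividesN. Qed.

Lemma dividesMl p a b : divides p b -> divides p (a * b).
Proof. by move=> [c ->]; exists (a * c); rewrite mulrA. Qed.

Lemma dividesMr p a b : divides p a -> divides p (a * b).
Proof. by rewrite mulrC; apply: dividesMl. Qed.

Lemma divides_sum I (s : seq I) (P : pred I) (F : I -> R) p :
  (forall i, P i -> divides p (F i)) -> divides p (\sum_(i <- s | P i) F i).
Proof.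
move=> h; elim/big_ind: _ => //; first exact: divides0.
exact: dividesD.
Qed.

Lemma divides_addr p a b : divides p a -> divides p (a + b) -> divides p b.
Proof.
by move=> pa pab; rewrite -(addKr a b) addrC; apply: dividesB.
Qed.

Lemma divides_trans p q a : divides p q -> divides q a -> divides p a.
Proof. by move=> [c ->] [d ->]; exists (d * c); rewrite mulrA. Qed.

Lemma prime_dividesM p a b :
  prime_elt p -> divides p (a * b) -> divides p a \/ divides p b.
Proof. by case=> _ _; apply. Qed.

Lemma prime_notdiv1 p : prime_elt p -> ~ divides p 1.
Proof.
move=> [_ /negP pU _] [c e]; apply: pU; apply/unitrPr; exists c.
by rewrite mulrC -e.
Qed.

Lemma prime_unitMl p u a :
  u \is a GRing.unit -> divides p (u * a) -> divides p a.
Proof.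
move=> uU [c e]; exists (u^-1 * c).
by rewrite -mulrA -e mulKr.
Qed.

Lemma prime_prod p u (s : seq R) : prime_elt p -> u \is a GRing.unit ->
  divides p (u * \prod_(q <- s) q) -> exists2 q, q \in s & divides p q.
Proof.
move=> pp uU /(prime_unitMl uU); elim: s => [|q s IH].
  by rewrite big_nil => /(prime_notdiv1 pp).
rewrite big_cons; case: pp => [? ? h] /h [pq|/IH [r rs pr]].
  by exists q; rewrite ?mem_head.
by exists r; rewrite // inE rs orbT.
Qed.

Lemma divides_prime p q : prime_elt p -> prime_elt q -> divides p q ->
  exists2 w, w \is a GRing.unit & q = w * p.
Proof.
move=> pp [q0 qU hq] [w e]; exists w => //.
have [[c ec]|[c ec]] : divides q w \/ divides q p.
  by apply: hq; rewrite -e; apply: divides_refl.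
  case: pp => _ /negP[]; apply/unitrPr; exists c; apply: (mulIf q0).
  have -> : p * c * q = c * q * p by ring.
  by rewrite -ec -e mul1r.
apply/unitrPr; exists c; apply: (mulIf q0).
have -> : w * c * q = w * (c * q) by ring.
by rewrite -ec -e mul1r.
Qed.

End Divisibility.

Section Gauss.
Variable R : idomainType.
Hypothesis factR : factorial_ring R.
Implicit Types (p q r f g : {poly R}) (c : R).

Lemma divides_polyC c p : divides c%:P p <-> forall i, divides c p`_i.
Proof.
split=> [[q ->] i|h]; first by rewrite coefMC; exists q`_i.
have [F hF] : exists F : nat -> R, forall i, (i < size p)%N -> p`_i = F i * c.
  elim: (size p) => [|n [F hF]]; first by exists (fun=> 0).
  have [d hd] := h n; exists (fun i => if i == n then d else F i) => i.
  by rewrite ltnS leq_eqVlt; case: eqP => [->|_] //= /hF.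
exists (\poly_(i < size p) F i); apply/polyP => i.
rewrite coefMC coef_poly; case: ltnP => [/hF //|/leq_sizeP ->] //.
by rewrite mul0r.
Qed.

(** Gauss: take the first coefficients of two factors that [c] does not divide;
    they produce a coefficient of the product that [c] does not divide. *)
Lemma prime_polyC c : prime_elt c -> prime_elt c%:P.
Proof.
move=> [c0 cU hc]; split.
- by rewrite polyC_eq0.
- by rewrite poly_unitE size_polyC c0 coefC eqxx.
have first_bad f : ~ divides c%:P f -> exists2 i, ~ divides c f`_i &
    forall j, (j < i)%N -> divides c f`_j.
  move=> nf; have [i] : exists i, ~ divides c f`_i.
    apply: boolp.contrapT => hn; apply: nf; apply/divides_polyC => i.
    by apply: boolp.contrapT => hi; apply: hn; exists i.
  elim/ltn_ind: i => i IH hi.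
  have [hj|hj] := boolp.pselect (forall j, (j < i)%N -> divides c f`_j).
    by exists i.
  have [j [ji hj']] : exists j, (j < i)%N /\ ~ divides c f`_j.
    apply: boolp.contrapT => hn; apply: hj => j ji.
    by apply: boolp.contrapT => hj'; apply: hn; exists j.
  exact: IH hj'.
move=> f g fg; apply: boolp.contrapT => /boolp.not_orP[/first_bad[i fi fl]].
move=> /first_bad[j gj gl].
move/divides_polyC/(_ (i + j)%N): fg; rewrite coefM.
have lti : (i < (i + j).+1)%N by rewrite ltnS leq_addr.
rewrite (bigD1 (Ordinal lti)) //= addKn addrC => hd.
have : divides c (f`_i * g`_j).
  apply: divides_addr hd; apply: divides_sum => l nl.
  have [li|il] := ltnP l i; first by apply: dividesMr; apply: fl.
  apply: dividesMl; apply: gl.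
  have : (i < l)%N by rewrite ltn_neqAle il andbT eq_sym; apply: nl.
  by have := ltn_ord l; lia.
by case/hc.
Qed.

Lemma prime_neq0 (S : idomainType) (c : S) : prime_elt c -> c != 0.
Proof. by case. Qed.

Definition primitive f := forall c, prime_elt c -> ~ divides c%:P f.

(** A constant common denominator can be removed from a factorisation one
    prime at a time, since constant primes stay prime. *)
Lemma factor_clear_const c p q r : c != 0 -> c%:P * p = q * r ->
  exists q' r', [/\ p = q' * r', size q' = size q & size r' = size r].
Proof.
move=> /factR[u [s [uU]]]; elim: s c p q r => [|a s IH] c p q r ps.
  rewrite big_nil mulr1 => -> e; exists (u^-1 *: q), r; split=> //.
    by rewrite -scalerAl -e mul_polyC scalerA mulVr ?scale1r.
  by rewrite size_scale // invr_eq0; apply: contraTneq uU => ->; rewrite unitr0.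
have pa : prime_elt a by apply: ps; rewrite mem_head.
have a0 := prime_neq0 pa; have a0' : a%:P != 0 by rewrite polyC_eq0.
rewrite big_cons mulrCA => -> e.
have ps' : {in s, forall x, prime_elt x} by move=> x xs; apply: ps; rewrite inE xs orbT.
have [|[q1 eq]|[r1 er]] := @prime_dividesM _ _ q r (prime_polyC pa).
- by exists ((u * \prod_(j <- s) j)%:P * p); rewrite -e polyCM; ring.
- have [|q' [r' [-> sq sr]]] := IH _ p q1 r ps' erefl.
    apply: (mulfI a0'); rewrite mulrA -polyCM e eq; ring.
  by exists q', r'; split=> //; rewrite sq eq mulrC mul_polyC size_scale.
have [|q' [r' [-> sq sr]]] := IH _ p q r1 ps' erefl.
  apply: (mulfI a0'); rewrite mulrA -polyCM e er; ring.
by exists q', r'; split=> //; rewrite sr er mulrC mul_polyC size_scale.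
Qed.

(** The constant coming from the pseudo-division is removed prime by prime: its
    prime factors do not divide [p]. *)
Lemma primitive_divides p g : primitive p -> p %| g -> divides p g.
Proof.
move=> prp /Pdiv.Idomain.dvdpP[[c r] /= c0]; rewrite -mul_polyC.
have [u [s [uU + ->]]] := factR c0; elim: s r => [|a s IH] r ps.
  rewrite big_nil mulr1 => e; exists (u^-1 *: r).
  by rewrite -scalerAl -e mul_polyC scalerA mulVr ?scale1r.
have pa : prime_elt a by apply: ps; rewrite mem_head.
have a0 := prime_neq0 pa; have a0' : a%:P != 0 by rewrite polyC_eq0.
rewrite big_cons mulrCA => e.
have [|[q1 eq]|/(prp _ pa)//] := @prime_dividesM _ _ r p (prime_polyC pa).
  by exists ((u * \prod_(j <- s) j)%:P * g); rewrite -e polyCM; ring.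
apply: (IH q1) => [x xs|]; first by apply: ps; rewrite inE xs orbT.
by apply: (mulfI a0'); rewrite mulrA -polyCM e eq; ring.
Qed.

(** Over the field of fractions [p] stays irreducible, so there it divides one of
    the factors; being primitive, it already divides it with coefficients in [R]. *)
Lemma primitive_irreducible_prime p : primitive p -> (1 < size p)%N ->
  (forall q r, p = q * r -> size q = 1%N \/ size r = 1%N) -> prime_elt p.
Proof.
move=> prp szp irr.
have p0 : p != 0 by rewrite -size_poly_gt0 ltnW.
have ip : irreducible_poly p.
  split=> // q sq /Pdiv.Idomain.dvdpP[[c r] /= c0]; rewrite -mul_polyC.
  move=> e; have [r' [q' [ep sr sq']]] := factor_clear_const c0 e.
  have [h|h] := irr _ _ ep; last by rewrite -sq' h in sq.
  rewrite -dvdp_size_eqp; last first.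
    by apply/Pdiv.Idomain.dvdpP; exists (c, r); rewrite //= -mul_polyC.
  rewrite ep size_mul; last 2 first.
  - by apply: contraNneq p0 => r0; rewrite ep r0 mul0r.
  - by apply: contraNneq p0 => r0; rewrite ep r0 mulr0.
  by rewrite h sq'.
split=> //.
  by rewrite poly_unitE gtn_eqF.
move=> f g [h e].
have [co|nco] := boolP (coprimep p f).
  right; apply: primitive_divides => //.
  by rewrite -(Gauss_dvdpr _ co) e dvdp_mull.
left; apply: primitive_divides => //.
have := ip.2 (gcdp p f); rewrite -coprimep_def nco dvdp_gcdl => /(_ isT isT).
by move/eqp_dvdl <-; apply: dvdp_gcdr.
Qed.

Lemma factorial_split a b : (exists u (s : seq {poly R}),
    [/\ u \is a GRing.unit, {in s, forall p, prime_elt p} &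
        a = u * \prod_(p <- s) p]) -> (exists u (s : seq {poly R}),
    [/\ u \is a GRing.unit, {in s, forall p, prime_elt p} &
        b = u * \prod_(p <- s) p]) -> exists u (s : seq {poly R}),
    [/\ u \is a GRing.unit, {in s, forall p, prime_elt p} &
        a * b = u * \prod_(p <- s) p].
Proof.
move=> [u [s [uU ps ->]]] [v [t [vU pt ->]]]; exists (u * v), (s ++ t); split.
- by rewrite unitrM uU.
- by move=> p; rewrite mem_cat => /orP[/ps|/pt].
- by rewrite big_cat /=; ring.
Qed.

(** Pulling out constant primes terminates because each of them uses up a prime
    factor of the leading coefficient. *)
Lemma content p : p != 0 -> exists (s : seq R) q,
  [/\ {in s, forall c, prime_elt c}, p = (\prod_(c <- s) c)%:P * q & primitive q].
Proof.
rewrite -lead_coef_eq0 => /factR[u [s [uU ps e]]].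
have [n sz] := ubnP (size s); elim: n p u s sz uU ps e => // n IH p u s.
rewrite ltnS => sz uU ps e.
have [prp|] := boolp.pselect (primitive p).
  by exists [::], p; rewrite big_nil mul1r; split.
move=> /boolp.existsNP[a /boolp.not_implyP[pa /boolp.contrapT[q eq]]].
have a0 := prime_neq0 pa.
have el : lead_coef p = lead_coef q * a by rewrite eq lead_coefM lead_coefC.
have [b bs ab] : exists2 b, b \in s & divides a b.
  by apply: (prime_prod pa uU); rewrite -e el; exists (lead_coef q).
have [w wU ew] := divides_prime pa (ps _ bs) ab.
have [||||t [r [pt er pr]]] := IH q (u * w) (rem b s).
- by rewrite size_rem // (leq_trans _ sz) // prednK //; case: (s) bs.
- by rewrite unitrM uU.
- by move=> x /mem_rem /ps.
- apply: (mulIf a0); rewrite -el e (perm_big _ (perm_to_rem bs)) big_cons ew /=.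
  by ring.
exists (a :: t), r; split=> //.
  by move=> x; rewrite inE => /orP[/eqP->|/pt].
by rewrite eq er big_cons polyCM; ring.
Qed.

(** Induction on the degree, once the content has been split off. *)
Lemma factorial_poly : factorial_ring {poly R}.
Proof.
move=> p; have [n] := ubnP (size p); elim: n p => // n IH p.
rewrite ltnS => sz p0; have [s [q [ps e prq]]] := content p0.
have q0 : q != 0 by apply: contraNneq p0 => q0; rewrite e q0 mulr0.
have szq : (size q <= n)%N.
  have := sz; rewrite e mul_polyC size_scale //.
  by apply: contraNneq p0 => c0; rewrite e c0 mul0r.
rewrite e; apply: factorial_split.
  exists 1, [seq c%:P | c <- s]; split; rewrite ?unitr1 //.
    by move=> _ /mapP[c cs ->]; apply/prime_polyC/ps.
  by rewrite mul1r big_map rmorph_prod.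
have [sq1|sq1] := leqP (size q) 1.
  rewrite (size1_polyC sq1); have c0 : q`_0 != 0.
    by move: q0; rewrite {1}(size1_polyC sq1) polyC_eq0.
  have [u [t [uU pt ->]]] := factR c0.
  exists u%:P, [seq c%:P | c <- t]; split.
  - by rewrite rmorph_unit.
  - by move=> _ /mapP[c ct ->]; apply/prime_polyC/pt.
  - by rewrite big_map polyCM rmorph_prod.
have [irr|] := boolp.pselect
    (forall f g, q = f * g -> size f = 1%N \/ size g = 1%N).
  exists 1, [:: q]; split; rewrite ?unitr1 ?big_seq1 ?mul1r // => x.
  by rewrite inE => /eqP->; apply: primitive_irreducible_prime.
move=> /boolp.existsNP[f /boolp.existsNP[g /boolp.not_implyP[efg]]].
move=> /boolp.not_orP[sf sg].
have f0 : f != 0 by apply: contraNneq q0 => z; rewrite efg z mul0r.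
have g0 : g != 0 by apply: contraNneq q0 => z; rewrite efg z mulr0.
have := szq; rewrite efg size_mul // => sfg.
have f1 : (0 < size f)%N by rewrite size_poly_gt0.
have g1 : (0 < size g)%N by rewrite size_poly_gt0.
by apply: factorial_split; apply: IH => //; lia.
Qed.

End Gauss.

Section FactorialMpoly.

Lemma factorial_transfer (R S : idomainType) (f : {rmorphism R -> S})
    (g : {rmorphism S -> R}) :
  cancel f g -> cancel g f -> factorial_ring R -> factorial_ring S.
Proof.
move=> fK gK factR a a0.
have ga0 : g a != 0.
  by apply: contra_neq a0 => /(congr1 f); rewrite gK rmorph0.
have [u [s [uU ps e]]] := factR _ ga0.
exists (f u), (map f s); split.
- exact: rmorph_unit.
- move=> _ /mapP[p /ps[p0 pU hp] ->]; split.
  + by apply: contra_neq p0 => /(congr1 g); rewrite fK rmorph0.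
  + by apply: contraNN pU => /(rmorph_unit g); rewrite fK.
  + move=> b c [d ed]; have : divides p (g b * g c).
      by exists (g d); rewrite -rmorphM ed rmorphM fK.
    by case/hp => -[d' ed']; [left|right]; exists (f d');
       rewrite -rmorphM -ed' gK.
- by rewrite big_map -rmorph_prod -rmorphM -e gK.
Qed.

Variable k : fieldType.

(** Singling out the last variable identifies [{mpoly k[n.+1]}] with
    [{poly {mpoly k[n]}}]. *)
Lemma factorial_mpoly n : factorial_ring {mpoly k[n]}.
Proof.
elim: n => [|n IH].
  move=> a a0; exists a, [::]; split=> //; last by rewrite big_nil mulr1.
  rewrite (nvar0_mpolyC a) in a0 *; rewrite mpolyC_eq0 in a0.
  by rewrite rmorph_unit // unitfE.
pose h (i : 'I_n.+1) : {poly {mpoly k[n]}} :=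
  if unlift ord_max i is Some j then ('X_j)%:P else 'X.
(* Morphisms are compared on generators, so only these values are recorded. *)
have [g [gC gX]] : exists g : {rmorphism {mpoly k[n.+1]} -> {poly {mpoly k[n]}}},
    (forall c, g c%:MP = (c%:MP)%:P) /\ (forall i, g 'X_i = h i).
  exists (mmap (polyC \o @mpolyC n k) h); split=> [c|i]; first exact: mmapC.
  by rewrite /= mmapX mmap1U.
have [wd [wdC wdX]] : exists wd : {rmorphism {mpoly k[n]} -> {mpoly k[n.+1]}},
    (forall c, wd c%:MP = c%:MP) /\ (forall i, wd 'X_i = 'X_(lift ord_max i)).
  exists (mmap (@mpolyC n.+1 k) (fun i => 'X_(lift ord_max i))).
  by split=> [c|i]; [exact: mmapC | rewrite /= mmapX mmap1U].
have [f [fC fX]] : exists f : {rmorphism {poly {mpoly k[n]}} -> {mpoly k[n.+1]}},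
    (forall c, f c%:P = wd c) /\ f 'X = 'X_ord_max.
  exists (horner_eval 'X_ord_max \o map_poly wd).
  by split=> [c|]; rewrite /= ?map_polyC ?map_polyX /horner_eval ?hornerC ?hornerX.
have wdK p : g (wd p) = p%:P.
  elim/mpolyind: p => [|c m p _ _ IHp]; first by rewrite !rmorph0.
  rewrite -mul_mpolyC mpolyXE_id !(rmorphD, rmorphM) IHp wdC gC !rmorph_prod.
  congr (_ * _ + _); apply: eq_bigr => i _.
  by rewrite !rmorphXn wdX gX /h liftK.
apply: (factorial_transfer (f := f) (g := g)); last exact: factorial_poly IH.
- move=> p; elim/poly_ind: p => [|p c IHp]; first by rewrite !rmorph0.
  by rewrite !(rmorphD, rmorphM) IHp fC fX wdK gX /h unlift_none.
- move=> p; elim/mpolyind: p => [|c m p _ _ IHp]; first by rewrite !rmorph0.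
  rewrite -mul_mpolyC mpolyXE_id !(rmorphD, rmorphM) IHp gC fC wdC !rmorph_prod.
  congr (_ * _ + _); apply: eq_bigr => i _.
  rewrite !rmorphXn gX /h; case: unliftP => [j|] ->; last by rewrite fX.
  by rewrite fC wdX.
Qed.

End FactorialMpoly.

Section Weights.
Variables (R : idomainType) (n : nat) (w : 'I_n -> nat).
Implicit Types p q : {mpoly R[n]}.

Definition wdeg (m : 'X_{1..n}) : nat := \sum_i w i * m i.

(** The substitution [X_i |-> X_i T^(w i)]: it turns the grading by weight into
    the degree in the single variable [T]. *)
Definition grade : {mpoly R[n]} -> {poly {mpoly R[n]}} :=
  mmap (polyC \o @mpolyC n R) (fun i => ('X_i)%:P * 'X^(w i)).
HB.instance Definition _ := GRing.RMorphism.copy grade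
  (mmap (polyC \o @mpolyC n R) (fun i => ('X_i)%:P * 'X^(w i))).

Lemma gradeX m : grade 'X_[m] = ('X_[m])%:P * 'X^(wdeg m).
Proof.
rewrite /grade mmapX /mmap1 [in RHS]mpolyXE_id rmorph_prod /wdeg.
rewrite -prodrXr -big_split /=; apply: eq_bigr => i _.
by rewrite exprMn rmorphXn exprM.
Qed.

Lemma gradeC c : grade c%:MP = (c%:MP)%:P.
Proof. by rewrite /grade mmapC. Qed.

Lemma gradeD p q : grade (p + q) = grade p + grade q.
Proof. exact: rmorphD. Qed.

Lemma gradeM p q : grade (p * q) = grade p * grade q.
Proof. exact: rmorphM. Qed.

Opaque grade.

Lemma coef_grade p j m : ((grade p)`_j)@_m = p@_m *+ (wdeg m == j).
Proof.
elim/mpolyind: p => [|c m' p _ _ IH].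
  by rewrite rmorph0 coef0 mcoeff0 mul0rn.
rewrite gradeD coefD [LHS]mcoeffD [X in X *+ _]mcoeffD mulrnDl.
congr (_ + _); last exact: IH.
rewrite -mul_mpolyC gradeM gradeC gradeX mulrA -polyCM coefCM coefXn.
rewrite mulr_natr mcoeffMn mul_mpolyC mcoeffZ mcoeffX.
have [->|ne] := eqVneq m' m; last by rewrite mulr0 !mul0rn.
by rewrite mulr1 eq_sym.
Qed.

End Weights.

Section Homogeneous.
Variables (R : idomainType) (n : nat).
Implicit Types p q : {mpoly R[n]}.

Lemma wdeg_mdeg (m : 'X_{1..n}) : wdeg (fun=> 1%N) m = mdeg m.
Proof. by rewrite /wdeg mdegE; under eq_bigr do rewrite mul1n. Qed.

Lemma dhomog_grade d p :
  p \is d.-homog -> grade (fun=> 1%N) p = p%:P * 'X^d.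
Proof.
move=> hp; apply/polyP => j; apply/mpolyP => m.
apply: (etrans (coef_grade _ p j m)).
rewrite wdeg_mdeg coefCM coefXn mulr_natr [RHS]mcoeffMn.
have [/eqP->|md] := boolP (mdeg m == d); first by rewrite eq_sym.
by rewrite (dhomog_nemf_coeff hp md) !mul0rn.
Qed.

Lemma grade_dhomog d p a :
  grade (fun=> 1%N) p = a%:P * 'X^d -> p \is d.-homog.
Proof.
move=> e; apply/dhomogP => m; rewrite mcoeff_msupp => pm.
have := coef_grade (fun=> 1%N) p (mdeg m) m.
rewrite e wdeg_mdeg eqxx coefCM coefXn mulr_natr mulr1n.
case: eqP => // _; rewrite mulr0n mcoeff0 => /eqP.
by rewrite eq_sym (negPf pm).
Qed.

(** At 0 the factors have multiplicities adding up to at most [d]; after removing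
    them, the product is a nonzero constant. *)
Lemma poly_factor_monomial (S : idomainType) (f g : {poly S}) c d :
  c != 0 -> f * g = c%:P * 'X^d -> exists a e, f = a%:P * 'X^e.
Proof.
move=> c0 e.
have fg0 : f * g != 0 by rewrite e mulf_neq0 ?polyC_eq0 ?polyXn_eq0 //; rewrite -size_poly_eq0 size_polyXn.
have f0 : f != 0 by apply: contraNneq fg0 => ->; rewrite mul0r.
have g0 : g != 0 by apply: contraNneq fg0 => ->; rewrite mulr0.
have [i [f1 +] ef] := multiplicity_XsubC f 0.
have [j [g1 +] eg] := multiplicity_XsubC g 0.
rewrite f0 g0 polyC0 !subr0 /= in ef eg * => g10 f10.
have fg1 : f1 * g1 = c%:P.
  have [h|h] := leqP (i + j) d; last first.
    have /eqP := congr1 (fun h : {poly S} => h`_d) e; rewrite coefCM coefXn eqxx mulr1.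
    rewrite ef eg mulrACA -exprD coefMXn h eq_sym.
    by rewrite (negPf c0).
  have : f1 * g1 = c%:P * 'X^(d - (i + j)).
    apply: (mulIf (_ : 'X^(i + j) != 0)); first by rewrite -size_poly_eq0 size_polyXn.
    by rewrite -[RHS]mulrA -exprD subnK // -e ef eg exprD; ring.
  case: (d - (i + j))%N => [|l]; first by rewrite expr0 mulr1.
  move/(congr1 (horner^~ 0)); rewrite !hornerE /= expr0n /= mulr0 => /eqP.
  by rewrite mulf_eq0 -!rootE (negPf f10) (negPf g10).
have : size (f1 * g1) = 1%N by rewrite fg1 size_polyC c0.
have f11 : f1 != 0 by apply: contraNneq f10 => ->; rewrite root0.
have g11 : g1 != 0 by apply: contraNneq g10 => ->; rewrite root0.
rewrite size_mul // => s1.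
have sf : (0 < size f1)%N by rewrite size_poly_gt0.
have sg : (0 < size g1)%N by rewrite size_poly_gt0.
exists f1`_0, i; rewrite ef -size1_polyC //.
by move: s1 sf sg; case: (size f1) => [|[|x]] //; case: (size g1) => [|y] //=;
   rewrite !addSn addnS.
Qed.

(** In the grading variable the product is a monomial, hence so are its factors. *)
Lemma dhomog_factor d p q : p * q != 0 -> p * q \is d.-homog ->
  exists i j, [/\ p \is i.-homog, q \is j.-homog & d = (i + j)%N].
Proof.
move=> pq0 /[dup] hpq /dhomog_grade; rewrite gradeM => e.
have [a [i /grade_dhomog hp]] := poly_factor_monomial pq0 e.
have [b [j /grade_dhomog hq]] : exists a e, grade (fun=> 1%N) q = a%:P * 'X^e.
  by apply: (poly_factor_monomial pq0); rewrite mulrC; apply: e.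
exists i, j; split=> //; apply: (dhomog_uniq pq0 hpq); exact: dhomogM.
Qed.

Lemma divides_dhomog p q d : q != 0 -> q \is d.-homog -> divides p q ->
  exists i j r, [/\ p \is i.-homog, r \is j.-homog, q = r * p & d = (i + j)%N].
Proof.
move=> q0 hq [r e]; rewrite e in q0 hq *.
have [j [i [hr hp ->]]] := dhomog_factor q0 hq.
by exists i, j, r; rewrite addnC.
Qed.

End Homogeneous.

(** By induction on the prime factors of [q]: each of them fails to divide some
    [A i], hence divides [w] and can be removed from both sides. *)
Lemma divides_cancel (R : idomainType) (I : Type) (A : I -> R) q w :
  factorial_ring R -> q != 0 -> (forall i, divides q (A i * w)) ->
  (forall p, prime_elt p -> divides p q -> exists i, ~ divides p (A i)) ->
  divides q w.
Proof.
move=> factR /factR[u [s [uU ps ->]]] {q}; elim: s w ps => [|a s IH] w ps.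
  by rewrite big_nil mulr1 => _ _; exists (w / u); rewrite divrK.
rewrite big_cons => h hp.
have pa : prime_elt a by apply: ps; rewrite mem_head.
have a0 := prime_neq0 pa.
have daq : divides a (u * (a * \prod_(p <- s) p)).
  by exists (u * \prod_(p <- s) p); ring.
have [i ni] := hp _ pa daq.
have [/ni//|[w' ew]] := prime_dividesM pa (divides_trans daq (h i)).
have [x xs|j|p pp hd|c ec] := IH w'.
- by apply: ps; rewrite inE xs orbT.
- have [c ec] := h j; exists c; apply: (mulIf a0).
  by rewrite -mulrA -ew ec; ring.
- apply: hp => //; apply: divides_trans hd _.
  by exists a; ring.
- by exists c; rewrite ew ec; ring.
Qed.

Lemma divides_prime_factor (R : idomainType) (q : R) : factorial_ring R ->
  q != 0 -> q \isn't a GRing.unit -> exists2 p, prime_elt p & divides p q.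
Proof.
move=> factR /factR[u [[|a s] [uU ps ->]]].
  by rewrite big_nil mulr1 uU.
move=> _; exists a; first by apply: ps; rewrite mem_head.
by exists (u * \prod_(p <- s) p); rewrite big_cons; ring.
Qed.

(** * Squares and derivations in characteristic 2 *)

Section CharTwo.
Variable R : comNzRingType.
Hypothesis char2 : 2%N \in [pchar R].
Implicit Types a b c : R.

Lemma addxx a : a + a = 0.
Proof. exact: addrr_pchar2. Qed.

Lemma opp2 a : - a = a.
Proof. exact: oppr_pchar2. Qed.

(** Equality up to a double: the way in which cancellations are justified. *)
Lemma eq_mod2 c a b : a = b + c *+ 2 -> a = b.
Proof. by move=> ->; rewrite mulr2n addxx addr0. Qed.

Lemma sqrrD2 a b : (a + b) ^+ 2 = a ^+ 2 + b ^+ 2.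
Proof. by apply: (@eq_mod2 (a * b)); ring. Qed.

Lemma sqr_sum I (s : seq I) (P : pred I) (F : I -> R) :
  (\sum_(i <- s | P i) F i) ^+ 2 = \sum_(i <- s | P i) F i ^+ 2.
Proof.
elim/big_rec2: _ => [|i a b _ <-]; first by rewrite expr0n.
by rewrite sqrrD2.
Qed.

Lemma add_eq0_2 a b : a + b = 0 -> a = b.
Proof. by move/eqP; rewrite addr_eq0 opp2 => /eqP. Qed.

End CharTwo.

Lemma sqr_inj2 (R : idomainType) (char2 : 2%N \in [pchar R]) (a b : R) :
  a ^+ 2 = b ^+ 2 -> a = b.
Proof.
move/eqP; rewrite eqf_sqr; case/orP=> /eqP // ->.
exact: oppr_pchar2.
Qed.

Lemma ord3_third (i l : 'I_3) : exists j, (j != i) && (j != l).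
Proof.
have /card_gt0P[j] : (0 < #|~: [set i; l]|)%N.
  by rewrite cardsCs finset.setCK card_ord cards2; case: (_ != _).
by rewrite !inE negb_or => h; exists j.
Qed.

Section ClosedChar2.
Variable k : closedFieldType.
Hypothesis char_k : 2%N \in [pchar k].

Lemma sqrt_exists (c : k) : exists d, d ^+ 2 == c.
Proof.
have [x ex] := @solve_monicpoly k 2 (fun i => if i == 0%N then c else 0) isT.
exists x; rewrite ex !big_ord_recl big_ord0 /= mul0r expr0 mulr1 !addr0.
by [].
Qed.

Definition rt (c : k) : k := xchoose (sqrt_exists c).

Lemma rtK c : rt c ^+ 2 = c.
Proof. exact/eqP/(xchooseP (sqrt_exists c)). Qed.

Lemma rt0 : rt 0 = 0.
Proof. by apply: (sqr_inj2 char_k); rewrite rtK expr0n. Qed.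

Lemma pchar_mpoly n : 2%N \in [pchar {mpoly k[n]}].
Proof. exact: (rmorph_pchar (@mpolyC n k)). Qed.

Local Notation char_P := (pchar_mpoly _).

Lemma mderivXi n (i j : 'I_n) : ('X_i : {mpoly k[n]})^`M(j) = (i == j)%:R.
Proof.
rewrite mderivX mnm1E; case: eqP => [->|_]; last by rewrite scale0r.
rewrite scale1r (_ : (_ - _)%MM = 0%MM) ?mpolyX0 //.
by apply/mnmP => l; rewrite mnmBE subnn mnmE.
Qed.

Lemma mderiv_sqr n i (p : {mpoly k[n]}) : (p ^+ 2)^`M(i) = 0.
Proof. by rewrite expr2 mderivM mulrC addxx // char_P. Qed.

(** All exponents are even and [k] is perfect. *)
Lemma mderiv_eq0_sqr n (p : {mpoly k[n]}) :
  (forall i, p^`M(i) = 0) -> exists r, p = r ^+ 2.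
Proof.
move=> dp; rewrite [p]mpolyE big_seq.
elim/big_ind: _ => [|_ _ [a ->] [b ->]|m mp]; first by exists 0; rewrite expr0n.
  by exists (a + b); rewrite (sqrrD2 char_P).
exists (rt p@_m *: 'X_[[multinom (m i)./2 | i < n]]).
rewrite exprZn rtK mpolyXn; congr (_ *: 'X_[_]); apply/mnmP => i.
rewrite mulmnE mnmE muln2 -[LHS]odd_double_half.
case: (boolP (odd (m i))) => [|//].
move=> om; move: mp; rewrite mcoeff_msupp => /negP[]; apply/eqP.
have := congr1 (mcoeff (m - U_(i))%MM) (dp i).
rewrite mcoeff_deriv mcoeff0 submK; last by rewrite lep1mP; case: (m i) om.
rewrite mnmBE mnm1E eqxx subn1 prednK; last by case: (m i) om.
have -> : p@_m *+ m i = p@_m; last by [].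
rewrite -(odd_double_half (m i)) om mulrnDr -muln2 mulnC mulrnA mulr2n.
by rewrite (addxx char_k) mul0rn addr0.
Qed.

Lemma msize_mderiv n i (p : {mpoly k[n]}) :
  p^`M(i) != 0 -> (msize p^`M(i) < msize p)%N.
Proof.
move=> nz; rewrite -(mlead_deg nz); have := mlead_supp nz.
rewrite mcoeff_msupp mcoeff_deriv => h.
have : (mlead p^`M(i) + U_(i))%MM \in msupp p.
  by rewrite mcoeff_msupp; apply: contra_neq h => ->; rewrite mul0rn.
by move/msize_mdeg_lt; rewrite mdegD mdeg1 addn1.
Qed.

Lemma divides_msize n (p q : {mpoly k[n]}) :
  q != 0 -> divides p q -> (msize p <= msize q)%N.
Proof.
move=> q0 [r e]; move: q0; rewrite e mulf_eq0 negb_or => /andP[r0 p0].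
rewrite msizeM //; have := mpolySpred mdeg r0.
by case: (msize r) => // m _; rewrite addSn /= leq_addl.
Qed.

(** Derivatives have smaller size, so a prime dividing all of them would have
    vanishing derivatives and be a square. *)
Lemma prime_mderiv n (p : {mpoly k[n]}) :
  prime_elt p -> exists i, ~ divides p p^`M(i).
Proof.
move=> pp; apply: boolp.contrapT => /boolp.forallNP hp.
have [r e] : exists r, p = r ^+ 2.
  apply: mderiv_eq0_sqr => i; have [//|nz] := eqVneq p^`M(i) 0.
  have /divides_msize : divides p p^`M(i) by apply: boolp.contrapT; apply: hp.
  by move=> /(_ nz); rewrite leqNgt msize_mderiv.
have p0 := prime_neq0 pp.
have r0 : r != 0 by apply: contraNneq p0 => z; rewrite e z expr0n.
have [c ec] : divides p r.
  by case: (@prime_dividesM _ p r r pp) => //; rewrite -expr2 -e; apply: divides_refl.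
apply: (@prime_notdiv1 _ p pp); exists (c ^+ 2).
by apply: (mulIf p0); rewrite mul1r {1}e {1}ec; ring.
Qed.

Local Notation P := {mpoly k[3]}.
Implicit Types (b : 'I_3 -> P) (p q : P).

(** The coefficients [cross b i j] are those of the twisted 1-form that
    annihilates the vector field [vf b]. *)
Definition cross b i j : P := b i ^+ 2 * 'X_j + b j ^+ 2 * 'X_i.

Definition vf b p : P := \sum_i b i ^+ 2 * p^`M(i).

Lemma vfD b p q : vf b (p + q) = vf b p + vf b q.
Proof. by rewrite /vf -big_split; apply: eq_bigr => i _; rewrite mderivD mulrDr. Qed.

Lemma vfM b p q : vf b (p * q) = p * vf b q + q * vf b p.
Proof.
rewrite /vf !big_distrr -big_split; apply: eq_bigr => i _ /=.
by rewrite mderivM; ring.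
Qed.

Lemma vfX b i : vf b 'X_i = b i ^+ 2.
Proof.
rewrite /vf (bigD1 i) //= big1 ?addr0 => [|j ji]; first by rewrite mderivXi eqxx mulr1.
by rewrite mderivXi eq_sym (negPf ji) mulr0.
Qed.

Lemma vfC b c : vf b c%:MP = 0.
Proof. by rewrite /vf big1 // => i _; rewrite mderivC mulr0. Qed.

Lemma vf_sqr b p : vf b (p ^+ 2) = 0.
Proof. by rewrite expr2 vfM addxx ?char_P. Qed.

(** The derivation [d_s p * d_t + d_t p * d_s] is tangent to the curve [p = 0],
    hence preserves divisibility by [p].  Applied to the forms [cross b i j] it
    shows that a common prime factor of all of them divides its derivatives. *)
Lemma prime_cross b p : prime_elt p -> (exists i, ~ divides p (b i)) ->
  exists i j, ~ divides p (cross b i j).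
Proof.
move=> pp [i ni]; apply: boolp.contrapT => hn.
have hc i' j' : divides p (cross b i' j').
  by apply: boolp.contrapT => h; apply: hn; exists i', j'.
pose T s t (f : P) := p^`M(s) * f^`M(t) + p^`M(t) * f^`M(s).
have hT s t f : divides p f -> divides p (T s t f).
  move=> [u ->]; exists (p^`M(s) * u^`M(t) + p^`M(t) * u^`M(s)).
  apply: (@eq_mod2 _ char_P (p^`M(s) * p^`M(t) * u)).
  by rewrite /T !mderivM; ring.
have TE s t l j : T s t (cross b l j) =
    b l ^+ 2 * (p^`M(s) * (j == t)%:R + p^`M(t) * (j == s)%:R) +
    b j ^+ 2 * (p^`M(s) * (l == t)%:R + p^`M(t) * (l == s)%:R).
  have dsq (f g : P) i' : (f ^+ 2 * g)^`M(i') = f ^+ 2 * g^`M(i').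
    by rewrite mderivM mderiv_sqr mul0r add0r.
  by rewrite /T /cross !mderivD !dsq !mderivXi; ring.
have cancel f : divides p (b i ^+ 2 * f) -> divides p f.
  by case/(prime_dividesM pp) => //; rewrite expr2 => /(prime_dividesM pp)[].
have hl l : l != i -> divides p p^`M(l).
  move=> li; have [j /andP[ji jl]] := ord3_third i l.
  apply: cancel; have := hT j l _ (hc i j); rewrite TE eqxx.
  rewrite (negPf jl) (eq_sym i l) (negPf li) (eq_sym i j) (negPf ji) /=.
  by rewrite !mulr0 !addr0 mulr0 add0r addr0 mulr1.
have [l nl] := prime_mderiv pp.
have [li|/hl//] := eqVneq l i; rewrite li in nl; apply: nl; apply: cancel.
have [j /andP[ji _]] := ord3_third i i.
have := hT i j _ (hc i j); rewrite TE !eqxx (eq_sym i j) (negPf ji) /=.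
rewrite !mulr0 !mulr1 add0r addr0 addrC; apply: divides_addr.
by apply: dividesMl; apply: hl.
Qed.

End ClosedChar2.

(** * Forms on the projective plane *)

Section Forms.
Variable k : closedFieldType.
Local Notation P := {mpoly k[3]}.
Implicit Types (p q : P) (v w : 'rV[k]_3) (A B C : 'M[k]_3).

Lemma hevalD p q v : heval (p + q) v = heval p v + heval q v.
Proof. exact: mevalD. Qed.
Lemma hevalM p q v : heval (p * q) v = heval p v * heval q v.
Proof. exact: mevalM. Qed.
Lemma hevalB p q v : heval (p - q) v = heval p v - heval q v.
Proof. exact: mevalB. Qed.
Lemma hevalC c v : heval c%:MP v = c.
Proof. exact: mevalC. Qed.
Lemma hevalZ c p v : heval (c *: p) v = c * heval p v.
Proof. exact: mevalZ. Qed.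
Lemma hevalXi i v : heval 'X_i v = v 0 i.
Proof. exact: mevalXU. Qed.
Lemma heval0 v : heval 0 v = 0.
Proof. exact: meval0. Qed.
Lemma heval1 v : heval 1 v = 1.
Proof. exact: meval1. Qed.
Lemma heval_exp p n v : heval (p ^+ n) v = heval p v ^+ n.
Proof. exact: (rmorphXn (meval _)). Qed.
Lemma heval_sum I (s : seq I) (R : pred I) (F : I -> P) v :
  heval (\sum_(i <- s | R i) F i) v = \sum_(i <- s | R i) heval (F i) v.
Proof. exact: (raddf_sum (meval _)). Qed.

Lemma heval_scale d p c v : p \is d.-homog -> heval p (c *: v) = c ^+ d * heval p v.
Proof.
move=> hp; rewrite /heval !mevalE big_distrr /= !big_seq; apply: eq_bigr => m mp.
rewrite mulrCA; congr (_ * _); rewrite -(dhomog_mf hp mp) /= mdegE -prodrXr -big_split /=.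
by apply: eq_bigr => i _; rewrite mxE exprMn.
Qed.

(** A zero exists on the line [X_2 = 0]: otherwise [p] would restrict to nonzero
    constants on the two affine charts of the line, and comparing them would make
    every nonzero element of [k] a root of unity of order dividing [d]. *)
Lemma homog_zero d p : p \is d.-homog -> (0 < d)%N ->
  exists2 v : 'rV[k]_3, v != 0 & heval p v = 0.
Proof.
move=> hp d0; apply: boolp.contrapT => hn.
have nz v : v != 0 -> heval p v != 0 by move=> v0; apply/eqP => h; apply: hn; exists v.
pose pt2 (s t : k) := pt s t 0.
have lin_const (f : 'I_3 -> {poly k}) (g : k -> 'rV[k]_3) :
    (forall t i, (f i).[t] = g t 0 i) -> (forall t, g t != 0) ->
    exists c, forall t, heval p (g t) = c.
  move=> fg g0; pose h := mmap (@polyC k) f p.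
  have hE t : h.[t] = heval p (g t).
    rewrite /h /mmap /heval mevalE horner_sum; apply: eq_bigr => m _.
    rewrite hornerM hornerC; congr (_ * _); rewrite /mmap1 horner_prod.
    by apply: eq_bigr => i _; rewrite horner_exp fg.
  have [/closed_rootP[t]|] := boolP (size h != 1%N).
    by rewrite /root hE (negPf (nz _ (g0 t))).
  rewrite negbK => /eqP s1; exists h`_0 => t.
  by rewrite -hE (size1_polyC (eq_leq s1)) hornerC coefC.
have pt_neq0 s t : (s != 0) || (t != 0) -> pt2 s t != 0.
  by apply: contraTneq => /rowP e; move: (e 0) (e 1); rewrite !mxE /= => -> ->; rewrite eqxx.
have [c hc] : exists c, forall t, heval p (pt2 1 t) = c.
  apply: (lin_const (fun i => [:: 1; 'X; 0]`_i)).
    by move=> t [[|[|[|//]]] ?]; rewrite mxE /= !hornerE.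
  by move=> t; rewrite pt_neq0 ?oner_eq0.
have [c' hc'] : exists c, forall t, heval p (pt2 t 1) = c.
  apply: (lin_const (fun i => [:: 'X; 1; 0]`_i)).
    by move=> t [[|[|[|//]]] ?]; rewrite mxE /= !hornerE.
  by move=> t; rewrite pt_neq0 ?oner_eq0 ?orbT.
have td (t : k) : t != 0 -> t ^+ d = 1.
  move=> t0; have e : pt2 1 t = t *: pt2 t^-1 1.
    by apply/rowP => -[[|[|[|//]]] ?]; rewrite !mxE /= ?mulr1 ?mulr0 // mulfV.
  have cc : c = c' by rewrite -(hc 1) -(hc' 1).
  have : c = t ^+ d * c by rewrite -{1}(hc t) e (heval_scale _ _ hp) hc' -cc.
  move/eqP; rewrite -{1}[c]mul1r => /eqP/mulIf ->//.
  by rewrite -(hc 1) nz // pt_neq0 ?oner_eq0.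
(* A root of X^2 - X - 1 is neither 0 nor 1, and it has a [d]-th root [b]. *)
have [a /eqP ea] : exists a : k, root ('X^2 - ('X + 1%:P)) a.
  by apply/closed_rootP; rewrite size_polyDl ?size_polyXn // size_polyN size_XaddC.
rewrite !hornerE in ea.
have a0 : a != 0.
  apply/eqP => a0; move: ea; rewrite a0 expr0n /= !add0r => /eqP.
  by rewrite oppr_eq0 oner_eq0.
have [b eb] := @solve_monicpoly k d (fun i => if i == 0%N then a else 0) d0.
have {}eb : b ^+ d = a.
  rewrite eb; case: (d) d0 => // d' _; rewrite big_ord_recl /= expr0 mulr1.
  by rewrite big1 ?addr0 // => i _; rewrite mul0r.
have b0 : b != 0.
  by apply: contraNneq a0 => b0; rewrite -eb b0 expr0n; case: (d) d0.
have a1 : a = 1 by rewrite -eb td.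
move: ea; rewrite a1 expr1n opprD addrA subrr add0r => /eqP.
by rewrite oppr_eq0 oner_eq0.
Qed.

(** Linear substitutions; with row vectors as points, [subst B] is the pullback
    along [v |-> v *m B]. *)
Definition subst B : P -> P :=
  mmap (@mpolyC 3 k) (fun i => \sum_j B j i *: 'X_j).
HB.instance Definition _ B := GRing.RMorphism.copy (subst B)
  (mmap (@mpolyC 3 k) (fun i => \sum_j B j i *: 'X_j)).

Lemma substD B p q : subst B (p + q) = subst B p + subst B q.
Proof. exact: rmorphD. Qed.
Lemma substM B p q : subst B (p * q) = subst B p * subst B q.
Proof. exact: rmorphM. Qed.
Lemma subst0 B : subst B 0 = 0.
Proof. exact: rmorph0. Qed.
Lemma substC B c : subst B c%:MP = c%:MP.
Proof. exact: mmapC. Qed.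
Lemma substXi B i : subst B 'X_i = \sum_j B j i *: 'X_j.
Proof. by rewrite /subst mmapX mmap1U. Qed.
Lemma substZ B c p : subst B (c *: p) = c *: subst B p.
Proof. by rewrite -!mul_mpolyC substM substC. Qed.
Lemma subst_sum B I (s : seq I) (R : pred I) (F : I -> P) :
  subst B (\sum_(i <- s | R i) F i) = \sum_(i <- s | R i) subst B (F i).
Proof. exact: rmorph_sum. Qed.
Lemma subst_exp B p n : subst B (p ^+ n) = subst B p ^+ n.
Proof. exact: rmorphXn. Qed.
Lemma subst_prod B I (s : seq I) (R : pred I) (F : I -> P) :
  subst B (\prod_(i <- s | R i) F i) = \prod_(i <- s | R i) subst B (F i).
Proof. exact: rmorph_prod. Qed.

Lemma mpoly_gen_ind (Q : P -> Prop) : (forall c, Q c%:MP) -> (forall i, Q 'X_i) ->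
  (forall p q, Q p -> Q q -> Q (p + q)) -> (forall p q, Q p -> Q q -> Q (p * q)) ->
  forall p, Q p.
Proof.
move=> hC hX hD hM p; rewrite [p]mpolyE.
have h1 : Q 1 by rewrite -mpolyC1; apply: hC.
have h0 : Q 0 by rewrite -mpolyC0; apply: hC.
apply: (big_ind Q h0 hD) => m _; rewrite -mul_mpolyC mpolyXE_id; apply: (hM) => //.
apply: (big_ind Q h1 hM) => i _; elim: (m i) => [|n IH]; first by rewrite expr0.
by rewrite exprS; apply: (hM).
Qed.

Lemma heval_subst B p v : heval (subst B p) v = heval p (v *m B).
Proof.
elim/mpoly_gen_ind: p => [c|i|p q hp hq|p q hp hq].
- by rewrite substC !hevalC.
- rewrite substXi heval_sum hevalXi mxE; apply: eq_bigr => j _.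
  by rewrite hevalZ hevalXi mulrC.
- by rewrite substD !hevalD hp hq.
- by rewrite substM !hevalM hp hq.
Qed.

Lemma subst_comp B C p : subst C (subst B p) = subst (C *m B) p.
Proof.
elim/mpoly_gen_ind: p => [c|i|p q hp hq|p q hp hq].
- by rewrite !substC.
- rewrite !substXi subst_sum.
  under eq_bigr => j _ do rewrite substZ substXi scaler_sumr.
  rewrite exchange_big /=; apply: eq_bigr => j _.
  rewrite mxE scaler_suml; apply: eq_bigr => l _.
  by rewrite scalerA mulrC.
- by rewrite !substD hp hq.
- by rewrite !substM hp hq.
Qed.

Lemma subst1 p : subst 1%:M p = p.
Proof.
elim/mpoly_gen_ind: p => [c|i|p q hp hq|p q hp hq].
- by rewrite substC.
- rewrite substXi (bigD1 i) //= big1 ?addr0 ?mxE ?eqxx ?scale1r // => j ji.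
  by rewrite mxE (negPf ji) scale0r.
- by rewrite substD hp hq.
- by rewrite substM hp hq.
Qed.

Lemma substK A : A \in unitmx -> cancel (subst A) (subst (invmx A)).
Proof. by move=> Au p; rewrite subst_comp mulVmx // subst1. Qed.

Lemma substVK A : A \in unitmx -> cancel (subst (invmx A)) (subst A).
Proof. by move=> Au p; rewrite subst_comp mulmxV // subst1. Qed.

Lemma dhomog_Xi i : ('X_i : P) \is 1.-homog.
Proof. by rewrite dhomogX; apply/eqP; apply: mdeg1. Qed.

Lemma X_neq0 (i : 'I_3) : ('X_i : P) != 0.
Proof.
by apply/eqP => /(congr1 (mcoeff U_(i))); rewrite mcoeffX eqxx mcoeff0 => /eqP; rewrite oner_eq0.
Qed.

Lemma dhomogXn i n : ('X_i : P) ^+ n \is n.-homog.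
Proof. by elim: n => [|n IH]; rewrite ?dhomog1 // exprS; exact: (dhomogM (dhomog_Xi i) IH). Qed.

Lemma dhomogC c : c%:MP \is [in k[3], 0.-homog].
Proof. by rewrite -[c%:MP]mulr1 mul_mpolyC dhomogZ // dhomog1. Qed.

Lemma subst_homog B d p : p \is d.-homog -> subst B p \is d.-homog.
Proof.
move=> hp; rewrite [p]mpolyE subst_sum big_seq; apply: rpred_sum => m mp.
rewrite substZ; apply: rpredZ; rewrite mpolyXE_id subst_prod.
rewrite -(dhomog_mf hp mp) /= mdegE.
elim/big_ind2: _ => [|? ? ? ? h1 h2|i _]; [exact: dhomog1 | exact: dhomogM |].
have hi : subst B 'X_i \is 1.-homog.
  by rewrite substXi; apply: rpred_sum => j _; apply: rpredZ; apply: dhomog_Xi.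
by have := dhomogMn (m i) hi; rewrite mul1n subst_exp.
Qed.

Definition e0 : 'rV[k]_3 := pt 1 0 0.

Lemma mnm_axis0 d (m : 'X_{1..3}) :
  mdeg m = d -> m 1 = 0%N -> m 2%R = 0%N -> m = (U_(0%R) *+ d)%MM.
Proof.
have o1 : lift ord0 ord0 = 1 :> 'I_3 by apply/val_inj.
have o2 : lift ord0 (lift ord0 ord0) = 2%R :> 'I_3 by apply/val_inj.
rewrite mdegE !big_ord_recl big_ord0 o1 o2 => + m1 m2.
rewrite m1 m2 !addn0 => m0; apply/mnmP => i; rewrite mulmnE mnm1E.
case: i => [[|[|[|//]]] h] /=; rewrite ?mul1n ?mul0n.
- by apply: (etrans _ m0); congr (m _); apply/val_inj.
- by apply: (etrans _ m1); congr (m _); apply/val_inj.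
- by apply: (etrans _ m2); congr (m _); apply/val_inj.
Qed.

Lemma heval_e0 d p : p \is d.-homog -> heval p e0 = p@_(U_(0%R) *+ d).
Proof.
move=> hp; rewrite /heval mevalE [in RHS](mpolyE p) raddf_sum /= !big_seq.
apply: eq_bigr => m mp; rewrite mcoeffZ mcoeffX; congr (_ * _).
have md : mdeg m = d by exact: (dhomog_mf hp mp).
rewrite !big_ord_recl big_ord0 !mxE /= expr1n mul1r mulr1.
have [->|ne] := eqVneq m (U_(0%R) *+ d)%MM.
  by rewrite !mulmnE !mnm1E /= !mul0n !expr0 mulr1.
have o1 : lift ord0 ord0 = 1 :> 'I_3 by apply/val_inj.
have o2 : lift ord0 (lift ord0 ord0) = 2%R :> 'I_3 by apply/val_inj.
rewrite o1 o2 !expr0n; case m1: (m 1 == 0%N); last by rewrite mul0r.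
case m2: (m 2%R == 0%N); last by rewrite mulr0.
case/negP: ne; apply/eqP; exact: (mnm_axis0 md (eqP m1) (eqP m2)).
Qed.

(** Every monomial other than the pure power of [X_0] contains [X_1] or [X_2].  The
    degrees of the cofactors are stated after multiplication by [X_0], which makes
    sense for [d = 0] too. *)
Lemma split_e0 d p : p \is d.-homog -> heval p e0 = 0 -> exists p1 p2,
  [/\ p = p1 * 'X_1 + p2 * 'X_2, p1 * 'X_0 \is d.-homog & p2 * 'X_0 \is d.-homog].
Proof.
move=> hp; rewrite (heval_e0 hp) => p0.
pose ok q := exists p1 p2,
  [/\ q = p1 * 'X_1 + p2 * 'X_2, p1 * 'X_0 \is d.-homog & p2 * 'X_0 \is d.-homog].
rewrite -/(ok p) [p]mpolyE big_seq; apply: (big_ind ok).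
- by exists 0, 0; rewrite !mul0r addr0; split; rewrite ?rpred0.
- move=> _ _ [a [b [-> ha hb]]] [a' [b' [-> ha' hb']]].
  exists (a + a'), (b + b'); split; first ring.
    by rewrite mulrDl rpredD.
  by rewrite mulrDl rpredD.
move=> m mp; have md : mdeg m = d by exact: (dhomog_mf hp mp).
have red i : m i != 0%N -> 'X_[m] = 'X_[m - U_(i)] * 'X_i :> P.
  by rewrite -lep1mP => h; rewrite -mpolyXD submK.
have hom i : m i != 0%N -> (p@_m *: 'X_[m - U_(i)]) * 'X_0 \is [in k[3], d.-homog].
  rewrite -lep1mP => h; rewrite -scalerAl; apply: rpredZ; rewrite -mpolyXD dhomogX.
  by apply/eqP; rewrite /= -md -{2}(submK h) !mdegD !mdeg1.
have [m1|m1] := boolP (m 1 != 0%N).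
  exists (p@_m *: 'X_[m - U_(1)]), 0; rewrite !mul0r addr0 rpred0.
  by split; [rewrite {1}(red 1) // scalerAl | exact: hom | ].
have [m2|m2] := boolP (m 2%R != 0%N).
  exists 0, (p@_m *: 'X_[m - U_(2%R)]); rewrite !mul0r add0r rpred0.
  by split; [rewrite {1}(red 2%R) // scalerAl | | exact: hom].
rewrite negbK in m1; rewrite negbK in m2.
have em := mnm_axis0 md (eqP m1) (eqP m2).
by rewrite mcoeff_msupp em p0 eqxx in mp.
Qed.

End Forms.

Section SquareDecomposition.
Variable k : closedFieldType.
Hypothesis char_k : 2%N \in [pchar k].
Local Notation P := {mpoly k[3]}.
Let charP : 2%N \in [pchar P] := pchar_mpoly char_k 3.

(** Group the monomials by the parities of their exponents, [k] being perfect; the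
    total degree is even, so no or exactly two exponents are odd. *)
Lemma square_dec d (p : P) : p \is (2 * d).-homog -> exists a0 a1 a2 a3 : P,
  [/\ p = a0 ^+ 2 + a1 ^+ 2 * 'X_0 * 'X_1 + a2 ^+ 2 * 'X_0 * 'X_2
             + a3 ^+ 2 * 'X_1 * 'X_2,
      a0 \is d.-homog, a1 * 'X_0 \is d.-homog, a2 * 'X_0 \is d.-homog &
      a3 * 'X_0 \is d.-homog].
Proof.
pose ok q := exists a0 a1 a2 a3 : P,
  [/\ q = a0 ^+ 2 + a1 ^+ 2 * 'X_0 * 'X_1 + a2 ^+ 2 * 'X_0 * 'X_2
             + a3 ^+ 2 * 'X_1 * 'X_2,
      a0 \is d.-homog, a1 * 'X_0 \is d.-homog, a2 * 'X_0 \is d.-homog &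
      a3 * 'X_0 \is d.-homog].
move=> hp; rewrite -/(ok p) [p]mpolyE big_seq; apply: (big_ind ok).
- by exists 0, 0, 0, 0; rewrite !expr0n !mul0r !addr0 rpred0.
- move=> _ _ [a0 [a1 [a2 [a3 [-> h0 h1 h2 h3]]]]] [b0 [b1 [b2 [b3 [-> g0 g1 g2 g3]]]]].
  exists (a0 + b0), (a1 + b1), (a2 + b2), (a3 + b3).
  split; first by rewrite !(sqrrD2 charP); ring.
  + by rewrite rpredD.
  + by rewrite mulrDl rpredD.
  + by rewrite mulrDl rpredD.
  + by rewrite mulrDl rpredD.
move=> m mp; have md : mdeg m = (2 * d)%N by exact: (dhomog_mf hp mp).
pose h : 'X_{1..3} := [multinom (m i)./2 | i < 3].
pose c := rt p@_m *: 'X_[h] : P.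
have o1 : lift ord0 ord0 = 1 :> 'I_3 by apply/val_inj.
have o2 : lift ord0 (lift ord0 ord0) = 2%R :> 'I_3 by apply/val_inj.
have ec : p@_m *: 'X_[m] =
   c ^+ 2 * ('X_0 ^+ odd (m 0) * 'X_1 ^+ odd (m 1) * 'X_2 ^+ odd (m 2%R)).
  rewrite /c exprZn rtK mpolyXn -scalerAl; congr (_ *: _).
  rewrite !mpolyXn -!mpolyXD; congr 'X_[_]; apply/mnmP => i.
  have hi2 : (h *+ 2)%MM i = (m i)./2.*2 by rewrite mulmnE mnmE muln2.
  rewrite [RHS]mnmDE hi2 [X in (_ + X)%N]mnmDE [X in (_ + (X + _))%N]mnmDE.
  rewrite !mulmnE !mnm1E -[LHS]odd_double_half addnC; congr (_ + _)%N.
  move: i {hi2}.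
  by case=> [[|[|[|//]]] hi] /=; rewrite ?mul1n ?mul0n ?addn0;
     congr (nat_of_bool (odd (m _))); apply/val_inj.
have dm : (m 0%R + m 1%R + m 2%R = 2 * d)%N.
  by move: md; rewrite mdegE !big_ord_recl big_ord0 o1 o2 addn0 addnA.
have dh : mdeg h = ((m 0%R)./2 + (m 1%R)./2 + (m 2%R)./2)%N.
  by rewrite mdegE !big_ord_recl big_ord0 o1 o2 !mnmE addn0 addnA.
have par : odd (m 0) (+) odd (m 1) (+) odd (m 2%R) = false.
  by rewrite -!oddD dm oddM.
have homc : (mdeg h == d) -> c \is [in k[3], d.-homog].
  by move=> e; apply: rpredZ; rewrite dhomogX.
have homc' : (mdeg h).+1 = d -> c * 'X_0 \is [in k[3], d.-homog].
  move=> e; rewrite /c -scalerAl; apply: rpredZ; rewrite -mpolyXD dhomogX.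
  by apply/eqP; rewrite /= mdegD mdeg1 addn1.
have h0 := odd_double_half (m 0); have h1 := odd_double_half (m 1).
have h2 := odd_double_half (m 2%R).
have z : (0 : P) \is [in k[3], d.-homog] by exact: rpred0.
rewrite ec; move: par; case e0: (odd (m 0)); case e1: (odd (m 1));
  case e2: (odd (m 2%R)) => //= _; rewrite e0 e1 e2 in h0 h1 h2;
  rewrite ?expr1 ?expr0 ?mulr1 ?mul1r.
- exists 0, c, 0, 0; rewrite !expr0n !mul0r !addr0 add0r mulrA; split=> //.
  by apply: homc'; rewrite dh; lia.
- exists 0, 0, c, 0; rewrite !expr0n !mul0r !addr0 !add0r mulrA; split=> //.
  by apply: homc'; rewrite dh; lia.
- exists 0, 0, 0, c; rewrite !expr0n !mul0r !addr0 !add0r mulrA; split=> //.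
  by apply: homc'; rewrite dh; lia.
- exists c, 0, 0, 0; rewrite !expr0n !mul0r !addr0; split=> //.
  by apply: homc; rewrite dh; lia.
Qed.

End SquareDecomposition.

(** * Regular systems of parameters *)

Section RatC.
Variable k : closedFieldType.

Lemma hval_inj : injective (@hval k).
Proof. exact: val_inj. Qed.

Lemma ratC_is_zmod_morphism : zmod_morphism (@ratC k).
Proof. by move=> a b; apply: hval_inj; rewrite /= !rmorphB. Qed.

Lemma ratC_is_monoid_morphism : monoid_morphism (@ratC k).
Proof. by split=> [|a b]; apply: hval_inj; rewrite /= ?rmorph1 ?rmorphM. Qed.

HB.instance Definition _ :=
  GRing.isZmodMorphism.Build k (ratfun k) (@ratC k) ratC_is_zmod_morphism.
HB.instance Definition _ :=
  GRing.isMonoidMorphism.Build k (ratfun k) (@ratC k) ratC_is_monoid_morphism.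

Lemma pchar_ratfun : 2%N \in [pchar k] -> 2%N \in [pchar (ratfun k)].
Proof. exact: (rmorph_pchar (@ratC k)). Qed.
End RatC.

Lemma mcoeff_pihomog (R : idomainType) n d (p : {mpoly R[n]}) m :
  (pihomog mdeg d p)@_m = p@_m *+ (mdeg m == d).
Proof.
elim/mpolyind: p => [|c m' p _ _ IH]; first by rewrite raddf0 !mcoeff0 mul0rn.
rewrite pihomog_is_linear !mcoeffD IH !mcoeffZ mulrnDl pihomogX; congr (_ + _).
rewrite mcoeffX; case: ifP => md; rewrite ?mcoeffX ?mcoeff0;
by have [<-|_] := eqVneq m' m; rewrite ?md ?mulr0 ?mul0rn ?mulr0n.
Qed.

Section LocalRing.
Variable k : closedFieldType.
Local Notation K := (ratfun k).
Implicit Types (O : set K) (x y : K).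

Definition ev2 x y : {mpoly k[2]} -> K :=
  mmap (@ratC k) (fun i => if i == 0 then x else y).
HB.instance Definition _ x y := GRing.RMorphism.copy (ev2 x y)
  (mmap (@ratC k) (fun i => if i == 0 then x else y)).

(** The powers of the ideal generated by [x] and [y]. *)
Fixpoint pw O x y n : set K :=
  if n is n'.+1 then
    [set r | exists a b, [/\ pw O x y n' a, pw O x y n' b & r = x * a + y * b]]
  else O.

(** [O] is a local ring with residue field [k], and [x], [y] is a regular system
    of parameters: the last condition says that the forms in [x] and [y] are
    linearly independent in the associated graded ring. *)
Record local_params O x y : Prop := LocalParams {
  lp_const : forall c, O (ratC c);
  lp_add : forall a b, O a -> O b -> O (a + b);
  lp_mul : forall a b, O a -> O b -> O (a * b);
  lp_x : O x;
  lp_y : O y;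
  lp_dec : forall a, O a ->
    exists c a1 a2, [/\ O a1, O a2 & a = ratC c + (x * a1 + y * a2)];
  lp_inv : forall c a1 a2, c != 0 -> O a1 -> O a2 ->
    O (ratC c + (x * a1 + y * a2))^-1;
  lp_free : forall d (Q : {mpoly k[2]}), Q \is d.-homog ->
    pw O x y d.+1 (ev2 x y Q) -> Q = 0 }.

Section Params.
Variables (O : set K) (x y : K).
Hypothesis lp : local_params O x y.
Local Notation I := (pw O x y).

Lemma lp_0 : O 0.
Proof. by rewrite -(rmorph0 (@ratC k)); apply: lp_const lp _. Qed.

Lemma lp_1 : O 1.
Proof. by rewrite -(rmorph1 (@ratC k)); apply: lp_const lp _. Qed.

Lemma lp_exp a n : O a -> O (a ^+ n).
Proof.
by move=> Oa; elim: n => [|n IH]; [exact: lp_1 | rewrite exprS; apply: (lp_mul lp)].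
Qed.

Lemma pw_add n a b : I n a -> I n b -> I n (a + b).
Proof.
elim: n a b => [|n IH] a b; first exact: (lp_add lp).
move=> [a1 [a2 [h1 h2 ->]]] [b1 [b2 [h3 h4 ->]]].
exists (a1 + b1), (a2 + b2); split; [exact: IH | exact: IH | ring].
Qed.

Lemma pw_mul m n a b : I m a -> I n b -> I (m + n)%N (a * b).
Proof.
elim: m a => [|m IH] a.
  move=> Oa; elim: n b => [|n IH] b; first exact: (lp_mul lp).
  move=> [b1 [b2 [h1 h2 ->]]]; exists (a * b1), (a * b2).
  by split; [exact: IH | exact: IH | ring].
move=> [a1 [a2 [h1 h2 ->]]] hb; exists (a1 * b), (a2 * b).
by split; [exact: IH | exact: IH | ring].
Qed.

Lemma pw_scale n a b : O a -> I n b -> I n (a * b).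
Proof. exact: (@pw_mul 0). Qed.

Lemma pw_0 n : I n 0.
Proof.
elim: n => [|n IH]; first exact: lp_0.
by exists 0, 0; split=> //; rewrite !mulr0 addr0.
Qed.

Lemma pw_x : I 1 x.
Proof.
by exists 1, 0; split; [exact: lp_1 | exact: lp_0 | rewrite mulr1 mulr0 addr0].
Qed.

Lemma pw_y : I 1 y.
Proof.
by exists 0, 1; split; [exact: lp_0 | exact: lp_1 | rewrite mulr1 mulr0 add0r].
Qed.

Lemma pw_S n a : I n.+1 a -> I n a.
Proof.
elim: n a => [|n IH] a [a1 [a2 [h1 h2 ->]]].
  apply: (lp_add lp); apply: (lp_mul lp) => //; [exact: lp_x lp|exact: lp_y lp].
by exists a1, a2; split=> //; apply: IH.
Qed.

Lemma pw_le m n a : (m <= n)%N -> I n a -> I m a.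
Proof.
move=> /subnK <-; elim: (n - m)%N => [//|l IH].
by rewrite addSn => /pw_S.
Qed.

Lemma pw_sum n J (s : seq J) (P : pred J) (F : J -> K) :
  (forall j, P j -> I n (F j)) -> I n (\sum_(j <- s | P j) F j).
Proof. by move=> h; elim/big_ind: _ => //; [exact: pw_0 | exact: pw_add]. Qed.

Lemma pw_exp m n a : I m a -> I (n * m)%N (a ^+ n).
Proof.
move=> ha; elim: n => [|n IH]; first exact: lp_1.
by rewrite exprS mulSn; apply: pw_mul.
Qed.

Lemma ev2X m : ev2 x y 'X_[m] = x ^+ m 0 * y ^+ m 1.
Proof.
rewrite /ev2 mmapX /mmap1 !big_ord_recl big_ord0 mulr1 /=.
by congr (_ * _ ^+ m _); apply/val_inj.
Qed.

Lemma ev2C c : ev2 x y c%:MP = ratC c.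
Proof. by rewrite /ev2 mmapC. Qed.

Lemma ev2M P Q : ev2 x y (P * Q) = ev2 x y P * ev2 x y Q.
Proof. exact: rmorphM. Qed.

Lemma ev2D P Q : ev2 x y (P + Q) = ev2 x y P + ev2 x y Q.
Proof. exact: rmorphD. Qed.

Lemma ev2E Q :
  ev2 x y Q = \sum_(m <- msupp Q) ratC Q@_m * (x ^+ m 0 * y ^+ m 1).
Proof.
rewrite {1}[Q]mpolyE rmorph_sum; apply: eq_bigr => m _.
by rewrite -mul_mpolyC [LHS]ev2M ev2C ev2X.
Qed.

Lemma mdeg2 (m : 'X_{1..2}) : mdeg m = (m 0%R + m 1%R)%N.
Proof. by rewrite mdegE !big_ord_recl big_ord0 addn0; congr (m _ + m _)%N; apply/val_inj. Qed.

Lemma pw_ev2 n (Q : {mpoly k[2]}) :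
  (forall m, (mdeg m < n)%N -> Q@_m = 0) -> I n (ev2 x y Q).
Proof.
move=> hQ; rewrite ev2E big_seq; apply: pw_sum => m mQ.
apply: pw_scale; first exact: lp_const lp _.
apply: (@pw_le _ (m 0%R * 1 + m 1%R * 1)%N).
  rewrite !muln1 -mdeg2 leqNgt; apply/negP => /hQ/eqP.
  by rewrite mcoeff_eq0 mQ.
by apply: pw_mul; apply: pw_exp; [exact: pw_x | exact: pw_y].
Qed.

(** Comparing lowest-degree forms extends linear independence from forms to
    polynomials. *)
Lemma ev2_free n (Q : {mpoly k[2]}) :
  I n (ev2 x y Q) -> forall m, (mdeg m < n)%N -> Q@_m = 0.
Proof.
move=> hI m; elim/ltn_ind: {m}(mdeg m) {-2}m (erefl (mdeg m)) => d IH m md; rewrite md => dn.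
pose Qd := pihomog mdeg d Q.
have coefQd m' : Qd@_m' = Q@_m' *+ (mdeg m' == d).
  exact: mcoeff_pihomog.
suff hI' : I d.+1 (ev2 x y Qd).
  have /mpolyP/(_ m) : Qd = 0 by apply: (lp_free lp _ hI'); exact: pihomogP.
  by rewrite coefQd md eqxx mcoeff0.
have -> : Qd = Q + (Qd - Q) by ring.
rewrite ev2D; apply: pw_add; first exact: pw_le dn hI.
apply: pw_ev2 => m' hm'; rewrite mcoeffB coefQd.
move: hm'; rewrite ltnS leq_eqVlt => /orP[/eqP->|lt]; first by rewrite eqxx subrr.
by rewrite (IH _ lt m' erefl (ltn_trans lt dn)) mul0rn subrr.
Qed.

End Params.
End LocalRing.

(** * Power series and Weierstrass division *)

Section PowerSeries.
Variable k : closedFieldType.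
Local Notation P := {mpoly k[3]}.
Implicit Types (a b : pseries k) (T : P) (m : 'X_{1..3}).

Definition trunc a n : P := \sum_(m : 'X_{1..3 < n}) a m *: 'X_[m].

Lemma coef_trunc a n m : (trunc a n)@_m = a m *+ (mdeg m < n)%N.
Proof.
have [h|h] := ltnP (mdeg m) n; first by rewrite /trunc mcoeff_mpoly.
rewrite /trunc raddf_sum /= big1 // => u _; rewrite mcoeffZ mcoeffX.
by case: eqP => [e|_]; rewrite ?mulr0 //; move: (bmdeg u); rewrite e ltnNge h.
Qed.

(** [T] has order at least [n]. *)
Definition low n T : Prop := forall m, (mdeg m < n)%N -> T@_m = 0.

Lemma lowM n T U : low n T -> low n (T * U).
Proof.
move=> hT m hm; rewrite mcoeffM big1 // => -[u v] /= /eqP e.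
have hu : (mdeg u < n)%N by have := congr1 (@mdeg 3) e; rewrite mdegD; lia.
by rewrite (hT _ hu) mul0r.
Qed.

Lemma trunc_mul a b n : low n (trunc (ps_mul a b) n - trunc a n * trunc b n).
Proof.
move=> m hm; rewrite mcoeffB coef_trunc hm mulr1n mcoeffM /ps_mul.
apply/eqP; rewrite subr_eq0; apply/eqP; apply: eq_bigr => -[u v] /= /eqP e.
have hu : (mdeg u < n)%N by have := congr1 (@mdeg 3) e; rewrite mdegD; lia.
have hv : (mdeg v < n)%N by have := congr1 (@mdeg 3) e; rewrite mdegD; lia.
by rewrite !coef_trunc hu hv.
Qed.

Lemma trunc_add a b n : trunc (ps_add a b) n = trunc a n + trunc b n.
Proof. by apply/mpolyP => m; rewrite mcoeffD !coef_trunc mulrnDl. Qed.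

Lemma trunc_poly T n : low n (trunc (ps_of_poly T) n - T).
Proof. by move=> m hm; rewrite mcoeffB coef_trunc hm mulr1n subrr. Qed.

Lemma ps_mulE T b m n : (mdeg m < n)%N ->
  ps_mul (ps_of_poly T) b m = (T * trunc b n)@_m.
Proof.
move=> hm; have := trunc_mul (ps_of_poly T) b hm.
rewrite mcoeffB coef_trunc hm mulr1n => /eqP; rewrite subr_eq0 => /eqP ->.
have := lowM (trunc b n) (@trunc_poly T n) hm.
by rewrite mulrBl mcoeffB => /eqP; rewrite subr_eq0 => /eqP.
Qed.

Lemma mcoeffXM u T m :
  ('X_[u] * T)@_m = if (u <= m)%MM then T@_(m - u)%MM else 0.
Proof.
rewrite mulrC; case: ifP => h; first by rewrite -{1}(submK h) addmC mcoeffMX.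
apply/eqP; rewrite mcoeff_eq0 (perm_mem (msuppMX _ _)); apply/mapP => -[v _ e].
by rewrite e lem_addr in h.
Qed.

Lemma ps_mulX u b m : ps_mul (ps_of_poly 'X_[u]) b m =
  if (u <= m)%MM then b (m - u)%MM else 0.
Proof.
rewrite (ps_mulE _ _ (ltnSn (mdeg m))) mcoeffXM; case: ifP => // _.
by rewrite coef_trunc ltnS mdegB.
Qed.

Lemma ps_mulDl T U b m : ps_mul (ps_of_poly (T + U)) b m =
  ps_mul (ps_of_poly T) b m + ps_mul (ps_of_poly U) b m.
Proof. by rewrite !(ps_mulE _ _ (ltnSn (mdeg m))) mulrDl mcoeffD. Qed.

Lemma ps_mul_sum (J : Type) (s : seq J) (F : J -> P) b m :
  ps_mul (ps_of_poly (\sum_(j <- s) F j)) b m =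
  \sum_(j <- s) ps_mul (ps_of_poly (F j)) b m.
Proof.
rewrite (ps_mulE _ _ (ltnSn (mdeg m))) mulr_suml raddf_sum /=.
by apply: eq_bigr => j _; rewrite (ps_mulE _ _ (ltnSn (mdeg m))).
Qed.

End PowerSeries.

(** The exponents of the part of the equation of a rational double point that
    involves only the first two variables. *)
Definition rdp_exps (t : rdp) : seq (nat * nat) :=
  match t with
  | A1 => [:: (1, 1)]
  | D0 n => [:: (2, 1); (1, n)]
  | E70 => [:: (3, 0); (1, 3)]
  end%N.

Definition exps_mnm (e : nat * nat) : 'X_{1..3} :=
  (U_(0%R) *+ e.1 + U_(1%R) *+ e.2)%MM.

Lemma exps_mnmE e : [/\ exps_mnm e 0%R = e.1, exps_mnm e 1%R = e.2 &
  exps_mnm e 2%R = 0%N].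
Proof. by rewrite /exps_mnm !mnmDE !mulmnE !mnm1E /= !mul1n !mul0n addn0. Qed.

Lemma rdp_eqnE (k : closedFieldType) t : rdp_eqn k t =
  'X_[U_(2%R) *+ 2] + \sum_(e <- rdp_exps t) 'X_[exps_mnm e].
Proof.
rewrite /exps_mnm; case: t => [|n|] /=; rewrite ?big_cons big_nil /= ?addr0;
by rewrite !mpolyXD -!mpolyXn ?expr1 ?expr0 ?mulr1 ?addrA.
Qed.

(** Division by [Z^2 + G(X, Y)]: every power series is, modulo the equation,
    linear in [Z].  The recursion for the quotient trades two units of degree in
    [Z] for a drop of the degree in [X] and [Y]. *)
Section Weierstrass.
Variable k : closedFieldType.
Hypothesis char_k : 2%N \in [pchar k].
Variables (s : seq (nat * nat)) (a : pseries k).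
Hypothesis s_pos : all (fun e => 0 < e.1 + e.2)%N s.

Let zz : 'X_{1..3} := (U_(2%R) *+ 2)%MM.
Let E : {mpoly k[3]} := 'X_[zz] + \sum_(e <- s) 'X_[exps_mnm e].

Fixpoint quot_fuel N (m : 'X_{1..3}) : k :=
  if N is N'.+1 then
    a (m + zz)%MM + \sum_(e <- s)
      (if (exps_mnm e <= m)%MM then quot_fuel N' (m - exps_mnm e + zz)%MM else 0)
  else 0.

Definition wquot (m : 'X_{1..3}) : k := quot_fuel (m 0%R + m 1%R).+1 m.

Lemma zzE : [/\ zz 0%R = 0%N, zz 1%R = 0%N & zz 2%R = 2%N].
Proof. by rewrite /zz !mulmnE !mnm1E. Qed.

Lemma quot_fuelE N N' (m : 'X_{1..3}) : (m 0%R + m 1%R < N)%N -> (m 0%R + m 1%R < N')%N ->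
  quot_fuel N m = quot_fuel N' m.
Proof.
elim: N N' m => [//|N IH] [//|N'] m hN hN' /=; congr (_ + _).
rewrite !big_seq; apply: eq_bigr => e es; case: ifP => // /mnm_lepP le.
have [z0 z1 _] := zzE; have [e0 e1 _] := exps_mnmE e.
have := allP s_pos _ es; have := le 0%R; have := le 1%R; rewrite e0 e1 => *.
by apply: IH; rewrite !(mnmDE _ _ zz) !mnmBE z0 z1 e0 e1; lia.
Qed.

Lemma wquotE m : wquot m = a (m + zz)%MM + \sum_(e <- s)
  (if (exps_mnm e <= m)%MM then wquot (m - exps_mnm e + zz)%MM else 0).
Proof.
rewrite {1}/wquot /=; congr (_ + _); rewrite !big_seq; apply: eq_bigr => e es.
case: ifP => // /mnm_lepP le; apply: quot_fuelE => //.
have [z0 z1 _] := zzE; have [e0 e1 _] := exps_mnmE e.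
have := allP s_pos _ es; have := le 0%R; have := le 1%R; rewrite e0 e1 => *.
by rewrite !(mnmDE _ _ zz) !mnmBE z0 z1 e0 e1; lia.
Qed.

Lemma weierstrass (m : 'X_{1..3}) : (1 < m 2%R)%N -> a m = ps_mul (ps_of_poly E) wquot m.
Proof.
move=> m2; have [z0 z1 z2] := zzE.
have lez : (zz <= m)%MM.
  apply/mnm_lepP => i; rewrite /zz mulmnE mnm1E.
  by case: eqP => [<-|_] /=; rewrite ?mul1n ?mul0n.
rewrite /E ps_mulDl ps_mulX lez ps_mul_sum wquotE submK //.
rewrite -addrA -big_split big1_seq ?addr0 //= => e _.
rewrite ps_mulX; have [e0 e1 e2] := exps_mnmE e.
have -> : (exps_mnm e <= m - zz)%MM = (exps_mnm e <= m)%MM.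
  apply/mnm_lepP/mnm_lepP => h i; have := h i; rewrite mnmBE.
    by move/leq_trans; apply; rewrite leq_subr.
  case: (i =P 2%R) => [->|]; first by rewrite e2.
  by rewrite /zz mulmnE mnm1E eq_sym => /eqP/negPf->; rewrite mul0n subn0.
case: ifP => [le|_]; last by rewrite addr0.
have -> : (m - zz - exps_mnm e + zz = m - exps_mnm e)%MM.
  apply/mnmP => i; rewrite (mnmDE _ _ zz) !mnmBE.
  case: (i =P 2%R) => [->|]; first by rewrite e2 z2; lia.
  by rewrite /zz mulmnE mnm1E eq_sym => /eqP/negPf->; rewrite mul0n !subn0 addn0.
by rewrite (addxx char_k).
Qed.

End Weierstrass.

(** * Rings generated by one element over squares *)

(** For [f] in [O], the subring generated by [f] over the squares of [O]. *)
Definition sq_span (k : closedFieldType) (O : set (ratfun k)) (f : ratfun k) :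
  set (ratfun k) := [set r | exists a s, [/\ O a, O s & r = a ^+ 2 + s ^+ 2 * f]].

Section DoubleCover.
Variable k : closedFieldType.
Hypothesis char_k : 2%N \in [pchar k].
Local Notation K := (ratfun k).
Let charK := pchar_ratfun char_k.
Variables (O : set K) (x y f : K).
Hypothesis lp : local_params O x y.
Hypothesis f2 : pw O x y 2 f.
Local Notation I := (pw O x y).
Local Notation R := (sq_span O f).

Lemma sq_f : O f.
Proof. exact: (pw_le lp (leq0n _) f2). Qed.

Lemma sq_sub r : R r -> O r.
Proof.
move=> [a [s [Oa Os ->]]]; apply: (lp_add lp); first exact: lp_exp lp _ _ _.
by apply: (lp_mul lp); [exact: lp_exp lp _ _ _ | exact: sq_f].
Qed.

Lemma sq_sqr a : O a -> R (a ^+ 2).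
Proof.
by move=> Oa; exists a, 0; split=> //; [exact: lp_0 lp | rewrite expr0n mul0r addr0].
Qed.

Lemma sq_gen : R f.
Proof.
exists 0, 1; split; [exact: lp_0 lp | exact: lp_1 lp |].
by rewrite expr0n expr1n mul1r add0r.
Qed.

Lemma sq_const c : R (ratC c).
Proof. by rewrite -(rtK c) rmorphXn; apply: sq_sqr; apply: lp_const lp _. Qed.

Lemma sq_add r t : R r -> R t -> R (r + t).
Proof.
move=> [a [s [Oa Os ->]]] [b [u [Ob Ou ->]]]; exists (a + b), (s + u).
by split; [exact: (lp_add lp) | exact: (lp_add lp) | rewrite !(sqrrD2 charK); ring].
Qed.

Lemma sq_mul r t : R r -> R t -> R (r * t).
Proof.
move=> [a [s [Oa Os ->]]] [b [u [Ob Ou ->]]].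
exists (a * b + s * u * f), (a * u + s * b).
have Om := lp_mul lp; have Of := sq_f.
split; [by apply: (lp_add lp); auto | by apply: (lp_add lp); auto |].
by rewrite !(sqrrD2 charK); ring.
Qed.

Lemma sq_0 : R 0.
Proof. by rewrite -(rmorph0 (@ratC k)); apply: sq_const. Qed.

Lemma sq_1 : R 1.
Proof. by rewrite -(rmorph1 (@ratC k)); apply: sq_const. Qed.

(** The powers of the ideal of [R] generated by [x^2], [y^2] and [f]. *)
Fixpoint mp n : set K :=
  if n is n'.+1 then
    [set r | exists a b c,
      [/\ mp n' a, mp n' b, mp n' c & r = x ^+ 2 * a + y ^+ 2 * b + f * c]]
  else R.

Lemma mp_add n a b : mp n a -> mp n b -> mp n (a + b).
Proof.
elim: n a b => [|n IH] a b; first exact: sq_add.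
move=> [a1 [a2 [a3 [h1 h2 h3 ->]]]] [b1 [b2 [b3 [h4 h5 h6 ->]]]].
exists (a1 + b1), (a2 + b2), (a3 + b3).
by split; [exact: IH | exact: IH | exact: IH | ring].
Qed.

Lemma mp_mul m n a b : mp m a -> mp n b -> mp (m + n)%N (a * b).
Proof.
elim: m a => [|m IH] a.
  move=> Ra; elim: n b => [|n IH] b; first exact: sq_mul.
  move=> [b1 [b2 [b3 [h1 h2 h3 ->]]]]; exists (a * b1), (a * b2), (a * b3).
  by split; [exact: IH | exact: IH | exact: IH | ring].
move=> [a1 [a2 [a3 [h1 h2 h3 ->]]]] hb; exists (a1 * b), (a2 * b), (a3 * b).
by split; [exact: IH | exact: IH | exact: IH | ring].
Qed.

Lemma mp_0 n : mp n 0.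
Proof.
elim: n => [|n IH]; first exact: sq_0.
by exists 0, 0, 0; split=> //; rewrite !mulr0 !addr0.
Qed.

Lemma mp_scale n a b : R a -> mp n b -> mp n (a * b).
Proof. exact: (@mp_mul 0). Qed.

Lemma mp_sum n J (s : seq J) (P : pred J) (F : J -> K) :
  (forall j, P j -> mp n (F j)) -> mp n (\sum_(j <- s | P j) F j).
Proof. by move=> h; elim/big_ind: _ => //; [exact: mp_0 | exact: mp_add]. Qed.

Lemma mp_sub n a : mp n a -> R a.
Proof.
elim: n a => [//|n IH] a [a1 [a2 [a3 [/IH h1 /IH h2 /IH h3 ->]]]].
apply: sq_add; last by apply: sq_mul => //; exact: sq_gen.
apply: sq_add; apply: sq_mul => //; apply: sq_sqr.
- exact: lp_x lp.
- exact: lp_y lp.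
Qed.

Lemma mp_S n a : mp n.+1 a -> mp n a.
Proof.
elim: n a => [|n IH] a; first exact: (@mp_sub 1).
move=> [a1 [a2 [a3 [h1 h2 h3 ->]]]]; exists a1, a2, a3.
by split=> //; apply: IH.
Qed.

Lemma mp_le m n a : (m <= n)%N -> mp n a -> mp m a.
Proof.
move=> /subnK <-; elim: (n - m)%N => [//|l IH].
by rewrite addSn => /mp_S.
Qed.

Lemma mp_pw n a : mp n a -> I (2 * n)%N a.
Proof.
elim: n a => [|n IH] a; first exact: sq_sub.
rewrite mulnS => -[a1 [a2 [a3 [/IH h1 /IH h2 /IH h3 ->]]]].
have hx := pw_mul lp (pw_exp lp 2 (pw_x lp)).
have hy := pw_mul lp (pw_exp lp 2 (pw_y lp)).
by apply: (pw_add lp); first apply: (pw_add lp); auto; apply: (pw_mul lp).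
Qed.

Lemma one_notin_pw : ~ I 1 1.
Proof.
move=> h; have e1 : ev2 x y 1 = 1 by exact: rmorph1.
have /eqP : (1 : {mpoly k[2]}) = 0; last by rewrite oner_eq0.
by apply: (lp_free lp (dhomog1 _ _)); rewrite e1.
Qed.

(** An element with nonzero constant term is invertible in [O], and its inverse
    [r * (r^-1)^2] stays in [R]. *)
Lemma max_idealE : max_ideal R = mp 1.
Proof.
apply/seteqP; split=> r.
  move=> [[a [s [Oa Os er]]] nu].
  have [c [a1 [a2 [O1 O2 ea]]]] := lp_dec lp Oa.
  have [c0|c0] := eqVneq c 0.
    exists (a1 ^+ 2), (a2 ^+ 2), (s ^+ 2); split; try exact: sq_sqr.
    by rewrite er ea c0 rmorph0 add0r (sqrrD2 charK); ring.
  exfalso; apply: nu.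
  have [f1 [f1' [O3 O4 ef]]] := pw_le lp (isT : (1 <= 2)%N) f2.
  have Om := lp_mul lp; have Oe := lp_exp lp; have Oc := lp_const lp.
  have Ox := lp_x lp; have Oy := lp_y lp.
  have [n1 [n2 [On1 On2 er']]] : exists n1 n2,
      [/\ O n1, O n2 & r = ratC (c ^+ 2) + (x * n1 + y * n2)].
    exists (x * a1 ^+ 2 + s ^+ 2 * f1), (y * a2 ^+ 2 + s ^+ 2 * f1').
    split; [by apply: (lp_add lp); auto | by apply: (lp_add lp); auto |].
    by rewrite er ea ef !(sqrrD2 charK) rmorphXn; ring.
  have c20 : c ^+ 2 != 0 by rewrite expf_neq0.
  have Or : O r^-1 by rewrite er'; apply: (lp_inv lp).
  have r0 : r != 0.
    apply: contraT => /negPn/eqP r0; exfalso; apply: one_notin_pw.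
    have rc0 : ratC (c ^+ 2) != 0 :> K by rewrite fmorph_eq0.
    exists (n1 / ratC (c ^+ 2)), (n2 / ratC (c ^+ 2)).
    rewrite -fmorphV; split; [exact: Om On1 (Oc _) | exact: Om On2 (Oc _) |].
    rewrite fmorphV.
    apply: (mulIf rc0); rewrite mul1r mulrDl -!mulrA !mulVf // !mulr1.
    by apply: (add_eq0_2 charK); rewrite -er'.
  exists (r * r^-1 ^+ 2); last by rewrite expr2 !mulrA mulfK // mulfV.
  by apply: sq_mul; [exists a, s | exact: sq_sqr].
move=> hr; split; first exact: (mp_sub hr).
move=> [g Rg e]; apply: one_notin_pw; rewrite -e mulrC.
apply: (pw_scale lp); first exact: sq_sub.
exact: (pw_le lp _ (mp_pw hr)).
Qed.

Lemma max_powE n : max_pow R n = mp n.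
Proof.
elim: n => [//|n IH]; rewrite /max_pow iterS -/(max_pow R n) IH max_idealE.
apply/seteqP; split=> r.
  move=> [l [a [b [ha hb ->]]]]; apply: mp_sum => i _.
  exact: (@mp_mul 1 n).
move=> [a [b [c [h1 h2 h3 ->]]]].
exists 3, (fun i : 'I_3 => [:: x ^+ 2; y ^+ 2; f]`_i),
          (fun i : 'I_3 => [:: a; b; c]`_i); split.
- have R0 := sq_0; have R1 := sq_1.
  move=> [[|[|[|i]]] //= _].
  + by exists 1, 0, 0; split=> //; ring.
  + by exists 0, 1, 0; split=> //; ring.
  + by exists 0, 0, 1; split=> //; ring.
- by move=> [[|[|[|i]]] //= _].
- by rewrite !big_ord_recl big_ord0 /= addr0 addrA.
Qed.

Lemma sq_dec r : R r -> exists c r', r = ratC c + r' /\ mp 1 r'.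
Proof.
move=> [a [s [Oa Os ->]]]; have [c [a1 [a2 [O1 O2 ->]]]] := lp_dec lp Oa.
exists (c ^+ 2), (x ^+ 2 * a1 ^+ 2 + y ^+ 2 * a2 ^+ 2 + f * s ^+ 2); split.
  by rewrite rmorphXn !(sqrrD2 charK); ring.
by exists (a1 ^+ 2), (a2 ^+ 2), (s ^+ 2); split=> //; exact: sq_sqr.
Qed.

Definition ev3 : {mpoly k[3]} -> K :=
  mmap (@ratC k) (fun i : 'I_3 => [:: x ^+ 2; y ^+ 2; f]`_i).
HB.instance Definition _ := GRing.RMorphism.copy ev3
  (mmap (@ratC k) (fun i : 'I_3 => [:: x ^+ 2; y ^+ 2; f]`_i)).

Lemma ev3C c : ev3 c%:MP = ratC c.
Proof. by rewrite /ev3 mmapC. Qed.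

Lemma ev3D T U : ev3 (T + U) = ev3 T + ev3 U.
Proof. exact: rmorphD. Qed.

Lemma ev3B T U : ev3 (T - U) = ev3 T - ev3 U.
Proof. exact: rmorphB. Qed.

Lemma ev3M T U : ev3 (T * U) = ev3 T * ev3 U.
Proof. exact: rmorphM. Qed.

Lemma ev3X m : ev3 'X_[m] =
  (x ^+ 2) ^+ m 0%R * (y ^+ 2) ^+ m 1%R * f ^+ m 2%R.
Proof.
rewrite /ev3 mmapX /mmap1 !big_ord_recl big_ord0 mulr1 /= mulrA.
by congr (_ ^+ m _ * _ ^+ m _ * _ ^+ m _); apply/val_inj.
Qed.

Lemma ev3E T : ev3 T = \sum_(m <- msupp T)
  ratC T@_m * ((x ^+ 2) ^+ m 0%R * (y ^+ 2) ^+ m 1%R * f ^+ m 2%R).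
Proof.
rewrite {1}[T]mpolyE rmorph_sum; apply: eq_bigr => m _.
by rewrite -mul_mpolyC [LHS]ev3M ev3C ev3X.
Qed.

Lemma mdeg3 (m : 'X_{1..3}) : mdeg m = (m 0%R + m 1%R + m 2%R)%N.
Proof.
rewrite mdegE !big_ord_recl big_ord0 addn0 addnA.
by congr (m _ + m _ + m _)%N; apply/val_inj.
Qed.

Lemma mp_exp m n a : mp m a -> mp (n * m)%N (a ^+ n).
Proof.
move=> ha; elim: n => [|n IH]; first exact: sq_1.
by rewrite exprS mulSn; apply: mp_mul.
Qed.

Lemma mp_gens : [/\ mp 1 (x ^+ 2), mp 1 (y ^+ 2) & mp 1 f].
Proof.
have R0 := sq_0; have R1 := sq_1; split.
- by exists 1, 0, 0; split=> //; ring.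
- by exists 0, 1, 0; split=> //; ring.
- by exists 0, 0, 1; split=> //; ring.
Qed.

Lemma low_mp n T : low n T -> mp n (ev3 T).
Proof.
move=> hT; rewrite ev3E big_seq; apply: mp_sum => m mT.
apply: mp_scale; first exact: sq_const.
have [hx hy hf] := mp_gens.
apply: (@mp_le _ (m 0%R * 1 + m 1%R * 1 + m 2%R * 1)%N).
  rewrite !muln1 -mdeg3 leqNgt; apply/negP => /hT/eqP.
  by rewrite mcoeff_eq0 mT.
by do 2![apply: mp_mul; last exact: mp_exp]; apply: mp_exp.
Qed.

(** Each layer of the filtration is spanned over [k] by the monomials. *)
Lemma mp_dec n r : mp n r ->
  exists T, T \is n.-homog /\ mp n.+1 (r - ev3 T).
Proof.
elim: n r => [|n IH] r.
  move=> /sq_dec[c [r' [-> hr']]]; exists c%:MP; split.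
    by rewrite -[c%:MP]mulr1 mul_mpolyC dhomogZ // dhomog1.
  by rewrite ev3C addrC addKr.
move=> [a [b [c [/IH[Ta [ha ea]] /IH[Tb [hb eb]] /IH[Tc [hc ec]] ->]]]].
have hX (i : 'I_3) : 'X_i \is [in k[3], 1.-homog] by rewrite dhomogX; apply/eqP; apply: mdeg1.
have eX (i : 'I_3) : ev3 'X_i = [:: x ^+ 2; y ^+ 2; f]`_i.
  by rewrite /ev3 mmapX mmap1U.
exists ('X_0 * Ta + 'X_1 * Tb + 'X_2 * Tc); split.
  by rewrite -[n.+1]add1n; do 2?[apply: rpredD]; apply: dhomogM.
exists (a - ev3 Ta), (b - ev3 Tb), (c - ev3 Tc); split=> //.
by rewrite !ev3D !ev3M !eX /=; ring.
Qed.

End DoubleCover.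

(** * Completion of the double cover *)

Definition mon2 (i j : nat) : 'X_{1..2} := (U_(0%R) *+ i + U_(1%R) *+ j)%MM.

Lemma mon2E i j : mon2 i j 0%R = i /\ mon2 i j 1%R = j.
Proof. by rewrite /mon2 !mnmDE !mulmnE !mnm1E /= !mul1n !mul0n addn0. Qed.

Lemma mon2_inj i j i' j' : (mon2 i j == mon2 i' j') = (i == i') && (j == j').
Proof.
apply/eqP/andP => [e|[/eqP-> /eqP->]//].
have [e0 e1] := mon2E i j; have [f0 f1] := mon2E i' j'.
by split; apply/eqP; [rewrite -[LHS]e0 e | rewrite -[LHS]e1 e].
Qed.

Lemma mon2D i j i' j' : (mon2 i j + mon2 i' j' = mon2 (i + i') (j + j'))%MM.
Proof.
apply/mnmP => -[[|[|//]] h]; rewrite mnmDE.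
  have -> : Ordinal h = 0 by apply/val_inj.
  by rewrite !(mon2E _ _).1.
have -> : Ordinal h = 1 by apply/val_inj.
by rewrite !(mon2E _ _).2.
Qed.

Lemma mdeg_mon2 i j : mdeg (mon2 i j) = (i + j)%N.
Proof. by rewrite mdegD !mdegMn !mdeg1 !mul1n. Qed.

Lemma odd_even_add a b : odd (2 * a + b) = odd b.
Proof. by rewrite oddD oddM. Qed.

Lemma odd_even a : odd (2 * a) = false.
Proof. by rewrite oddM. Qed.

Definition mon3 (i j l : nat) : 'X_{1..3} :=
  (exps_mnm (i, j) + U_(2%R) *+ l)%MM.

Lemma mon3E i j l : [/\ mon3 i j l 0%R = i, mon3 i j l 1%R = j & mon3 i j l 2%R = l].
Proof.
have [e0 e1 e2] := exps_mnmE (i, j).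
by rewrite /mon3 !(mnmDE _ (exps_mnm _)) e0 e1 e2 !mulmnE !mnm1E /= !mul0n !addn0 mul1n.
Qed.

Lemma ord3E (i : 'I_3) : [\/ i = 0, i = 1 | i = 2%R].
Proof.
by case: i => [[|[|[|//]]] h]; [apply: Or31|apply: Or32|apply: Or33]; apply/val_inj.
Qed.

Lemma mon3_eta (m : 'X_{1..3}) : m = mon3 (m 0%R) (m 1%R) (m 2%R).
Proof.
apply/mnmP => i; have [e0 e1 e2] := mon3E (m 0%R) (m 1%R) (m 2%R).
by case: (ord3E i) => ->.
Qed.

Lemma mon3_inj i j l i' j' l' :
  (mon3 i j l == mon3 i' j' l') = [&& i == i', j == j' & l == l'].
Proof.
apply/eqP/and3P => [e|[/eqP-> /eqP-> /eqP->]//].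
have [e0 e1 e2] := mon3E i j l; have [f0 f1 f2] := mon3E i' j' l'.
by split; apply/eqP; [rewrite -[LHS]e0 e | rewrite -[LHS]e1 e | rewrite -[LHS]e2 e].
Qed.

(** Conditions on the polynomial [F] with [Z^2 = F(X, Y)]: no monomial of [F] is a
    square, and the first one differs from the others in the parities of its
    exponents and has degree at most 3; so it remains visible modulo the squares
    and the fourth power of the ideal of [x] and [y]. *)
Definition good_exps (s : seq (nat * nat)) : bool :=
  if s is e0 :: s' then
    [&& (e0.1 + e0.2 <= 3)%N,
        all (fun e => odd e.1 || odd e.2) s,
        all (fun e => 2 <= e.1 + e.2)%N s &
        all (fun e => (odd e.1 != odd e0.1) || (odd e.2 != odd e0.2)) s']
  else false.

Definition rdp_ok (t : rdp) : bool := if t is D0 n then (0 < n)%N else true.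

Lemma good_rdp t : rdp_ok t -> good_exps (rdp_exps t).
Proof. by case: t => [|[|n]|]. Qed.

Section Completion.
Variable k : closedFieldType.
Hypothesis char_k : 2%N \in [pchar k].
Local Notation K := (ratfun k).
Let charK := pchar_ratfun char_k.
Variables (O : set K) (x y : K) (s : seq (nat * nat)).
Hypothesis lp : local_params O x y.
Hypothesis s_ok : good_exps s.
Let f : K := \sum_(e <- s) x ^+ e.1 * y ^+ e.2.
Local Notation I := (pw O x y).
Local Notation R := (sq_span O f).
Let E : {mpoly k[3]} := 'X_[U_(2%R) *+ 2] + \sum_(e <- s) 'X_[exps_mnm e].

Lemma exps_pw : I 2 f.
Proof.
rewrite /f big_seq; apply: (pw_sum lp) => e es.
have h : (2 <= e.1 + e.2)%N.
  by move: s_ok es; case: (s) => // e0 s' /and4P[_ _ /allP h _] /h.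
have := pw_mul lp (pw_exp lp e.1 (pw_x lp)) (pw_exp lp e.2 (pw_y lp)).
by rewrite !muln1; apply: (pw_le lp h).
Qed.
Let f2 := exps_pw.
Let mpP := @mp_pw k O x y f lp f2.
Let mpD := @mp_add k char_k O x y f lp.
Let mpM := @mp_mul k char_k O x y f lp f2.
Let mpL := @low_mp k char_k O x y f lp f2.
Let mpZ := @mp_scale k char_k O x y f lp f2.

Let F : {mpoly k[2]} := \sum_(e <- s) 'X_[mon2 e.1 e.2].

(** Substitution of the polynomials that [ev2] evaluates to [x^2], [y^2] and [f], so
    that [ev2] after [sub2] is [ev3]. *)
Definition sub2 : {mpoly k[3]} -> {mpoly k[2]} :=
  mmap (@mpolyC 2 k) (fun i : 'I_3 => [:: 'X_[mon2 2 0]; 'X_[mon2 0 2]; F]`_i).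

HB.instance Definition _ := GRing.RMorphism.copy sub2
  (mmap (@mpolyC 2 k) (fun i : 'I_3 => [:: 'X_[mon2 2 0]; 'X_[mon2 0 2]; F]`_i)).

Lemma sub2Z c T : sub2 (c *: T) = c *: sub2 T.
Proof. by rewrite -!mul_mpolyC [LHS]rmorphM /= /sub2 mmapC. Qed.

Lemma sub2X m : sub2 'X_[m] = 'X_[mon2 (2 * m 0%R) (2 * m 1%R)] * F ^+ m 2%R.
Proof.
rewrite /sub2 mmapX /mmap1 !big_ord_recl big_ord0 mulr1 /= mulrA !mpolyXn -mpolyXD.
have mulm i j n : (mon2 i j *+ n = mon2 (n * i) (n * j))%MM.
  elim: n => [|n IH]; last by rewrite mulmS IH mon2D !mulSn.
  by apply/mnmP => l; rewrite mulm0n mnmE /mon2 mnmDE !mulmnE !muln0.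
rewrite !mulm mon2D !muln0 addn0 add0n.
have -> : lift ord0 (lift ord0 ord0) = 2%R :> 'I_3 by apply/val_inj.
have -> : lift ord0 ord0 = 1 :> 'I_3 by apply/val_inj.
by rewrite ![(2 * _)%N]mulnC.
Qed.

Lemma ev2_F : ev2 x y F = f.
Proof.
rewrite /F rmorph_sum; apply: eq_bigr => e _.
by rewrite [LHS]ev2X !(mon2E _ _).1 !(mon2E _ _).2.
Qed.

Lemma sub2E T : sub2 T = \sum_(m <- msupp T) T@_m *:
  ('X_[mon2 (2 * m 0%R) (2 * m 1%R)] * F ^+ m 2%R).
Proof.
rewrite {1}[T]mpolyE rmorph_sum; apply: eq_bigr => m _.
by rewrite [LHS]sub2Z sub2X.
Qed.

Lemma ev2_sub2 T : ev2 x y (sub2 T) = ev3 x y f T.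
Proof.
rewrite sub2E rmorph_sum [in RHS]ev3E; apply: eq_bigr => m _.
rewrite -mul_mpolyC [LHS]ev2M ev2C ev2M ev2X (mon2E _ _).1 (mon2E _ _).2.
by rewrite [ev2 x y (F ^+ _)]rmorphXn /= ev2_F -!exprM.
Qed.

(** Reading off the coefficients of a polynomial that is linear in [Z]. *)
Lemma sub2_coef0 T i j : (forall m : 'X_{1..3}, m \in msupp T -> (m 2%R <= 1)%N) ->
  (sub2 T)@_(mon2 (2 * i) (2 * j)) = T@_(mon3 i j 0).
Proof.
move=> hT; rewrite sub2E [in RHS](mpolyE T) !raddf_sum /= !big_seq.
apply: eq_bigr => m mT; rewrite !mcoeffZ; congr (_ * _).
rewrite mcoeffX [in RHS](mon3_eta m) mon3_inj; have := hT m mT.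
case: (m 2%R) => [|[|//]] _ /=.
  by rewrite expr0 mulr1 mcoeffX mon2_inj andbT !eqn_pmul2l.
rewrite andbF /= !andbF expr1 /F mulr_sumr raddf_sum /= big_seq big1 // => e es.
rewrite -mpolyXD mon2D mcoeffX mon2_inj; case: andP => // -[/eqP h1 /eqP h2].
have : odd e.1 || odd e.2.
  by move: s_ok es; case: (s) => // e0 s' /and4P[_ /allP h _ _] /h.
by move: (congr1 odd h1) (congr1 odd h2); rewrite 2!odd_even_add 2!odd_even => -> ->.
Qed.

Lemma sub2_coef1 T i j : (forall m : 'X_{1..3}, m \in msupp T -> (m 2%R <= 1)%N) ->
  let e0 := head (0, 0)%N s in
  (sub2 T)@_(mon2 (2 * i + e0.1) (2 * j + e0.2)) = T@_(mon3 i j 1).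
Proof.
move=> hT e0; rewrite sub2E [in RHS](mpolyE T) !raddf_sum /= !big_seq.
apply: eq_bigr => m mT; rewrite !mcoeffZ; congr (_ * _).
rewrite mcoeffX [in RHS](mon3_eta m) mon3_inj; have := hT m mT.
have : good_exps s by [].
rewrite /F /e0; case: (s) => // e s' /and4P[_ /andP[oe _] _ /allP hs].
case: (m 2%R) => [|[|//]] _ /=.
  rewrite andbF /= !andbF expr0 mulr1 mcoeffX mon2_inj; case: andP => // -[/eqP h1 /eqP h2].
  move: oe; move: (congr1 odd h1) (congr1 odd h2).
  by rewrite 2!odd_even_add 2!odd_even => <- <-.
rewrite andbT expr1 mulr_sumr big_cons mcoeffD raddf_sum /= [X in _ + X]big_seq.
rewrite [X in _ + X]big1 => [|e' es].
  by rewrite addr0 -mpolyXD mon2D mcoeffX mon2_inj !eqn_add2r !eqn_pmul2l.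
rewrite -mpolyXD mon2D mcoeffX mon2_inj; case: andP => // -[/eqP h1 /eqP h2].
have := hs _ es; move: (congr1 odd h1) (congr1 odd h2).
by rewrite 4!odd_even_add => -> ->; rewrite !eqxx.
Qed.

Lemma sq_eq : ev3 x y f E = 0.
Proof.
rewrite /E ev3D rmorph_sum ev3X !mulmnE !mnm1E /= mul0n !expr0 !mul1r mul1n.
have -> : \sum_(e <- s) ev3 x y f 'X_[exps_mnm e] = f ^+ 2.
  rewrite (sqr_sum charK); apply: eq_bigr => e _; have [e0 e1 e2] := exps_mnmE e.
  by rewrite ev3X e0 e1 e2 expr0 mulr1 [RHS]exprMn; congr (_ * _); apply: exprAC.
by rewrite (addxx charK).
Qed.

Local Notation ev := (ev3 x y f).

(** If a power series that is linear in [Z] vanishes on the double cover, then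
    its truncations are polynomials in [x], [y] of arbitrarily high order and its
    coefficients are, by parity, among theirs. *)
Lemma linear_null c : (forall m : 'X_{1..3}, (1 < m 2%R)%N -> c m = 0) ->
  (forall n, mp O x y f n (ev (trunc c n))) -> forall m, c m = 0.
Proof.
move=> c1 hc; have hT n m : m \in msupp (trunc c n) -> (m 2%R <= 1)%N.
  rewrite mcoeff_msupp coef_trunc [(_ <= 1)%N]leqNgt; apply: contra => /c1 ->.
  by rewrite mul0rn.
have hn n m : (mdeg m < 2 * n)%N -> (sub2 (trunc c n))@_m = 0.
  by apply: (ev2_free lp); rewrite ev2_sub2; apply: mpP.
move=> m; set i := m 0%R; set j := m 1%R.
case e2: (m 2%R) => [|[|l]]; last by apply: c1; rewrite e2.
all: rewrite (mon3_eta m) -/i -/j e2.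
- have := hn (i + j).+1 (mon2 (2 * i) (2 * j)).
  rewrite sub2_coef0; last exact: hT.
  have [f0' f1' f2'] := mon3E i j 0.
  rewrite coef_trunc mdeg_mon2 mdeg3 f0' f1' f2' addn0 ltnS leqnn mulr1n; apply.
  lia.
- have := hn (i + j).+3 (mon2 (2 * i + (head (0, 0)%N s).1) (2 * j + (head (0, 0)%N s).2)).
  rewrite sub2_coef1; last exact: hT.
  have e3 : ((head (0, 0)%N s).1 + (head (0, 0)%N s).2 <= 3)%N.
    by move: s_ok; case: (s) => // e s' /and4P[].
  have [f0' f1' f2'] := mon3E i j 1.
  rewrite coef_trunc mdeg_mon2 mdeg3 f0' f1' f2'.
  have -> : (i + j + 1 < (i + j).+3)%N by lia.
  rewrite mulr1n; apply.
  lia.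
Qed.

(** A power series is sent to the values of its truncations at [x^2], [y^2], [f].
    Elements of the completion are approximated layer by layer with [mp_dec]; a
    series in the kernel becomes linear in [Z] after Weierstrass division and then
    vanishes by [linear_null]. *)
Theorem double_cover_completion : completion_iso R E.
Proof.
pose phi (a : pseries k) n := ev (trunc a n).
have evl n T U : low n (T - U) -> mp O x y f n (ev T - ev U).
  by move=> h; rewrite -ev3B; apply: mpL.
have mpE n : max_pow R n = mp O x y f n by apply: max_powE.
have ev_trunc_mul a b n :
    mp O x y f n (phi (ps_mul a b) n - phi a n * phi b n).
  by rewrite -ev3M; apply/evl/trunc_mul.
have ev_eqn b n : mp O x y f n (phi (ps_mul (ps_of_poly E) b) n).
  have -> : phi (ps_mul (ps_of_poly E) b) n =
      phi (ps_mul (ps_of_poly E) b) n - phi (ps_of_poly E) n * phi b n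
      + (phi (ps_of_poly E) n - ev E) * phi b n.
    by rewrite sq_eq; ring.
  apply: mpD; first exact: ev_trunc_mul.
  rewrite -ev3B -ev3M; apply: mpL; apply: lowM.
  exact: trunc_poly.
exists phi; split.
- move=> a n; rewrite mpE; split.
    by apply: (@mpL 0) => m; rewrite ltn0.
  apply: evl => m hm; rewrite mcoeffB !coef_trunc hm.
  by rewrite (ltn_trans hm (ltnSn _)) subrr.
- split=> a b n; rewrite mpE; last exact: ev_trunc_mul.
  by rewrite /phi trunc_add ev3D subrr; apply: mp_0 lp _.
- by move=> c n; rewrite mpE -(ev3C x y f); apply/evl/trunc_poly.
- move=> r hr.
  pose good (p : nat * {mpoly k[3]}) := mp O x y f p.1 (r p.1 - ev p.2).
  have step (p : nat * {mpoly k[3]}) : exists T, good p ->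
      T \is p.1.-homog /\ good (p.1.+1, p.2 + T).
    have [g|ng] := pselect (good p); last by exists 0.
    have [T [hT eT]] : exists T, T \is p.1.-homog /\
        mp O x y f p.1.+1 (r p.1.+1 - ev p.2 - ev T).
      apply: (mp_dec char_k lp).
      have -> : r p.1.+1 - ev p.2 = (r p.1.+1 - r p.1) + (r p.1 - ev p.2) by ring.
      by apply: mpD => //; have [_] := hr p.1; rewrite mpE.
    by exists T => _; split=> //; rewrite /good /= ev3D opprD addrA.
  have [next hnext] := choice step.
  pose S := fix S n := if n is n'.+1 then S n' + next (n', S n') else 0.
  have goodS n : good (n, S n).
    elim: n => [|n /hnext[_ //]]; rewrite /good /= (rmorph0 ev) subr0.
    by have [] := hr 0%N.
  have SD n l m : (mdeg m < n)%N -> (S (n + l)%N)@_m = (S n)@_m.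
    move=> hm; elim: l => [|l IH]; first by rewrite addn0.
    rewrite addnS /= mcoeffD IH; have [hh _] := hnext _ (goodS (n + l)%N).
    rewrite (dhomog_nemf_coeff hh) ?addr0 //=.
    by rewrite neq_ltn (leq_trans hm) ?leq_addr.
  have Slow n m : (n <= mdeg m)%N -> (S n)@_m = 0.
    elim: n => [|n IH] hm /=; first by rewrite mcoeff0.
    rewrite mcoeffD IH ?(ltnW hm) // add0r; have [hh _] := hnext _ (goodS n).
    by rewrite (dhomog_nemf_coeff hh) //= neq_ltn hm orbT.
  exists (fun m => (S (mdeg m).+1)@_m) => n; rewrite mpE.
  suff -> : phi (fun m => (S (mdeg m).+1)@_m) n = ev (S n).
    have -> : ev (S n) - r n = - 1 * (r n - ev (S n)) by ring.
    apply: mpZ; last exact: goodS.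
    by rewrite (opp2 charK); apply: sq_1 lp.
  congr (ev _); apply/mpolyP => m; rewrite coef_trunc.
  have [h|h] := ltnP (mdeg m) n; last first.
    by rewrite mulr0n (Slow _ _ h).
  by rewrite mulr1n -[in RHS](subnKC h) SD.
move=> a; split=> [ha|[b -> n]]; last by rewrite mpE; apply: ev_eqn.
have s_pos : all (fun e => 0 < e.1 + e.2)%N s.
  move: s_ok; case: (s) => // e0 s' /and4P[_ _ h _].
  by apply: sub_all h => e /= /ltnW.
pose b := wquot s a; exists b.
pose c : pseries k := fun m => a m + ps_mul (ps_of_poly E) b m.
have c0 : forall m, c m = 0.
  apply: linear_null => [m m2|n].
    by rewrite /c -(weierstrass char_k) // (addxx char_k).
  have -> : trunc c n = trunc a n + trunc (ps_mul (ps_of_poly E) b) n.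
    exact: trunc_add.
  by rewrite ev3D; apply: mpD; [have := ha n; rewrite mpE | exact: ev_eqn].
by apply/funext => m; apply: (add_eq0_2 char_k); apply: c0.
Qed.

(** The embedding dimension is 3: modulo the square of the maximal ideal there is
    no linear relation between [x^2], [y^2] and [f]. *)
Theorem double_cover_singular : ~ regular2 R.
Proof.
have mpE1 : max_ideal R = mp O x y f 1 by apply: max_idealE.
move=> [a [b []]]; rewrite mpE1 => ma mb gen.
have [mx my mf] := mp_gens f lp.
have lin r : mp O x y f 1 r -> exists c d, mp O x y f 2 (r - (ratC c * a + ratC d * b)).
  move=> /gen[g [h [Rg Rh ->]]].
  have [c [g' [-> hg']]] := sq_dec char_k lp Rg.
  have [d [h' [-> hh']]] := sq_dec char_k lp Rh.
  exists c, d.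
  have -> : (ratC c + g') * a + (ratC d + h') * b - (ratC c * a + ratC d * b)
    = g' * a + h' * b by ring.
  by apply: mpD; apply: (@mpM 1 1).
have [c0 [d0 h0]] := lin _ mx; have [c1 [d1 h1]] := lin _ my.
have [c2 [d2 h2]] := lin _ mf.
pose M : 'M[k]_(3, 2) := \matrix_(i, j) (nth [::] [:: [:: c0; d0]; [:: c1; d1]; [:: c2; d2]] i)`_j.
have [u u0 uM] : exists2 u : 'rV_3, u != 0 & u *m M = 0.
  have : kermx M != 0.
    rewrite kermx_eq0 /row_free neq_ltn; apply/orP; left.
    by rewrite ltnS; apply: rank_leq_col.
  case/rowV0Pn => u /sub_kermxP h hu; by exists u.
have cols : u 0 0 * c0 + u 0 1 * c1 + u 0 2%R * c2 = 0 /\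
            u 0 0 * d0 + u 0 1 * d1 + u 0 2%R * d2 = 0.
  have o1 : lift ord0 ord0 = 1 :> 'I_3 by apply/val_inj.
  have o2 : lift ord0 (lift ord0 ord0) = 2%R :> 'I_3 by apply/val_inj.
  split; [move/matrixP/(_ 0 0): uM | move/matrixP/(_ 0 1): uM];
    by rewrite !mxE !big_ord_recl big_ord0 !mxE /= o2 o1 addr0 addrA.
pose T : {mpoly k[3]} := u 0 0 *: 'X_[mon3 1 0 0] + u 0 1 *: 'X_[mon3 0 1 0]
   + u 0 2%R *: 'X_[mon3 0 0 1].
have coefT i j l : T@_(mon3 i j l) = u 0 0 * ((i == 1) && (j == 0) && (l == 0))%N%:R +
    u 0 1 * ((i == 0) && (j == 1) && (l == 0))%N%:R +
    u 0 2%R * ((i == 0) && (j == 0) && (l == 1))%N%:R.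
  rewrite /T !mcoeffD !mcoeffZ !mcoeffX !mon3_inj.
  by rewrite !(eq_sym i) !(eq_sym j) !(eq_sym l) !andbA.
have hT (m : 'X_{1..3}) : m \in msupp T -> (m 2%R <= 1)%N.
  rewrite mcoeff_msupp (mon3_eta m) coefT; have [_ _ ->] := mon3E (m 0%R) (m 1%R) (m 2%R).
  by case: (m 2%R) => [|[|l]] //=; rewrite !andbF !mulr0 !addr0 eqxx.
have evT : mp O x y f 2 (ev T).
  have eX i j l : ev 'X_[mon3 i j l] = (x ^+ 2) ^+ i * (y ^+ 2) ^+ j * f ^+ l.
    by rewrite ev3X; have [-> -> ->] := mon3E i j l.
  have evZ c U : ev (c *: U) = ratC c * ev U by rewrite -mul_mpolyC ev3M ev3C.
  have [e0 e1] := cols.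
  have r0 : (ratC (u 0 0) * ratC c0 + ratC (u 0 1) * ratC c1 + ratC (u 0 2%R) * ratC c2) = 0 :> K.
    by rewrite -!rmorphM -!rmorphD e0 rmorph0.
  have r1 : (ratC (u 0 0) * ratC d0 + ratC (u 0 1) * ratC d1 + ratC (u 0 2%R) * ratC d2) = 0 :> K.
    by rewrite -!rmorphM -!rmorphD e1 rmorph0.
  have -> : ev T = ratC (u 0 0) * (x ^+ 2 - (ratC c0 * a + ratC d0 * b))
     + ratC (u 0 1) * (y ^+ 2 - (ratC c1 * a + ratC d1 * b))
     + ratC (u 0 2%R) * (f - (ratC c2 * a + ratC d2 * b))
     + (ratC (u 0 0) * ratC c0 + ratC (u 0 1) * ratC c1 + ratC (u 0 2%R) * ratC c2) * a
     + (ratC (u 0 0) * ratC d0 + ratC (u 0 1) * ratC d1 + ratC (u 0 2%R) * ratC d2) * b.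
    by rewrite /T !ev3D !evZ !eX; ring.
  rewrite r0 r1 !mul0r !addr0.
  by apply: mpD; [apply: mpD|]; apply: mpZ => //; exact: (sq_const f lp).
have hn m : (mdeg m < 4)%N -> (sub2 T)@_m = 0.
  by apply: (ev2_free lp); rewrite ev2_sub2; apply: (@mpP 2).
have u00 : u 0 0 = 0.
  have := hn (mon2 (2 * 1) (2 * 0)); rewrite sub2_coef0 // mdeg_mon2 coefT => /(_ isT).
  by rewrite !mulr0 !addr0 mulr1.
have u01 : u 0 1 = 0.
  have := hn (mon2 (2 * 0) (2 * 1)); rewrite sub2_coef0 // mdeg_mon2 coefT => /(_ isT).
  by rewrite !mulr0 addr0 add0r mulr1.
have u02 : u 0 2%R = 0.
  have := hn (mon2 (2 * 0 + (head (0, 0)%N s).1) (2 * 0 + (head (0, 0)%N s).2)).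
  have e3 : ((head (0, 0)%N s).1 + (head (0, 0)%N s).2 <= 3)%N.
    by move: s_ok; case: (s) => // e s' /and4P[].
  rewrite sub2_coef1 // mdeg_mon2 coefT muln0 !add0n ltnS => /(_ e3).
  by rewrite !mulr0 !add0r mulr1.
by case/eqP: u0; apply/rowP => i; rewrite mxE; case: (ord3E i) => ->.
Qed.

End Completion.

(** * Regular points and ordinary double points *)

Section LocalLemmas.
Variable k : closedFieldType.
Hypothesis char_k : 2%N \in [pchar k].
Local Notation K := (ratfun k).
Let charK := pchar_ratfun char_k.
Variables (O : set K) (x y : K).
Hypothesis lp : local_params O x y.
Local Notation I := (pw O x y).

Lemma pw1_const c : I 1 (ratC c) -> c = 0.
Proof.
move=> h; have /eqP : c%:MP_[2] = 0; last by rewrite mpolyC_eq0 => /eqP.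
apply: (lp_free lp (d := 0)); last by rewrite ev2C.
by rewrite -[c%:MP]mulr1 mul_mpolyC dhomogZ // dhomog1.
Qed.

Lemma pw_inv n r : I n.+1 r ->
  exists a b, [/\ I n a, I n b & r = x * a + y * b].
Proof. by []. Qed.

Lemma lp_res a : O a -> exists c i, I 1 i /\ a = ratC c + i.
Proof.
by move=> /(lp_dec lp)[c [a1 [a2 [h1 h2 ->]]]]; exists c, (x * a1 + y * a2); split=> //;
   exists a1, a2.
Qed.

Lemma lp_unit a : O a -> ~ I 1 a -> a != 0 /\ O a^-1.
Proof.
move=> Oa na; split; first by apply: contra_notN na => /eqP ->; exact: pw_0 lp _.
have [c [a1 [a2 [h1 h2 e]]]] := lp_dec lp Oa; rewrite e; apply: (lp_inv lp) => //.
apply: contra_notN na => /eqP c0; rewrite e c0 rmorph0 add0r.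
by exists a1, a2.
Qed.

Lemma pw1_sqr a : O a -> I 1 (a ^+ 2) -> I 1 a.
Proof.
move=> /lp_res[c [i [hi ->]]]; rewrite (sqrrD2 charK) => h.
have : I 1 (ratC (c ^+ 2)).
  have -> : ratC (c ^+ 2) = (ratC c ^+ 2 + i ^+ 2) + i ^+ 2.
    by rewrite rmorphXn -addrA (addxx charK) addr0.
  apply: (pw_add lp) => //; apply: (pw_le lp (isT : (1 <= 2 * 1)%N)).
  exact: (pw_exp lp 2 hi).
by move/pw1_const/eqP; rewrite expf_eq0 => /eqP ->; rewrite rmorph0 add0r.
Qed.

(** At a point where the foliation is regular, [f] has a linear term and can be
    used, together with [y^2], as a system of parameters of the quotient. *)
Lemma regular_span b1 b2 b3 : O b1 -> O b2 -> O b3 -> ~ I 1 b2 ->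
  regular2 (sq_span O (b2 ^+ 2 * x + b1 ^+ 2 * y + b3 ^+ 2 * x * y)).
Proof.
move=> O1 O2 O3 nb2; set f := _ + _.
have Ox := lp_x lp; have Oy := lp_y lp.
have Om := lp_mul lp; have Oa := lp_add lp; have Oe := lp_exp lp.
have If : I 1 f.
  exists (b2 ^+ 2 + b3 ^+ 2 * y), (b1 ^+ 2); split=> /=; [|by auto|rewrite /f; ring].
  by apply: Oa; auto.
have Of : O f by exact: (pw_S lp If).
have one : ~ I 1 1.
  by rewrite -(rmorph1 (@ratC k)) => /pw1_const/eqP; rewrite oner_eq0.
have sub r : sq_span O f r -> O r.
  by move=> [a [s [ha hs ->]]]; apply: Oa; auto.
have Iy2 : I 1 (y ^+ 2).
  by apply: (pw_le lp (isT : (1 <= 2 * 1)%N)); exact: (pw_exp lp 2 (pw_y lp)).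
have max r : sq_span O f r -> I 1 r -> max_ideal (sq_span O f) r.
  move=> Rr Ir; split=> // -[g /sub Og e]; apply: one.
  by rewrite -e mulrC; exact: (pw_scale lp Og Ir).
have O0 := lp_0 lp; have O1' := lp_1 lp.
exists (y ^+ 2), f; split.
- by apply: max => //; exists y, 0; split=> //; rewrite expr0n mul0r addr0.
- by apply: max => //; exists 0, 1; split=> //; rewrite expr0n expr1n mul1r add0r.
move=> r [Rr nu]; have [a [s [ha hs er]]] := Rr.
have Ir : I 1 r.
  apply: contrapT => nr; apply: nu.
  have [r0 Or] := lp_unit (sub _ Rr) nr.
  exists ((a * r^-1) ^+ 2 + (s * r^-1) ^+ 2 * f).
    by exists (a * r^-1), (s * r^-1); split; auto.
  have -> : r * ((a * r^-1) ^+ 2 + (s * r^-1) ^+ 2 * f) =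
     r * r^-1 * (a ^+ 2 + s ^+ 2 * f) * r^-1 by ring.
  by rewrite mulfV // mul1r -er mulfV.
have [a1 [a2 [h1 h2 ea]]] : I 1 a.
  apply: pw1_sqr => //; have -> : a ^+ 2 = r + s ^+ 2 * f.
    by rewrite er -addrA (addxx charK) addr0.
  by apply: (pw_add lp) => //; apply: (pw_scale lp) => //; apply: Oe.
pose w := b2 ^+ 2 + b3 ^+ 2 * y.
have Ow : O w by apply: Oa; auto.
have [w0 Owi] : w != 0 /\ O w^-1.
  apply: lp_unit => // h; apply: nb2; apply: pw1_sqr => //.
  have -> : b2 ^+ 2 = w + b3 ^+ 2 * y by rewrite /w -addrA (addxx charK) addr0.
  apply: (pw_add lp) => //; apply: (pw_scale lp); first exact: Oe.
  exact: pw_y lp.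
(* As [f = x * w + b1^2 * y], squaring expresses [x^2] through [f^2] and [y^2]. *)
have ew : (x * w) ^+ 2 = f ^+ 2 + (b1 ^+ 2 * y) ^+ 2.
  by rewrite /w /f !(sqrrD2 charK); apply: (@eq_mod2 _ charK (x ^+ 2 * b2 ^+ 2 * b3 ^+ 2 * y - b1 ^+ 4 * y ^+ 2)); ring.
have ex : x ^+ 2 = (f ^+ 2 + (b1 ^+ 2 * y) ^+ 2) * w^-1 ^+ 2.
  by rewrite -ew exprMn -mulrA -exprMn mulfV // expr1n mulr1.
exists ((a2 + a1 * b1 ^+ 2 * w^-1) ^+ 2), (s ^+ 2 + (a1 * w^-1) ^+ 2 * f); split.
- exists (a2 + a1 * b1 ^+ 2 * w^-1), 0; rewrite expr0n mul0r addr0; split=> //.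
  by auto 10.
- by exists s, (a1 * w^-1); split; auto.
rewrite er ea !(sqrrD2 charK) [(x * a1) ^+ 2]exprMn ex.
by ring.
Qed.

(** The change is linear with determinant [D], a unit, so the new elements generate
    the same ideal; modulo higher order it does not affect forms in [x] and [y]. *)
Lemma local_params_change i j : I 2 i -> I 2 j -> local_params O (x + i) (y + j).
Proof.
move=> Ii Ij; have Ox := lp_x lp; have Oy := lp_y lp.
have Om := lp_mul lp; have Oa := lp_add lp; have Oe := lp_exp lp.
have [i1 [i2 [Ii1 Ii2 ei]]] := pw_inv Ii.
have [j1 [j2 [Ij1 Ij2 ej]]] := pw_inv Ij.
have Oi1 := pw_S lp Ii1; have Oi2 := pw_S lp Ii2.
have Oj1 := pw_S lp Ij1; have Oj2 := pw_S lp Ij2.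
have O1 := lp_1 lp; have O0 := lp_0 lp.
pose D := 1 + (i1 + j2 + i1 * j2 + i2 * j1).
have ID : I 1 (i1 + j2 + i1 * j2 + i2 * j1).
  apply: (pw_add lp); first apply: (pw_add lp); first exact: (pw_add lp).
  - by apply: (pw_scale lp).
  - by apply: (pw_scale lp).
have [D0 OD] : D != 0 /\ O D^-1.
  apply: lp_unit; first by apply: Oa => //; exact: (pw_S lp ID).
  move=> h; have : I 1 (ratC 1).
    rewrite rmorph1; have -> : 1 = D + (i1 + j2 + i1 * j2 + i2 * j1) :> K.
      by rewrite /D -addrA (addxx charK) addr0.
    exact: (pw_add lp).
  by move/pw1_const/eqP; rewrite oner_eq0.
have ex : x = (x + i) * ((1 + j2) * D^-1) + (y + j) * (i2 * D^-1).
  apply: (mulIf D0); rewrite mulrDl -!mulrA !mulVf // !mulr1 ei ej /D.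
  by apply: (@eq_mod2 _ charK (- (y * i2 * (1 + j2)))); ring.
have ey : y = (x + i) * (j1 * D^-1) + (y + j) * ((1 + i1) * D^-1).
  apply: (mulIf D0); rewrite mulrDl -!mulrA !mulVf // !mulr1 ei ej /D.
  by apply: (@eq_mod2 _ charK (- (x * j1 * (1 + i1)))); ring.
have sub n r : pw O (x + i) (y + j) n r -> I n r.
  elim: n r => [//|n IH] r [a [b [/IH ha /IH hb ->]]].
  apply: (pw_add lp); apply: (pw_mul lp (m := 1)) => //; apply: (pw_add lp).
  - exact: pw_x lp.
  - exact: (pw_S lp Ii).
  - exact: pw_y lp.
  - exact: (pw_S lp Ij).
have cong z t n : I 1 z -> I 2 t -> I n.+1 ((z + t) ^+ n + z ^+ n).
  move=> Iz It; elim: n => [|n IH]; first by rewrite !expr0 (addxx charK); exact: (pw_0 lp).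
  have -> : (z + t) ^+ n.+1 + z ^+ n.+1 =
    z * ((z + t) ^+ n + z ^+ n) + t * (z + t) ^+ n by rewrite !exprS; ring.
  apply: (pw_add lp); first exact: (pw_mul lp (m := 1)).
  rewrite -[n.+2]/((2 + n)%N) -[n in (2 + n)%N]muln1.
  apply: (pw_mul lp) => //; apply: (pw_exp lp); apply: (pw_add lp) => //.
  exact: (pw_S lp It).
split=> //.
- exact: lp_const lp.
- exact: (Oa _ _ Ox (pw_S lp (pw_S lp Ii))).
- exact: (Oa _ _ Oy (pw_S lp (pw_S lp Ij))).
- move=> a /(lp_dec lp)[c [a1 [a2 [h1 h2 ->]]]].
  exists c, ((1 + j2) * D^-1 * a1 + j1 * D^-1 * a2),
            (i2 * D^-1 * a1 + (1 + i1) * D^-1 * a2); split.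
  + by auto 10.
  + by auto 10.
  + by rewrite (congr1 ( *%R^~ a1) ex : x * a1 = _) (congr1 ( *%R^~ a2) ey : y * a2 = _) /=; ring.
- move=> c a1 a2 c0 h1 h2.
  have -> : ratC c + ((x + i) * a1 + (y + j) * a2) =
    ratC c + (x * ((1 + i1) * a1 + j1 * a2) + y * (i2 * a1 + (1 + j2) * a2)).
    by rewrite ei ej; ring.
  by apply: (lp_inv lp) => //; auto 10.
- move=> d Q hQ /sub h; apply: (lp_free lp hQ).
  have -> : ev2 x y Q = ev2 (x + i) (y + j) Q + (ev2 (x + i) (y + j) Q + ev2 x y Q).
    by rewrite addrA (addxx charK) add0r.
  apply: (pw_add lp) => //; rewrite !ev2E -big_split big_seq.
  apply: (pw_sum lp) => m /(dhomog_mf hQ) hm.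
  cbv beta; rewrite -[X in pw _ _ _ _ X]mulrDr; apply: (pw_scale lp); first exact: (lp_const lp).
  have md : (m 0%R + m 1%R)%N = d by rewrite -mdeg2; apply: hm.
  have -> : (x + i) ^+ m 0 * (y + j) ^+ m 1 + x ^+ m 0 * y ^+ m 1 =
    ((x + i) ^+ m 0 + x ^+ m 0) * (y + j) ^+ m 1 +
    x ^+ m 0 * ((y + j) ^+ m 1 + y ^+ m 1).
    by apply: (@eq_mod2 _ charK (- (x ^+ m 0 * (y + j) ^+ m 1))); ring.
  have Iyj : I 1 (y + j) by apply: (pw_add lp); [exact: pw_y lp|exact: (pw_S lp Ij)].
  have := pw_mul lp (cong x i (m 0) (pw_x lp) Ii) (pw_exp lp (m 1) Iyj).
  have := pw_mul lp (pw_exp lp (m 0) (pw_x lp)) (cong y j (m 1) (pw_y lp) Ij).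
  rewrite !muln1 addSn addnS md => ? ?.
  exact: (pw_add lp).
Qed.

(** A singular point at which the vector field does not vanish: completing the
    product [x y + b1^2 y + b2^2 x] gives an ordinary double point. *)
Lemma A1_span b1 b2 : I 1 b1 -> I 1 b2 ->
  let R := sq_span O (x * y + b1 ^+ 2 * y + b2 ^+ 2 * x) in
  completion_iso R (rdp_eqn k A1) /\ ~ regular2 R.
Proof.
move=> h1 h2 R.
have lp' : local_params O (x + b1 ^+ 2) (y + b2 ^+ 2).
  by apply: local_params_change; apply: (pw_exp lp 2 (m := 1)).
have -> : R = sq_span O (\sum_(e <- rdp_exps A1)
    (x + b1 ^+ 2) ^+ e.1 * (y + b2 ^+ 2) ^+ e.2).
  (* The two functions differ by the square of [b1 * b2]. *)
  rewrite big_seq1 /= !expr1.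
  have Om := lp_mul lp; have Oa := lp_add lp.
  have Ob1 := pw_S lp h1; have Ob2 := pw_S lp h2.
  apply/seteqP; split=> _ [a [s [ha hs ->]]].
    exists (a + s * b1 * b2), s; split=> //; first by apply: Oa => //; auto.
    rewrite (sqrrD2 charK).
    by apply: (@eq_mod2 _ charK (- (s * b1 * b2) ^+ 2)); ring.
  exists (a + s * b1 * b2), s; split=> //; first by apply: Oa => //; auto.
  by rewrite (sqrrD2 charK); ring.
split; last exact: double_cover_singular.
by rewrite rdp_eqnE; apply: double_cover_completion.
Qed.

Lemma rdp_span t : rdp_ok t ->
  let R := sq_span O (\sum_(e <- rdp_exps t) x ^+ e.1 * y ^+ e.2) in
  completion_iso R (rdp_eqn k t) /\ ~ regular2 R.
Proof.
move=> /good_rdp ok R; split; last exact: double_cover_singular.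
by rewrite rdp_eqnE; apply: double_cover_completion.
Qed.

End LocalLemmas.

(** * The local rings of the plane *)

Local Open Scope classical_set_scope.
Local Open Scope ring_scope.

Section RegularFunctions.
Variable k : closedFieldType.
Local Notation K := (ratfun k).
Local Notation P := {mpoly k[3]}.
Implicit Types (p q : P) (v : 'rV[k]_3) (f : K).

Lemma hvalD f g : hval (f + g) = hval f + hval g. Proof. exact: rmorphD. Qed.
Lemma hvalM f g : hval (f * g) = hval f * hval g. Proof. exact: rmorphM. Qed.
Lemma hvalX f n : hval (f ^+ n) = hval f ^+ n. Proof. exact: rmorphXn. Qed.
Lemma hvalV f : hval f^-1 = (hval f)^-1. Proof. exact: fmorphV. Qed.
Lemma hval_ratC (c : k) : hval (ratC c) = hfrac c%:MP. Proof. by []. Qed.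
Lemma hval_sum I (s : seq I) (R : pred I) (F : I -> K) :
  hval (\sum_(i <- s | R i) F i) = \sum_(i <- s | R i) hval (F i).
Proof. exact: rmorph_sum. Qed.
Lemma hfracD p q : hfrac (p + q) = hfrac p + hfrac q. Proof. exact: rmorphD. Qed.
Lemma hfracM p q : hfrac (p * q) = hfrac p * hfrac q. Proof. exact: rmorphM. Qed.
Lemma hfracX p n : hfrac (p ^+ n) = hfrac p ^+ n. Proof. exact: rmorphXn. Qed.
Lemma hfrac_sum I (s : seq I) (R : pred I) (F : I -> P) :
  hfrac (\sum_(i <- s | R i) F i) = \sum_(i <- s | R i) hfrac (F i).
Proof. exact: rmorph_sum. Qed.

Definition rat p q : K := insubd (0 : K) (hfrac p / hfrac q).

Lemma hval_rat d p q : p \is d.-homog -> q \is d.-homog -> q != 0 ->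
  hval (rat p q) = hfrac p / hfrac q.
Proof.
move=> hp hq q0; rewrite /rat /hval -[sfval _]/(val _) insubdK //.
by apply/asboolP; exists p, q, d, d; split=> //; rewrite addr0.
Qed.

(** The local ring of the plane at [v]. *)
Definition Oloc v : set K := [set f | exists d p q,
  [/\ p \is d.-homog, q \is d.-homog, heval q v != 0 & hval f = hfrac p / hfrac q]].

Lemma heval_neq0 q v : heval q v != 0 -> q != 0.
Proof. by apply: contra_neq => ->; rewrite heval0. Qed.

Lemma hquot0 s p q : hquot 0 s p q <-> exists d,
  [/\ p \is d.-homog, q \is d.-homog, q != 0 & s = hfrac p / hfrac q].
Proof.
split=> [[d [e [hp hq q0 de ->]]]|[d [hp hq q0 ->]]].
  by exists e; split=> //; move: de; rewrite addr0 => -[<-].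
by exists d, d; split=> //; rewrite addr0.
Qed.

Lemma ratfunP f : exists d p q,
  [/\ p \is d.-homog, q \is d.-homog, q != 0 & hval f = hfrac p / hfrac q].
Proof.
case: f => s /= /asboolP[p [q /hquot0[d [hp hq q0 es]]]].
by exists d, p, q.
Qed.

Lemma open_neq0 d q : q \is d.-homog -> q != 0 -> (exists2 v, v != 0 & heval q v != 0) ->
  open_ne [set v | P2 v /\ heval q v != 0].
Proof.
move=> hq q0 [v v0 qv]; split; last by exists v.
exists [set q]; first by move=> _ ->; exists d.
apply/seteqP; split=> w /= [w0].
  by move=> qw; split=> //; exists q.
by move=> [_ ->].
Qed.

Lemma OX_stalkE v : v != 0 -> OX_stalk v = Oloc v.
Proof.
move=> v0; apply/seteqP; split=> f.
  move=> [U [_ Uv /(_ v Uv)[p [q [/hquot0[d [hp hq q0 e]] qv]]]]].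
  by exists d, p, q.
move=> [d [p [q [hp hq qv e]]]].
exists [set w | P2 w /\ heval q w != 0]; split=> //.
  by apply: (open_neq0 hq); [exact: heval_neq0 qv | exists v].
move=> w /= [_ qw]; exists p, q; split=> //; apply/hquot0; exists d; split=> //.
exact: heval_neq0 qv.
Qed.

Lemma hfrac_neq0 q : q != 0 -> hfrac q != 0.
Proof. by rewrite hfrac_eq0. Qed.

Lemma hfrac_inj : injective (@hfrac k).
Proof.
move=> p q /eqP; rewrite -subr_eq0 -rmorphB hfrac_eq0 subr_eq0 => /eqP.
by [].
Qed.

Lemma eq_frac p q p' q' : q != 0 -> q' != 0 ->
  hfrac p / hfrac q = hfrac p' / hfrac q' -> p * q' = p' * q.
Proof.
move=> q0 q0' /eqP; rewrite eqr_div ?hfrac_neq0 // -!rmorphM => /eqP.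
exact: hfrac_inj.
Qed.

End RegularFunctions.

Lemma mmap2E (k : closedFieldType) (S : comNzRingType) (i : k -> S) (s t : S)
    (Q : {mpoly k[2]}) :
  mmap i (fun j : 'I_2 => if j == 0 then s else t) Q =
  \sum_(m <- msupp Q) i Q@_m * (s ^+ m 0 * t ^+ m 1).
Proof.
apply: eq_bigr => m _; rewrite /mmap1 !big_ord_recl big_ord0 mulr1 /=.
by congr (_ * (_ * _ ^+ m _)); apply/val_inj.
Qed.

Lemma frac_dec (F : fieldType) (p q y c y1 m1 y2 m2 : F) : q != 0 -> y != 0 ->
  p * y = c * q * y + y1 * m1 + y2 * m2 ->
  p / q = c + (y1 / y * (m1 / q) + y2 / y * (m2 / q)).
Proof.
move=> q0 y0 e; apply: (mulIf q0); apply: (mulIf y0); rewrite divfK // e.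
by field; rewrite q0 y0.
Qed.

Lemma frac_comb (F : fieldType) (c y y1 y2 p q p' q' : F) :
  q != 0 -> q' != 0 -> y != 0 ->
  c + (y1 / y * (p / q) + y2 / y * (p' / q')) =
  (c * (y * (q * q')) + y1 * (p * q') + y2 * (q * p')) / (y * (q * q')).
Proof. by move=> q0 q0' y0; field; rewrite q0 q0' y0. Qed.

Lemma frac_pow (F : fieldType) (c y y1 y2 : F) i j : y != 0 ->
  c * ((y1 / y) ^+ i * (y2 / y) ^+ j) = c * (y1 ^+ i * y2 ^+ j) / y ^+ (i + j).
Proof.
by move=> y0; rewrite !expr_div_n exprD; field; rewrite !expf_neq0.
Qed.

Lemma pow_collect (R : comPzRingType) (a b t r r' g g' : R) n :
  a * t ^+ 1 * (t ^+ n * r * g') + b * t ^+ 1 * (g * (t ^+ n * r')) =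
  t ^+ n.+1 * (a * r * g' + b * r' * g).
Proof. by rewrite [t ^+ n.+1]exprS; ring. Qed.

Lemma pow_weight (R : comPzRingType) (c a b t : R) i j :
  c * ((a * t ^+ 1) ^+ i * (b * t ^+ 1) ^+ j) = c * (a ^+ i * b ^+ j) * t ^+ (i + j).
Proof. by rewrite expr1 !exprMn exprD; ring. Qed.

Lemma pow_cancel (R : comPzRingType) (a t g r h : R) d :
  a * t ^+ d * g = t ^+ d.+1 * r * h -> a * g * t ^+ d = t * (r * h) * t ^+ d.
Proof. by rewrite [t ^+ d.+1]exprS => e; rewrite mulrAC e; ring. Qed.

Section LocalFrame.
Variable k : closedFieldType.
Local Notation K := (ratfun k).
Local Notation P := {mpoly k[3]}.
Variables (A : 'M[k]_3).
Hypothesis Au : A \in unitmx.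
Let v : 'rV[k]_3 := e0 k *m A.

(** The coordinate forms with respect to the basis formed by the rows of [B]. *)
Definition frame (B : 'M[k]_3) i : P := subst (invmx B) 'X_i.
Local Notation Y := (frame A).

Lemma frame_homog i : Y i \is 1.-homog.
Proof. by apply: subst_homog; apply: dhomog_Xi. Qed.

Lemma frame_v i : heval (Y i) v = (i == 0)%:R.
Proof.
rewrite heval_subst /v mulmxK // hevalXi mxE.
by case: i => [[|[|[|//]]] h].
Qed.

Lemma frame0_v : heval (Y 0) v != 0.
Proof. by rewrite frame_v oner_neq0. Qed.
Let Y0 : Y 0 != 0 := heval_neq0 frame0_v.

Definition xc : K := rat (Y 1) (Y 0).
Definition yc : K := rat (Y 2%R) (Y 0).

Lemma hval_xc : hval xc = hfrac (Y 1) / hfrac (Y 0).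
Proof. by apply: (hval_rat (d := 1)); rewrite ?frame_homog ?Y0. Qed.

Lemma hval_yc : hval yc = hfrac (Y 2%R) / hfrac (Y 0).
Proof. by apply: (hval_rat (d := 1)); rewrite ?frame_homog ?Y0. Qed.

Local Notation O := (Oloc v).

Lemma Oloc_const c : O (ratC c).
Proof.
exists 0%N, c%:MP, 1; rewrite dhomogC dhomog1 heval1 oner_neq0.
by split=> //; rewrite hval_ratC rmorph1 divr1.
Qed.

Lemma Oloc_add a b : O a -> O b -> O (a + b).
Proof.
move=> [d [p [q [hp hq qv ea]]]] [e [p' [q' [hp' hq' qv' eb]]]].
have q0 := hfrac_neq0 (heval_neq0 qv); have q0' := hfrac_neq0 (heval_neq0 qv').
exists (d + e)%N, (p * q' + p' * q), (q * q'); split.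
- by apply: rpredD; [exact: dhomogM | rewrite addnC; exact: dhomogM].
- exact: dhomogM.
- by rewrite hevalM mulf_neq0.
- by rewrite hvalD ea eb addf_div // hfracD !hfracM.
Qed.

Lemma Oloc_mul a b : O a -> O b -> O (a * b).
Proof.
move=> [d [p [q [hp hq qv ea]]]] [e [p' [q' [hp' hq' qv' eb]]]].
exists (d + e)%N, (p * p'), (q * q'); split.
- exact: dhomogM.
- exact: dhomogM.
- by rewrite hevalM mulf_neq0.
- by rewrite hvalM ea eb mulf_div !hfracM.
Qed.

Lemma Oloc_x : O xc.
Proof. by exists 1%N, (Y 1), (Y 0); rewrite !frame_homog frame0_v hval_xc. Qed.

Lemma Oloc_y : O yc.
Proof. by exists 1%N, (Y 2%R), (Y 0); rewrite !frame_homog frame0_v hval_yc. Qed.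

Lemma Oloc_value d p q a : p \is d.-homog -> q \is d.-homog -> heval q v != 0 ->
  hval a = hfrac p / hfrac q -> exists a1 a2,
  [/\ O a1, O a2 & a = ratC (heval p v / heval q v) + (xc * a1 + yc * a2)].
Proof.
move=> hp hq qv ea.
have q0 := heval_neq0 qv.
pose c := heval p v / heval q v; pose n := p - c%:MP * q.
have hn : n \is d.-homog.
  by rewrite rpredB // mul_mpolyC rpredZ.
have nv : heval (subst A n) (e0 k) = 0.
  by rewrite heval_subst -/v hevalB hevalM hevalC /c divfK ?subrr.
have [n1 [n2 [en h1 h2]]] := split_e0 (subst_homog A hn) nv.
pose m1 := subst (invmx A) (n1 * 'X_0); pose m2 := subst (invmx A) (n2 * 'X_0).
have hm1 : m1 \is d.-homog by apply: subst_homog.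
have hm2 : m2 \is d.-homog by apply: subst_homog.
exists (rat m1 q), (rat m2 q); split.
- by exists d, m1, q; rewrite (hval_rat hm1 hq q0).
- by exists d, m2, q; rewrite (hval_rat hm2 hq q0).
apply: hval_inj; rewrite !hvalD !hvalM.
rewrite (hval_rat hm1 hq q0) (hval_rat hm2 hq q0) hval_xc hval_yc.
rewrite hval_ratC ea.
have e : p * Y 0 = c%:MP * q * Y 0 + Y 1 * m1 + Y 2%R * m2.
  have -> : p = c%:MP * q + n by rewrite /n; ring.
  have -> : n = subst (invmx A) (n1 * 'X_1 + n2 * 'X_2) by rewrite -en substK.
  by rewrite /m1 /m2 !(substD, substM) -!/(Y _); ring.
apply: (frac_dec (hfrac_neq0 q0) (hfrac_neq0 Y0)).
by rewrite -hfracM e !hfracD !hfracM.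
Qed.

Lemma Oloc_dec a : O a ->
  exists c a1 a2, [/\ O a1, O a2 & a = ratC c + (xc * a1 + yc * a2)].
Proof.
move=> [d [p [q [hp hq qv ea]]]].
by exists (heval p v / heval q v); exact: (Oloc_value hp hq qv ea).
Qed.

Lemma Oloc_inv c a1 a2 : c != 0 -> O a1 -> O a2 ->
  O (ratC c + (xc * a1 + yc * a2))^-1.
Proof.
move=> c0 [d [p [q [hp hq qv ea]]]] [e [p' [q' [hp' hq' qv' eb]]]].
have q0 := hfrac_neq0 (heval_neq0 qv); have q0' := hfrac_neq0 (heval_neq0 qv').
have Yf := hfrac_neq0 Y0.
pose D := Y 0 * (q * q'); pose N := c%:MP * D + Y 1 * (p * q') + Y 2%R * (q * p').
have hD : D \is (1 + (d + e)).-homog.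
  by do 2?apply: dhomogM => //; exact: frame_homog.
have hN : N \is (1 + (d + e)).-homog.
  rewrite /N mul_mpolyC; apply: rpredD; first apply: rpredD; first exact: rpredZ.
    by do 2?apply: dhomogM => //; exact: frame_homog.
  by do 2?apply: dhomogM => //; exact: frame_homog.
have Nv : heval N v != 0.
  rewrite /N !hevalD !hevalM hevalC !frame_v /= !mul0r !addr0 mul1r.
  by rewrite !mulf_neq0.
exists (1 + (d + e))%N, D, N; split=> //.
rewrite hvalV -invf_div; congr (_^-1).
rewrite !hvalD !hvalM ea eb hval_xc hval_yc hval_ratC.
rewrite /N /D !hfracD !hfracM.
exact: (frac_comb _ _ _ _ _ q0 q0' Yf).
Qed.

(** Weight 1 for the coordinates vanishing at the base point: the order of
    vanishing is read off as a power of the grading variable. *)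
Let w : 'I_3 -> nat := fun i => (i != 0).
Let G (p : P) : {poly P} := grade w (subst A p).

Lemma G_M p q : G (p * q) = G p * G q.
Proof. by rewrite /G substM gradeM. Qed.
Lemma G_D p q : G (p + q) = G p + G q.
Proof. by rewrite /G substD gradeD. Qed.

Lemma G_C c : G c%:MP = (c%:MP)%:P.
Proof. by rewrite /G substC gradeC. Qed.

Lemma G_frame i : G (Y i) = ('X_i)%:P * 'X^(w i).
Proof.
rewrite /G substVK // gradeX; congr (_ * 'X^_).
rewrite /wdeg (bigD1 i) //= mnm1E eqxx muln1 big1 ?addn0 // => j ji.
by rewrite mnm1E eq_sym (negPf ji) muln0.
Qed.

(** An element of the [n]-th power vanishes to order [n] at the base point. *)
Lemma pw_order n a : pw O xc yc n a -> exists d p q r,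
  [/\ p \is d.-homog, q \is d.-homog, heval q v != 0,
      hval a = hfrac p / hfrac q & G p = 'X^n * r].
Proof.
elim: n a => [|n IH] a.
  move=> [d [p [q [hp hq qv ea]]]]; exists d, p, q, (G p).
  by split=> //; rewrite expr0 mul1r.
move=> [a1 [a2 [/IH[d [p [q [r [hp hq qv ea er]]]]] ]]].
move=> /IH[e [p' [q' [r' [hp' hq' qv' eb er']]]]] ->.
have q0 := hfrac_neq0 (heval_neq0 qv); have q0' := hfrac_neq0 (heval_neq0 qv').
have Yf := hfrac_neq0 Y0.
exists (1 + (d + e))%N, (Y 1 * (p * q') + Y 2%R * (q * p')), (Y 0 * (q * q')).
exists (('X_1)%:P * r * G q' + ('X_2)%:P * r' * G q); split.
- by apply: rpredD; do 2?apply: dhomogM => //; exact: frame_homog.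
- by do 2?apply: dhomogM => //; exact: frame_homog.
- by rewrite !hevalM frame_v mul1r mulf_neq0.
- rewrite !hvalD !hvalM ea eb hval_xc hval_yc !hfracD !hfracM.
  have := frac_comb 0 (hfrac (Y 1)) (hfrac (Y 2%R)) (hfrac p) (hfrac p') q0 q0' Yf.
  by rewrite mul0r !add0r.
- rewrite G_D G_M (G_M p) (G_M (Y 2%R)) (G_M q) !G_frame er er'.
  exact: pow_collect.
Qed.

(** The constant term in the grading variable is the value at the base point, times
    a power of the coordinate form that does not vanish there. *)
Lemma G_unit q : heval q v != 0 -> forall d, q \is d.-homog -> (G q)`_0 != 0.
Proof.
move=> qv d hq; apply: contra_neq qv => h.
rewrite /v -heval_subst (heval_e0 (subst_homog A hq)).
have := coef_grade w (subst A q) 0 (U_(0%R) *+ d)%MM; rewrite -/(G q) h mcoeff0.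
suff -> : wdeg w (U_(0%R) *+ d)%MM = 0%N by rewrite eqxx mulr1n => <-.
rewrite /wdeg big1 // => i _; rewrite mulmnE mnm1E (eq_sym 0) /w.
by case: (i == 0); rewrite ?mul0n ?muln0.
Qed.

(** Clearing denominators, a form of degree [d] in the two vanishing coordinates
    would be divisible by the power [d.+1] of the grading variable. *)
Lemma Oloc_free d (Q : {mpoly k[2]}) : Q \is d.-homog ->
  pw O xc yc d.+1 (ev2 xc yc Q) -> Q = 0.
Proof.
move=> hQ /pw_order[e [p [q [r [hp hq qv ea er]]]]].
pose QY : P := mmap (@mpolyC 3 k) (fun j : 'I_2 => if j == 0 then Y 1 else Y 2%R) Q.
pose QX : P := mmap (@mpolyC 3 k) (fun j : 'I_2 => if j == 0 then 'X_1 else 'X_2) Q.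
have Yf := hfrac_neq0 Y0.
have sumQ : hval (ev2 xc yc Q) = hfrac QY / hfrac (Y 0) ^+ d.
  rewrite ev2E /QY mmap2E hval_sum hfrac_sum mulr_suml !big_seq; apply: eq_bigr => m mQ.
  have <- : (m 0%R + m 1%R)%N = d by rewrite -mdeg2; exact: (dhomog_mf hQ mQ).
  rewrite !hvalM !hvalX !hfracM !hfracX hval_xc hval_yc hval_ratC.
  exact: frac_pow.
have GQ : G QY = QX%:P * 'X^d.
  have G_sum I (s : seq I) (F : I -> P) : G (\sum_(i <- s) F i) = \sum_(i <- s) G (F i).
    by rewrite /G subst_sum rmorph_sum.
  have G_exp p' n : G (p' ^+ n) = G p' ^+ n by rewrite /G subst_exp rmorphXn.
  have CP I (s : seq I) (F : I -> P) : (\sum_(i <- s) F i)%:P = \sum_(i <- s) (F i)%:P.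
    exact: (rmorph_sum polyC).
  rewrite /QY /QX !mmap2E G_sum CP mulr_suml !big_seq; apply: eq_bigr => m mQ.
  have <- : (m 0%R + m 1%R)%N = d by rewrite -mdeg2; exact: (dhomog_mf hQ mQ).
  rewrite (G_M _%:MP) (G_M (Y 1 ^+ _)) !G_exp !G_frame G_C !polyCM !polyC_exp.
  exact: pow_weight.
have q0 := heval_neq0 qv.
have eq1 : QY * q = p * Y 0 ^+ d.
  apply: eq_frac => //; first by rewrite expf_neq0.
  by rewrite -ea sumQ hfracX.
have : QX%:P * G q = 'X * (r * G (Y 0 ^+ d)).
  have Xd : 'X^d != 0 :> {poly P} by rewrite -size_poly_eq0 size_polyXn.
  have e1 : QX%:P * 'X^d * G q = 'X^(d.+1) * r * G (Y 0 ^+ d).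
    by rewrite -GQ -(G_M QY q) eq1 (G_M p) er.
  exact: (mulIf Xd (pow_cancel e1)).
move/(congr1 (fun f : {poly P} => f`_0)); rewrite coefCM coefXM /= => /eqP.
rewrite mulf_eq0 (negPf (G_unit qv hq)) orbF => /eqP QX0.
apply/mpolyP => u; rewrite mcoeff0.
have := congr1 (mcoeff (U_(1%R) *+ u 0%R + U_(2%R) *+ u 1%R)%MM) QX0.
rewrite mcoeff0 => <-; rewrite /QX mmap2E [in LHS](mpolyE Q) !raddf_sum /=.
apply: eq_bigr => m _; rewrite !mpolyXn -mpolyXD mcoeffCM mcoeffZ !mcoeffX.
congr (_ * (nat_of_bool _)%:R); apply/eqP/eqP => [->//|/mnmP em].
have := em 1; have := em 2%R.
rewrite ![(_ *+ _ + _ *+ _)%MM _]mnmDE !mulmnE !mnm1E /= !mul1n !mul0n !addn0 !add0n.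
move=> e1 e0'; apply/mnmP => -[[|[|//]] hi].
  by have -> : Ordinal hi = 0 by apply/val_inj.
by have -> : Ordinal hi = 1 by apply/val_inj.
Qed.

Lemma frame_local_params : local_params O xc yc.
Proof.
split; [exact: Oloc_const | exact: Oloc_add | exact: Oloc_mul | exact: Oloc_x
  | exact: Oloc_y | exact: Oloc_dec | exact: Oloc_inv | exact: Oloc_free].
Qed.

End LocalFrame.

(** * The local rings of the quotient *)

Lemma mpoly_unit_const (k : closedFieldType) (q : {mpoly k[3]}) d :
  q \is a GRing.unit -> q \is d.-homog -> d = 0%N.
Proof.
move=> qU hq; case: d hq => // d hq; have [v v0 qv] := homog_zero hq (ltn0Sn d).
have := congr1 (fun p => heval p v) (mulrV qU).
by rewrite /= hevalM qv mul0r heval1 => /esym/eqP; rewrite oner_eq0.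
Qed.

Lemma homog0_const (k : closedFieldType) (p : {mpoly k[3]}) : p \is 0.-homog -> p = (p@_0)%:MP.
Proof.
move=> hp; apply/mpolyP => m; rewrite mcoeffC; have [<-|m0] := eqVneq 0%MM m; first by rewrite mulr1.
by rewrite mulr0 (dhomog_nemf_coeff hp) // mdeg_eq0 eq_sym.
Qed.

Lemma homog0_unit (k : closedFieldType) (p : {mpoly k[3]}) : p \is 0.-homog -> p != 0 -> p \is a GRing.unit.
Proof.
move=> hp p0; have e := homog0_const hp; rewrite e; apply: rmorph_unit; rewrite unitfE.
by apply: contraNneq p0 => c0; rewrite e c0 mpolyC0.
Qed.

Lemma prime_exists (k : closedFieldType) : exists p : {mpoly k[3]}, prime_elt p.
Proof.
have [|p pp _] := divides_prime_factor (@factorial_mpoly k 3) (X_neq0 k 0); last by exists p.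
by apply/negP => /mpoly_unit_const/(_ (dhomog_Xi _ 0)).
Qed.

Lemma deg_sum1 d e m : (d * 2 + (e + m.+1) * 2 = (d + e + m.+1) * 2)%N.
Proof. lia. Qed.

Lemma deg_sum2 d e m : ((e + d) * 2 + 2 * m.+1 = (d + e + m.+1) * 2)%N.
Proof. lia. Qed.

Lemma dhomog_cast (k : closedFieldType) (d d' : nat) (p : {mpoly k[3]}) :
  d = d' -> p \is d.-homog -> p \is d'.-homog.
Proof. by move=> ->. Qed.

Lemma dual_expand (R : comNzRingType) (char2 : 2%N \in [pchar R])
    (u1 u2 u3 c0 c1 c2 y0 y1 y2 : R) :
  (u1 * c1 + u2 * c2) ^+ 2 * y0 + (u1 * c0 + u3 * c2) ^+ 2 * y1
    + (u2 * c0 + u3 * c1) ^+ 2 * y2 =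
  u3 ^+ 2 * (y1 * c2 ^+ 2 + y2 * c1 ^+ 2) + u2 ^+ 2 * (y0 * c2 ^+ 2 + y2 * c0 ^+ 2)
    + u1 ^+ 2 * (y0 * c1 ^+ 2 + y1 * c0 ^+ 2).
Proof. by rewrite !(sqrrD2 char2); ring. Qed.

Lemma square_quot (F : fieldType) (p q u ty t y n : F) : q != 0 -> y != 0 ->
  p * q = u ^+ 2 + t ^+ 2 * n -> ty = t * y ->
  p / q = (u / q) ^+ 2 + (ty / q) ^+ 2 * (n / y ^+ 2).
Proof.
move=> q0 y0 e ->; have -> : p / q = (p * q) / q ^+ 2 by field.
by rewrite e; field; rewrite q0 y0.
Qed.

Section MorphismExpansions.
Variables (R S : comPzRingType) (f : {rmorphism R -> S}).

Lemma morph_num (c0 c1 c2 y0 y1 y2 : R) :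
  f (c0 ^+ 2 * (y1 * y2) + c1 ^+ 2 * (y0 * y2) + c2 ^+ 2 * (y0 * y1)) =
  f c0 ^+ 2 * (f y1 * f y2) + f c1 ^+ 2 * (f y0 * f y2) + f c2 ^+ 2 * (f y0 * f y1).
Proof. by rewrite !rmorphD !rmorphM. Qed.

Lemma morph_loc (g0 g1 g2 x y : R) :
  f (g0 ^+ 2 * x * y + g1 ^+ 2 * y + g2 ^+ 2 * x) =
  f g0 ^+ 2 * f x * f y + f g1 ^+ 2 * f y + f g2 ^+ 2 * f x.
Proof. by rewrite !rmorphD !rmorphM. Qed.

Lemma morph_square (p q p' q' y n : R) :
  f (p ^+ 2 * (q' * y) ^+ 2 + (p' * q) ^+ 2 * n) =
  f p ^+ 2 * (f q' * f y) ^+ 2 + (f p' * f q) ^+ 2 * f n.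
Proof. by rewrite !rmorphD !rmorphM. Qed.

Lemma morph_dec (a0 a1 a2 a3 x0 x1 x2 : R) :
  f (a0 ^+ 2 + a1 ^+ 2 * x0 * x1 + a2 ^+ 2 * x0 * x2 + a3 ^+ 2 * x1 * x2) =
  f a0 ^+ 2 + (f a3 ^+ 2 * (f x1 * f x2) + f a2 ^+ 2 * (f x0 * f x2)
  + f a1 ^+ 2 * (f x0 * f x1)).
Proof. by rewrite !rmorphD !rmorphM; ring. Qed.

Lemma morph_den (q q' y : R) : f ((q * q' * y) ^+ 2) = (f q * f q' * f y) ^+ 2.
Proof. by rewrite !rmorphM. Qed.

Lemma morph_span (a s n : R) : f (a ^+ 2 + s ^+ 2 * n) = f a ^+ 2 + f s ^+ 2 * f n.
Proof. by rewrite !rmorphD !rmorphM. Qed.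

End MorphismExpansions.

Section Kernel.
Variable k : closedFieldType.
Hypothesis char_k : 2%N \in [pchar k].
Local Notation K := (ratfun k).
Local Notation P := {mpoly k[3]}.
Let charP : 2%N \in [pchar P] := pchar_mpoly char_k 3.
Variables (m : nat) (b : 'I_3 -> P).
Hypothesis bm : forall i, b i \is m.-homog.
Hypothesis bp : forall p, prime_elt p -> exists i, ~ divides p (b i).

(** The local ring at [v] of the quotient by the vector field [vf b]. *)
Definition Rloc (v : 'rV[k]_3) : set K := [set f | exists d p q,
  [/\ p \is d.-homog, q \is d.-homog, heval q v != 0, hval f = hfrac p / hfrac q &
      vf b p * q = p * vf b q]].

Variable A : 'M[k]_3.
Hypothesis Au : A \in unitmx.
Let v : 'rV[k]_3 := e0 k *m A.
Local Notation Y := (frame A).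
Local Notation O := (Oloc v).
Local Notation x := (xc A).
Local Notation y := (yc A).

(** The square roots of the components of the vector field in the frame. *)
Definition fcomp i : P := \sum_j rt (invmx A j i) *: b j.
Local Notation c := fcomp.

Lemma fcomp_homog i : c i \is m.-homog.
Proof. by apply: rpred_sum => j _; apply: rpredZ; exact: bm. Qed.

Lemma vf_sum I (s : seq I) (F : I -> P) :
  vf b (\sum_(i <- s) F i) = \sum_(i <- s) vf b (F i).
Proof.
elim: s => [|i s IH]; first by rewrite !big_nil -mpolyC0 vfC.
by rewrite !big_cons vfD IH.
Qed.

Lemma vfZ a p : vf b (a *: p) = a *: vf b p.
Proof. by rewrite -!mul_mpolyC vfM vfC mulr0 addr0. Qed.

Lemma vf_sqrM p q : vf b (p ^+ 2 * q) = p ^+ 2 * vf b q.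
Proof. by rewrite vfM (vf_sqr char_k) mulr0 addr0. Qed.

Lemma vf_lin3 p0 p1 p2 q0 q1 q2 :
  vf b (p0 ^+ 2 * (q1 * q2) + p1 ^+ 2 * (q0 * q2) + p2 ^+ 2 * (q0 * q1)) =
  p0 ^+ 2 * (q1 * vf b q2 + q2 * vf b q1) + p1 ^+ 2 * (q0 * vf b q2 + q2 * vf b q0)
  + p2 ^+ 2 * (q0 * vf b q1 + q1 * vf b q0).
Proof. by rewrite !vfD !vf_sqrM (vfM b q1) !(vfM b q0). Qed.

Lemma vf_frame i : vf b (Y i) = c i ^+ 2.
Proof.
rewrite /frame substXi vf_sum /fcomp (sqr_sum charP); apply: eq_bigr => j _.
by rewrite vfZ vfX exprZn rtK.
Qed.

Lemma fcomp_inv j : b j = \sum_i rt (A i j) *: c i.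
Proof.
rewrite /fcomp; under eq_bigr => i _ do rewrite scaler_sumr.
rewrite exchange_big /=.
rewrite (bigD1 j) //= [X in _ + X]big1 ?addr0 => [|l lj].
  under eq_bigr => i _ do rewrite scalerA.
  rewrite -scaler_suml.
  suff -> : \sum_i rt (A i j) * rt (invmx A j i) = 1 by rewrite scale1r.
  apply: (sqr_inj2 char_k); rewrite (sqr_sum char_k) expr1n.
  transitivity ((invmx A *m A) j j); last by rewrite mulVmx // mxE eqxx.
  by rewrite mxE; apply: eq_bigr => i _; rewrite exprMn !rtK mulrC.
under eq_bigr => i _ do rewrite scalerA.
rewrite -scaler_suml.
suff -> : \sum_i rt (A i j) * rt (invmx A l i) = 0 by rewrite scale0r.
apply: (sqr_inj2 char_k); rewrite (sqr_sum char_k) expr0n.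
transitivity ((invmx A *m A) l j); last by rewrite mulVmx // mxE (negPf lj).
by rewrite mxE; apply: eq_bigr => i _; rewrite exprMn !rtK mulrC.
Qed.

Lemma fcomp_prime p : prime_elt p -> exists i, ~ divides p (c i).
Proof.
move=> /bp[j nj]; apply: contrapT => hn; apply: nj; rewrite fcomp_inv.
apply: divides_sum => i _; rewrite -mul_mpolyC; apply: dividesMl.
by apply: contrapT => h; apply: hn; exists i.
Qed.

Lemma fcomp_neq0 : exists i, c i != 0.
Proof.
have [p pp] := prime_exists k; have [i ni] := fcomp_prime pp.
by exists i; apply/eqP => z; apply: ni; rewrite z; exact: divides0.
Qed.

Definition gam i : K := rat (c i) (Y 0 ^+ m).
(** The function whose differential defines the foliation in this chart. *)
Definition ffun_loc : K := gam 0 ^+ 2 * x * y + gam 1 ^+ 2 * y + gam 2%R ^+ 2 * x.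

Lemma frameX_homog n : Y 0 ^+ n \is n.-homog.
Proof. by have := dhomogMn n (frame_homog A 0); rewrite mul1n. Qed.

Lemma frame0_neq0 : Y 0 != 0.
Proof. by apply: (heval_neq0 (v := v)); rewrite frame0_v. Qed.

Lemma hval_gam i : hval (gam i) = hfrac (c i) / hfrac (Y 0) ^+ m.
Proof.
rewrite (hval_rat (fcomp_homog i) (frameX_homog m)) ?hfracX //.
by rewrite expf_neq0 // frame0_neq0.
Qed.

(** The numerator of [ffun_loc]. *)
Definition fnum : P := c 0 ^+ 2 * (Y 1 * Y 2%R) + c 1 ^+ 2 * (Y 0 * Y 2%R)
  + c 2%R ^+ 2 * (Y 0 * Y 1).

Lemma fnum_homog : fnum \is (2 * m.+1).-homog.
Proof.
have h i : c i ^+ 2 \is (m * 2).-homog by apply: dhomogMn; exact: fcomp_homog.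
have -> : (2 * m.+1 = m * 2 + 1 + 1)%N by lia.
rewrite -addnA.
have hY i j : Y i * Y j \is (1 + 1).-homog by apply: dhomogM; exact: frame_homog.
by do 2?[apply: rpredD]; apply: dhomogM.
Qed.

Lemma vf_fnum : vf b fnum = 0.
Proof.
rewrite /fnum vf_lin3 !vf_frame.
apply: (@eq_mod2 _ charP (c 0 ^+ 2 * c 1 ^+ 2 * Y 2%R + c 0 ^+ 2 * c 2%R ^+ 2 * Y 1
   + c 1 ^+ 2 * c 2%R ^+ 2 * Y 0)).
by ring.
Qed.

Lemma frac_f (F : fieldType) (c0 c1 c2 y0 y1 y2 : F) : y0 != 0 ->
  (c0 / y0 ^+ m) ^+ 2 * (y1 / y0) * (y2 / y0) + (c1 / y0 ^+ m) ^+ 2 * (y2 / y0)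
   + (c2 / y0 ^+ m) ^+ 2 * (y1 / y0) =
  (c0 ^+ 2 * (y1 * y2) + c1 ^+ 2 * (y0 * y2) + c2 ^+ 2 * (y0 * y1)) / (y0 ^+ m.+1) ^+ 2.
Proof.
move=> h; have hm : y0 ^+ m != 0 by rewrite expf_neq0.
by rewrite [y0 ^+ m.+1]exprS; field; rewrite h hm.
Qed.

Lemma hval_f : hval ffun_loc = hfrac fnum / (hfrac (Y 0) ^+ m.+1) ^+ 2.
Proof.
rewrite /ffun_loc /fnum (morph_loc (@hval k)) (morph_num (@hfrac k)) /=.
rewrite !hval_gam (hval_xc Au) (hval_yc Au).
exact: (frac_f _ _ _ _ _ (hfrac_neq0 frame0_neq0)).
Qed.

Lemma square_frac (F : fieldType) (p q p' q' y0 n : F) : q != 0 -> q' != 0 -> y0 != 0 ->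
  (p / q) ^+ 2 + (p' / q') ^+ 2 * (n / y0 ^+ 2) =
  (p ^+ 2 * (q' * y0) ^+ 2 + (p' * q) ^+ 2 * n) / (q * q' * y0) ^+ 2.
Proof. by move=> q0 q0' h; field; rewrite h q0 q0'. Qed.

Lemma sq_span_Rloc : sq_span O ffun_loc `<=` Rloc v.
Proof.
move=> _ [a [s [[d [p [q [hp hq qv ea]]]] [e [p' [q' [hp' hq' qv' es]]]] ->]]].
have q0 := hfrac_neq0 (heval_neq0 qv); have q0' := hfrac_neq0 (heval_neq0 qv').
have Yv : heval (Y 0 ^+ m.+1) v != 0 by rewrite heval_exp expf_neq0 // frame0_v.
exists ((d + e + m.+1) * 2)%N,
  (p ^+ 2 * (q' * Y 0 ^+ m.+1) ^+ 2 + (p' * q) ^+ 2 * fnum),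
  ((q * q' * Y 0 ^+ m.+1) ^+ 2); split.
- have hy : q' * Y 0 ^+ m.+1 \is (e + m.+1).-homog.
    by apply: dhomogM => //; exact: frameX_homog.
  have hpq : p' * q \is (e + d).-homog by apply: dhomogM.
  apply: rpredD.
    exact: (dhomog_cast (deg_sum1 d e m) (dhomogM (dhomogMn 2 hp) (dhomogMn 2 hy))).
  exact: (dhomog_cast (deg_sum2 d e m) (dhomogM (dhomogMn 2 hpq) fnum_homog)).
- apply: dhomogMn; apply: dhomogM; first exact: dhomogM.
  exact: frameX_homog.
- by rewrite heval_exp expf_neq0 // !hevalM !mulf_neq0.
- rewrite (morph_span (@hval k) a s ffun_loc :
    hval _ = hval a ^+ 2 + hval s ^+ 2 * hval ffun_loc).
  rewrite (morph_square (@hfrac k) p q p' q' (Y 0 ^+ m.+1) fnum : hfrac _ = hfrac p ^+ 2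
    * (hfrac q' * hfrac (Y 0 ^+ m.+1)) ^+ 2 + (hfrac p' * hfrac q) ^+ 2 * hfrac fnum).
  rewrite (morph_den (@hfrac k) q q' (Y 0 ^+ m.+1) :
    hfrac _ = (hfrac q * hfrac q' * hfrac (Y 0 ^+ m.+1)) ^+ 2).
  rewrite (hfracX (Y 0)) ea es hval_f.
  exact: (square_frac _ _ _ q0 q0' (expf_neq0 m.+1 (hfrac_neq0 frame0_neq0))).
- have -> : p ^+ 2 * (q' * Y 0 ^+ m.+1) ^+ 2 = (p * (q' * Y 0 ^+ m.+1)) ^+ 2 by rewrite [RHS]exprMn.
  by rewrite vfD vf_sqrM vf_fnum !(vf_sqr char_k) !mulr0 addr0 mul0r.
Qed.

(** Differentiation kills the squares and isolates one of them at a time. *)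
Lemma frame_sq_indep s0 s1 s2 :
  s0 ^+ 2 * Y 0 + s1 ^+ 2 * Y 1 + s2 ^+ 2 * Y 2%R = 0 -> [/\ s0 = 0, s1 = 0 & s2 = 0].
Proof.
move/(congr1 (subst A)); rewrite !substD (substM A (s0 ^+ 2)) (substM A (s1 ^+ 2)).
rewrite (substM A (s2 ^+ 2)) !subst_exp !(substVK Au) subst0 => e.
have dsq (f g : P) j : (f ^+ 2 * g)^`M(j) = f ^+ 2 * g^`M(j).
  by rewrite mderivM (mderiv_sqr char_k) mul0r add0r.
have d (j : 'I_3) : subst A s0 ^+ 2 * (0 == j)%:R + subst A s1 ^+ 2 * (1 == j)%:R +
    subst A s2 ^+ 2 * (2%R == j)%:R = 0.
  by have := congr1 (mderiv j) e; rewrite !mderivD !dsq !mderivXi mderiv0.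
have z s : subst A s ^+ 2 = 0 -> s = 0.
  move/eqP; rewrite expf_eq0 /= => /eqP e'.
  by rewrite -(substK Au s) e' subst0.
by split; apply: z; [have := d 0 | have := d 1 | have := d 2%R];
  rewrite /= !mulr0 !mulr1 ?addr0 ?add0r.
Qed.

(** The denominator of the factor of proportionality contains no prime, because
    the vector [c] is primitive. *)
Lemma proportional_primitive (u : 'I_3 -> P) :
  (forall i j, u i * c j = u j * c i) -> exists t, forall i, u i = t * c i.
Proof.
move=> h; have [j cj] := fcomp_neq0.
have [t et] : divides (c j) (u j).
  apply: (divides_cancel (A := c)) => //; first exact: factorial_mpoly.
    by move=> i; exists (u i); rewrite mulrC -h.
  by move=> p pp _; exact: fcomp_prime.
exists t => i; apply: (mulIf cj); rewrite h et; ring.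
Qed.

Lemma dhomog_factor_r d e (p q : P) : q != 0 -> p * q \is d.-homog -> q \is e.-homog ->
  exists2 i : nat, p \is i.-homog & (p != 0 -> d = (i + e)%N).
Proof.
move=> q0 hpq hq; have [->|p0] := eqVneq p 0; first by exists 0%N; rewrite ?rpred0.
have [i [j [hp hq' ->]]] := dhomog_factor (mulf_neq0 p0 q0) hpq.
by exists i => // _; rewrite (dhomog_uniq q0 hq hq').
Qed.

(** Expand [p q] over the field of squares.  That [vf b] annihilates it makes the
    coefficients of the products of two coordinates proportional to the
    components [c] of the vector field, hence a polynomial multiple of them. *)
Lemma Rloc_sq_span : Rloc v `<=` sq_span O ffun_loc.
Proof.
move=> r [d [p [q [hp hq qv er kr]]]].
have q0 := heval_neq0 qv.
have hpq : p * q \is (2 * d).-homog.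
  by apply: (dhomog_cast _ (dhomogM hp hq)); rewrite addnn mul2n.
have [a0 [a1 [a2 [a3 [e h0 h1 h2 h3]]]]] := square_dec char_k (subst_homog A hpq).
pose u i := subst (invmx A) i : P.
have epq : p * q = u a0 ^+ 2 + (u a3 ^+ 2 * (Y 1 * Y 2%R) + u a2 ^+ 2 * (Y 0 * Y 2%R)
    + u a1 ^+ 2 * (Y 0 * Y 1)).
  rewrite -(substK Au (p * q)) e.
  exact: (morph_dec (@subst k (invmx A)) a0 a1 a2 a3 'X_0 'X_1 'X_2).
have kpq : vf b (p * q) = 0.
  by rewrite vfM [q * _]mulrC kr; exact: (addxx charP).
move: kpq; rewrite epq vfD (vf_sqr char_k) add0r vf_lin3 !vf_frame => kpq.
have [z0 z1 z2] := @frame_sq_indep (u a1 * c 1 + u a2 * c 2%R)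
    (u a1 * c 0 + u a3 * c 2%R) (u a2 * c 0 + u a3 * c 1) (eq_trans (dual_expand charP
      (u a1) (u a2) (u a3) (c 0) (c 1) (c 2%R) (Y 0) (Y 1) (Y 2%R)) kpq).
have e0 := add_eq0_2 charP z0; have e1 := add_eq0_2 charP z1.
have e2 := add_eq0_2 charP z2.
pose U (i : 'I_3) := [:: u a3; u a2; u a1]`_i.
have [t et] : exists t, forall i, U i = t * c i.
  apply: proportional_primitive => i j.
  by case: (ord3E i) => ->; case: (ord3E j) => ->; rewrite /U //=.
have [u3 u2 u1] : [/\ u a3 = t * c 0, u a2 = t * c 1 & u a1 = t * c 2%R].
  by split; [exact: (et 0) | exact: (et 1) | exact: (et 2%R)].
have ht : t * Y 0 ^+ m.+1 \is d.-homog.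
  have hU i : U i * Y 0 \is d.-homog.
    have hs a : a * 'X_0 \is d.-homog -> u a * Y 0 \is d.-homog.
      by move=> ha; rewrite /Y -substM; apply: subst_homog.
    by case: (ord3E i) => ->; apply: hs.
  have [j cj] := fcomp_neq0.
  have cY : c j * Y 0 \is m.+1.-homog.
    exact: (dhomog_cast (addn1 m) (dhomogM (fcomp_homog j) (frame_homog A 0))).
  have cY0 : c j * Y 0 != 0 by rewrite mulf_neq0 // frame0_neq0.
  have := hU j; rewrite et -mulrA => /(dhomog_factor_r cY0)/(_ cY)[i hi di].
  have [->|t0] := eqVneq t 0; first by rewrite mul0r rpred0.
  by rewrite (di t0); apply: dhomogM => //; exact: frameX_homog.
have hu0 : u a0 \is d.-homog by apply: subst_homog.
exists (rat (u a0) q), (rat (t * Y 0 ^+ m.+1) q); split.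
- by exists d, (u a0), q; rewrite (hval_rat hu0 hq q0).
- by exists d, (t * Y 0 ^+ m.+1), q; rewrite (hval_rat ht hq q0).
apply: hval_inj.
rewrite (morph_span (@hval k) (rat (u a0) q) (rat (t * Y 0 ^+ m.+1) q) ffun_loc :
    hval _ = hval (rat (u a0) q) ^+ 2 + hval (rat (t * Y 0 ^+ m.+1) q) ^+ 2 * hval ffun_loc).
rewrite (hval_rat hu0 hq q0) (hval_rat ht hq q0) hval_f er.
have epq' : p * q = u a0 ^+ 2 + t ^+ 2 * fnum.
  rewrite epq u3 u2 u1 /fnum; congr (_ + _).
  by rewrite !exprMn !mulrDr !mulrA.
apply: (square_quot (t := hfrac t) (hfrac_neq0 q0) (expf_neq0 m.+1 (hfrac_neq0 frame0_neq0))).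
  by rewrite -hfracM epq'; exact: (morph_span (@hfrac k) (u a0) t fnum).
by rewrite hfracM hfracX.
Qed.

Theorem Rloc_eq : Rloc v = sq_span O ffun_loc.
Proof.
by apply/seteqP; split; [exact: Rloc_sq_span | exact: sq_span_Rloc].
Qed.

End Kernel.

(** * Types of the points of the quotient *)

Lemma frame_of_vector (k : fieldType) n (v : 'rV[k]_n.+1) : v != 0 ->
  exists2 A : 'M[k]_n.+1, A \in unitmx & delta_mx 0 0 *m A = v.
Proof.
move=> v0; have r1 : \rank v = 1%N.
  apply/eqP; rewrite eqn_leq rank_leq_row lt0n mxrank_eq0.
  exact: v0.
exists (col_ebase v 0 0 *: row_ebase v).
  rewrite unitmxZ ?row_ebase_unit // unitfE.
  have := col_ebase_unit v; rewrite unitmxE [col_ebase v]mx11_scalar det_scalar1 unitfE.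
  by rewrite mxE eqxx.
have ev := mulmx_ebase v; rewrite r1 (mx11_scalar (col_ebase v)) mul_scalar_mx in ev.
rewrite -scalemxAl in ev; rewrite -scalemxAr -[RHS]ev; congr (_ *: (_ *m _)).
apply/matrixP => i j; rewrite !mxE (ord1 i).
by case: j => [[|j]] h.
Qed.

Lemma scale_quad (F : fieldType) (g0 g1 g2 x y : F) : g0 != 0 ->
  g0 ^+ 2 * x * y + g1 ^+ 2 * y + g2 ^+ 2 * x =
  g0 ^+ 2 * (x * y + (g1 * g0^-1) ^+ 2 * y + (g2 * g0^-1) ^+ 2 * x).
Proof. by move=> h; field. Qed.

Section LocalTypes.
Variable k : closedFieldType.
Hypothesis char_k : 2%N \in [pchar k].
Local Notation K := (ratfun k).
Local Notation P := {mpoly k[3]}.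
Let charK := pchar_ratfun char_k.
Variables (m : nat) (b : 'I_3 -> P).
Hypothesis bm : forall i, b i \is m.-homog.
Hypothesis bp : forall p, prime_elt p -> exists i, ~ divides p (b i).

(** The value of the vector field [vf b] at [v]; up to proportionality to [v] it
    is its direction at the corresponding point of the plane. *)
Definition dir (v : 'rV[k]_3) : 'rV[k]_3 := \row_i heval (b i) v ^+ 2.

Lemma e0E : e0 k = delta_mx 0 0.
Proof. by apply/rowP => -[[|[|[|//]]] h]; rewrite !mxE. Qed.

Section Frame.
Variable A : 'M[k]_3.
Hypothesis Au : A \in unitmx.
Let v : 'rV[k]_3 := e0 k *m A.
Local Notation c := (fcomp b A).
Local Notation O := (Oloc v).
Local Notation I := (pw O (xc A) (yc A)).
Let lp := frame_local_params Au.

Lemma fcomp_dir (w : 'rV[k]_3) i : heval (c i) w ^+ 2 = (dir w *m invmx A) 0 i.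
Proof.
rewrite /fcomp heval_sum (sqr_sum char_k) mxE; apply: eq_bigr => j _.
by rewrite hevalZ exprMn rtK mxE mulrC.
Qed.

Lemma gam_value i : exists a1 a2, [/\ O a1, O a2 &
  gam m b A i = ratC (heval (c i) v) + (xc A * a1 + yc A * a2)].
Proof.
have Yv : heval (frame A 0 ^+ m) v = 1 by rewrite heval_exp (frame_v Au) expr1n.
have [||||a1 [a2 [h1 h2 e]]] := @Oloc_value k A Au m (c i) (frame A 0 ^+ m) (gam m b A i).
- exact: fcomp_homog.
- exact: frameX_homog.
- by rewrite Yv oner_neq0.
- by rewrite (hval_gam bm Au) hfracX.
by exists a1, a2; split=> //; rewrite e Yv divr1.
Qed.

Lemma gam_O i : O (gam m b A i).
Proof.
have [a1 [a2 [h1 h2 ->]]] := gam_value i.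
apply: (lp_add lp); first exact: (lp_const lp).
by apply: (lp_add lp); apply: (lp_mul lp) => //; [exact: (lp_x lp) | exact: (lp_y lp)].
Qed.

Lemma gam_I1 i : heval (c i) v = 0 -> I 1 (gam m b A i).
Proof.
have [a1 [a2 [h1 h2 ->]]] := gam_value i => ->.
by rewrite rmorph0 add0r; exists a1, a2.
Qed.

Lemma gam_notI1 i : heval (c i) v != 0 -> ~ I 1 (gam m b A i).
Proof.
move=> ci h; have [a1 [a2 [h1 h2 e]]] := gam_value i.
have : I 1 (ratC (heval (c i) v)).
  have -> : ratC (heval (c i) v) = gam m b A i + (xc A * a1 + yc A * a2).
    by rewrite e -addrA (addxx charK) addr0.
  by apply: (pw_add lp) => //; exists a1, a2.
by move/(pw1_const lp)/eqP; rewrite (negPf ci).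
Qed.

Lemma Rloc_regular : heval (c 2%R) v != 0 -> regular2 (Rloc b v).
Proof.
move=> c2; rewrite (Rloc_eq char_k bm bp Au).
have -> : ffun_loc m b A = gam m b A 2%R ^+ 2 * xc A + gam m b A 1 ^+ 2 * yc A
    + gam m b A 0 ^+ 2 * xc A * yc A.
  by rewrite /ffun_loc; ring.
by apply: (regular_span char_k lp); [exact: gam_O | exact: gam_O | exact: gam_O | exact: gam_notI1].
Qed.

Lemma sq_span_unit (O' : set K) (a g : K) : (forall u w, O' u -> O' w -> O' (u * w)) ->
  a != 0 -> O' a -> O' a^-1 -> sq_span O' (a ^+ 2 * g) = sq_span O' g.
Proof.
move=> Om a0 Oa Oi; apply/seteqP; split=> _ [u [w [hu hw ->]]].
  by exists u, (w * a); split; auto; ring.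
exists u, (w * a^-1); split; auto; congr (_ + _).
by rewrite [RHS]mulrA -exprMn -[w * _ * a]mulrA mulVf // mulr1.
Qed.

Lemma Rloc_A1 : heval (c 1) v = 0 -> heval (c 2%R) v = 0 -> heval (c 0) v != 0 ->
  completion_iso (Rloc b v) (rdp_eqn k A1) /\ ~ regular2 (Rloc b v).
Proof.
move=> c1 c2 c0; rewrite (Rloc_eq char_k bm bp Au).
have [g0 Og] := lp_unit lp (gam_O 0) (gam_notI1 c0).
have -> : ffun_loc m b A = gam m b A 0 ^+ 2 * (xc A * yc A
    + (gam m b A 1 * (gam m b A 0)^-1) ^+ 2 * yc A
    + (gam m b A 2%R * (gam m b A 0)^-1) ^+ 2 * xc A).
  exact: (scale_quad (gam m b A 1) (gam m b A 2%R) (xc A) (yc A) g0).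
rewrite (sq_span_unit _ (lp_mul lp) g0 (gam_O 0) Og).
by apply: (A1_span char_k lp); rewrite mulrC; apply: (pw_scale lp) => //; apply: gam_I1.
Qed.

Lemma Rloc_rdp t : rdp_ok t ->
  ffun_loc m b A = \sum_(e <- rdp_exps t) xc A ^+ e.1 * yc A ^+ e.2 ->
  completion_iso (Rloc b v) (rdp_eqn k t) /\ ~ regular2 (Rloc b v).
Proof.
by move=> ht e; rewrite (Rloc_eq char_k bm bp Au) e; apply: (rdp_span char_k lp).
Qed.

End Frame.

(** In a frame whose first vector is [v], one of the components of the vector field
    along the other two vectors does not vanish. *)
Lemma Rloc_transverse v : v != 0 -> (forall l, dir v <> l *: v) -> regular2 (Rloc b v).
Proof.
move=> v0 hd; have [A Au ev] := frame_of_vector v0; rewrite -e0E in ev.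
have [c2|c2] := eqVneq (heval (fcomp b A 2%R) v) 0; last first.
  by rewrite -ev; apply: Rloc_regular => //; rewrite ev.
have [c1|c1] := eqVneq (heval (fcomp b A 1) v) 0; last first.
  have Bu : xrow 1 2%R A \in unitmx by rewrite xrowE unitmx_mul unitmx_perm.
  have eB : e0 k *m xrow 1 2%R A = v.
    rewrite -ev e0E -!rowE; apply/rowP => j; rewrite !mxE.
    by rewrite tpermD.
  rewrite -eB; apply: Rloc_regular => //; rewrite eB.
  apply/eqP => u0; move/eqP: c1; apply.
  have := fcomp_dir (xrow 1 2%R A) v 2%R; rewrite u0 expr0n /= => /esym u2.
  suff e : heval (fcomp b A 1) v ^+ 2 = 0 by move/eqP: e; rewrite expf_eq0 /= => /eqP.
  rewrite fcomp_dir -[RHS]u2.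
  have -> : dir v *m invmx A = xcol 1 2%R (dir v *m invmx (xrow 1 2%R A)).
    by rewrite xcolE -{1}[dir v](mulmxKV Bu) {2}xrowE -!mulmxA mulmxV // mulmx1.
  by rewrite mxE tpermL.
exfalso; apply: (hd (heval (fcomp b A 0) v ^+ 2)).
have e1 : dir v *m invmx A = heval (fcomp b A 0) v ^+ 2 *: e0 k.
  apply/rowP => i; rewrite -fcomp_dir mxE e0E mxE.
  case: (ord3E i) => ->; rewrite ?mulr1 //=.
    by rewrite c1 expr0n mulr0.
  by rewrite c2 expr0n mulr0.
by rewrite -[dir v](mulmxKV Au) e1 -scalemxAl ev.
Qed.

(** In a frame whose first vector is [v], only the first component of the vector
    field is nonzero at [v]; its square is the coefficient of [x y] in [ffun_loc]. *)
Lemma Rloc_tangent v l : v != 0 -> l != 0 -> dir v = l *: v ->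
  completion_iso (Rloc b v) (rdp_eqn k A1) /\ ~ regular2 (Rloc b v).
Proof.
move=> v0 l0 hd; have [A Au ev] := frame_of_vector v0; rewrite -e0E in ev.
have e1 i : heval (fcomp b A i) v ^+ 2 = l * (i == 0)%:R.
  rewrite fcomp_dir hd -ev -scalemxAl mulmxK // mxE e0E mxE.
  by [].
have z i : i != 0 -> heval (fcomp b A i) v = 0.
  move=> i0; have := e1 i; rewrite (negPf i0) mulr0 => /eqP.
  by rewrite expf_eq0 /= => /eqP.
rewrite -ev; apply: Rloc_A1; rewrite ?ev; [exact: Au | exact: z | exact: z | ].
by apply/eqP => u0; have := e1 0; rewrite u0 expr0n /= mulr1 => /esym/eqP; rewrite (negPf l0).
Qed.

End LocalTypes.

(** * Semilinear maps in dimension 3 *)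

Section Semilinear.
Variable k : closedFieldType.
Hypothesis char_k : 2%N \in [pchar k].

(** The entrywise Frobenius twist. *)
Definition tw m n (B : 'M[k]_(m, n)) : 'M[k]_(m, n) := map_mx (pFrobenius_aut char_k) B.

Lemma twM m n p (B : 'M_(m, n)) (C : 'M_(n, p)) : tw (B *m C) = tw B *m tw C.
Proof. exact: map_mxM. Qed.

Lemma twE m n (B : 'M_(m, n)) i j : tw B i j = B i j ^+ 2.
Proof. by rewrite mxE. Qed.

Lemma twZ m n a (B : 'M_(m, n)) : tw (a *: B) = a ^+ 2 *: tw B.
Proof. by apply/matrixP => i j; rewrite !mxE !pFrobenius_autE exprMn. Qed.

Lemma tw_sum m n I (s : seq I) (F : I -> 'M_(m, n)) :
  tw (\sum_(i <- s) F i) = \sum_(i <- s) tw (F i).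
Proof. exact: (raddf_sum (map_mx (pFrobenius_aut char_k))). Qed.

Lemma tw_unit n (B : 'M_n) : (tw B \in unitmx) = (B \in unitmx).
Proof. exact: map_unitmx. Qed.

Lemma tw_rt n (u : 'rV[k]_n) : exists v, u = tw v.
Proof. by exists (map_mx (@rt k) u); apply/matrixP => i j; rewrite twE mxE rtK. Qed.

(** If [phi^(r+1) u] is the combination of the [phi^i u] with coefficients [c i],
    the combination with coefficients [a i] is fixed by [phi] when each [a i] is
    the value of [fixpoly c i] at [a r]. *)
Fixpoint fixpoly (c : nat -> k) i : {poly k} :=
  (if i is i'.+1 then fixpoly c i' ^+ 2 else 0) + (c i)%:P * 'X^2.

Lemma fixpoly_dvd c i : exists B, fixpoly c i = 'X^2 * B.
Proof.
elim: i => [|i [B e]] /=; first by exists (c 0%N)%:P; rewrite add0r mulrC.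
by exists (B ^+ 2 * 'X^2 + (c i.+1)%:P); rewrite e; ring.
Qed.

Lemma fixpoly_eq0 c i : fixpoly c i = 0 -> forall j, (j <= i)%N -> c j = 0.
Proof.
elim: i => [|i IH] /=.
  rewrite add0r => e j; rewrite leqn0 => /eqP ->.
  by have := congr1 (fun p : {poly k} => p`_2) e; rewrite mul_polyC coefZ coefXn coef0 mulr1.
have [B eB] := fixpoly_dvd c i; rewrite eB => e.
have ci : c i.+1 = 0.
  have := congr1 (fun p : {poly k} => p`_2) e; rewrite coefD mul_polyC coefZ coefXn coef0 mulr1.
  by rewrite exprMn -exprM coefXnM add0r.
move=> j; rewrite leq_eqVlt => /orP[/eqP -> //|]; rewrite ltnS; apply: IH.
move: e; rewrite ci mul0r addr0 => /eqP; rewrite expf_eq0 /= => /eqP e0.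
by rewrite eB e0.
Qed.

Lemma fixpoly_root c r : (exists2 j, (j <= r)%N & c j != 0) ->
  exists2 t, t != 0 & (fixpoly c r).[t] = t.
Proof.
move=> [j jr cj]; have [B eB] := fixpoly_dvd c r.
have B0 : B != 0.
  by apply: contraNneq cj => B0; apply/eqP/(@fixpoly_eq0 c r) => //; rewrite eB B0 mulr0.
have hs : size ('X * B - 1) != 1%N.
  have sX : size ('X * B) = (size B).+1 by rewrite mulrC size_mulX.
  by rewrite size_polyDl ?sX ?size_polyN ?size_polyC ?oner_eq0 ?eqSS ?size_poly_eq0 // ltnS size_poly_gt0.
have [t] := closed_rootP _ hs; rewrite /root hornerD hornerN hornerC hornerM hornerX => ht.
exists t.
  by apply: contraTneq ht => ->; rewrite mul0r add0r oppr_eq0 oner_eq0.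
by rewrite eB hornerM hornerXn; move: ht; rewrite subr_eq0 => /eqP e; rewrite expr2 -mulrA e mulr1.
Qed.

(** A case of Lang's theorem.  Take the shortest dependent piece of the orbit of a
    vector; a fixed vector is found among the combinations of its members by
    solving one polynomial equation for the last coefficient. *)
Lemma semilinear_fixed n (M : 'M[k]_n.+1) : M \in unitmx ->
  exists2 u : 'rV_n.+1, u != 0 & tw u *m M = u.
Proof.
move=> Mu; pose phi (u : 'rV[k]_n.+1) := tw u *m M.
pose u0 : 'rV[k]_n.+1 := delta_mx 0 0; pose o i := iter i phi u0.
have phi_inj u : phi u = 0 -> u = 0.
  move=> e; have : tw u = 0 by rewrite -(mulmxK Mu (tw u)) [tw u *m M]e mul0mx.
  move=> /rowP z; apply/rowP => j; have := z j; rewrite twE !mxE => /eqP.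
  by rewrite expf_eq0 /= => /eqP.
have o_neq0 i : o i != 0.
  elim: i => [|i IH] /=; last by apply: contra IH => /eqP/phi_inj/eqP.
  by apply/eqP => /rowP/(_ 0); rewrite !mxE !eqxx; apply/eqP; rewrite oner_eq0.
pose dep r := `[< exists2 d : nat -> k, d r != 0 & \sum_(i < r.+1) d i *: o i = 0 >].
have exdep : exists r, dep r.
  apply: contrapT => nd; have ind r (d : nat -> k) : \sum_(i < r) d i *: o i = 0 ->
      forall i, (i < r)%N -> d i = 0.
    elim: r => // r IH e; have dr : d r = 0.
      by apply/eqP/negPn/negP => dr; apply: nd; exists r; apply/asboolP; exists d.
    move=> i; rewrite ltnS leq_eqVlt => /orP[/eqP -> //|]; apply: IH.
    by move: e; rewrite big_ord_recr /= dr scale0r addr0.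
  pose O : 'M[k]_(n.+2, n.+1) := \matrix_i o i.
  have : row_free O.
    rewrite -kermx_eq0; apply/eqP/row_matrixP => i; rewrite row0.
    have /sub_kermxP := row_sub i (kermx O); set w := row _ _ => ew.
    apply/rowP => j; rewrite [RHS]mxE; pose d (l : nat) := w 0 (inord l).
    have ed : \sum_(l < n.+2) d l *: o l = 0.
      rewrite -[RHS]ew mulmx_sum_row; apply: eq_bigr => l _; rewrite /d inord_val.
      by rewrite rowK.
    by have := ind _ _ ed j (ltn_ord j); rewrite /d inord_val.
  rewrite /row_free => /eqP e; have := rank_leq_col O; rewrite e ltnn.
  by [].
case: (ex_minnP exdep) => r /asboolP[d dr ed] rmin.
have ind (a : nat -> k) : \sum_(i < r) a i *: o i = 0 -> forall i, (i < r)%N -> a i = 0.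
  suff ind' r' : (r' <= r)%N -> \sum_(i < r') a i *: o i = 0 ->
    forall i, (i < r')%N -> a i = 0 by exact: ind'.
  elim: r' => // r' IH rr e.
  have ar : a r' = 0.
    apply/eqP/negPn/negP => ar; have : (r <= r')%N by apply: rmin; apply/asboolP; exists a.
    by rewrite leqNgt rr.
  move=> i; rewrite ltnS leq_eqVlt => /orP[/eqP -> //|]; apply: IH; first exact: ltnW.
  by move: e; rewrite big_ord_recr /= ar scale0r addr0.
pose c i := - d i / d r.
have er : o r = \sum_(i < r) c i *: o i.
  move: ed; rewrite big_ord_recr /= => /eqP; rewrite addrC addr_eq0 => /eqP e.
  rewrite -[LHS]scale1r -(mulVf dr) -scalerA e -sumrN scaler_sumr; apply: eq_bigr => i _.
  by rewrite -scaleNr scalerA /c mulrC.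
case: r dr ed rmin ind c er => [|r] dr ed rmin ind c er.
  by move: (o_neq0 0%N); rewrite er big_ord0 eqxx.
have [t t0 et] : exists2 t, t != 0 & (fixpoly c r).[t] = t.
  apply: fixpoly_root; apply: contrapT => nc; move: (o_neq0 r.+1); rewrite er big1 ?eqxx // => i _.
  have -> : c i = 0 by apply/eqP/negPn/negP => ci; apply: nc; exists i => //; rewrite -ltnS.
  by rewrite scale0r.
pose a i := (fixpoly c i).[t]; exists (\sum_(i < r.+1) a i *: o i).
  by apply/eqP => /ind/(_ r (ltnSn r))/eqP; rewrite /a et (negPf t0).
have phiS i : tw (o i) *m M = o i.+1 by [].
clearbody o.
rewrite tw_sum mulmx_suml.
under eq_bigr do rewrite twZ -scalemxAl phiS.
rewrite big_ord_recr /= /a et er scaler_sumr.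
rewrite big_ord_recl [RHS]big_ord_recl addrCA; congr (_ + _).
  by rewrite scalerA /= add0r hornerM hornerC hornerXn mulrC.
rewrite -big_split /=; apply: eq_bigr => i _.
rewrite scalerA -scalerDl hornerD horner_exp hornerM hornerC hornerXn.
by rewrite [t ^+ 2 * _]mulrC.
Qed.

Lemma semilinear_eigen n (M : 'M[k]_n.+1) :
  exists (u : 'rV_n.+1) (e : k), [/\ u != 0, e = 0 \/ e = 1 & tw u *m M = e *: u].
Proof.
have [Mu|Mn] := boolP (M \in unitmx).
  have [u u0 eu] := semilinear_fixed Mu.
  by exists u, 1; split; [|right|rewrite scale1r].
have /rowV0Pn[w /sub_kermxP wM w0] : kermx M != 0 by rewrite kermx_eq0 row_free_unit.
have [u eu] := tw_rt w; exists u, 0; split; [|by left|by rewrite -eu scale0r].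
by apply: contra_neq w0 => u0; rewrite eu u0 /tw map_mx0.
Qed.

(** Twisted conjugation; [N] represents the semilinear map of [M] in the basis
    formed by the rows of an invertible matrix. *)
Definition twconj n (M N : 'M[k]_n) : Prop :=
  exists2 B : 'M_n, B \in unitmx & tw B *m M = N *m B.

Lemma twconj_trans n (M N Q : 'M[k]_n) : twconj M N -> twconj N Q -> twconj M Q.
Proof.
move=> [B Bu eB] [C Cu eC]; exists (C *m B); first by rewrite unitmx_mul Cu.
by rewrite twM -mulmxA eB !mulmxA eC.
Qed.

Lemma twconj_rank n (M N : 'M[k]_n) : twconj M N -> \rank M = \rank N.
Proof.
move=> [B Bu eB]; have tu : tw B \in unitmx by rewrite tw_unit.
rewrite -(mxrankMfree N (B := B)) ?row_free_unit // -eB.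
by rewrite -(eqmxMfull M (A := tw B)) ?row_full_unit.
Qed.

(** Induction on [n], starting the basis with an eigenvector. *)
Lemma semilinear_trig n (M : 'M[k]_n) : exists N, [/\ twconj M N, is_trig_mx N &
  forall i, N i i = 0 \/ N i i = 1].
Proof.
elim: n M => [|n IH] M.
  exists M; split; [|by apply/is_trig_mxP => -[]|by case].
  by exists 1%:M; rewrite ?unitmx1 // /tw map_mx1 mul1mx mulmx1.
have [u [e [u0 e01 eu]]] := semilinear_eigen M.
have [A Au ea] := frame_of_vector u0.
pose N1 : 'M_(1 + n) := tw A *m M *m invmx A.
have e1 : tw A *m M = N1 *m A by rewrite /N1 mulmxKV.
have rN : delta_mx 0 0 *m N1 = e *: delta_mx 0 0 :> 'rV_(1 + n).
  have td : delta_mx 0 0 = tw (delta_mx 0 0 : 'rV_n.+1).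
    by apply/matrixP => i j; rewrite twE !mxE; case: (_ && _); rewrite ?expr0n ?expr1n.
  rewrite {1}td /N1 !mulmxA -twM ea eu -ea -scalemxAl mulmxK //.
clearbody N1.
have [Q [[B Bu eB] Qt Qd]] := IH (drsubmx N1).
have eul : ulsubmx N1 = e%:M.
  have /rowP/(_ 0) := rN; rewrite -rowE !mxE !eqxx mulr1 => e0.
  apply/matrixP => i j; rewrite !ord1 !mxE mulr1n -e0.
  by congr (N1 _ _); apply/val_inj.
have eur : ursubmx N1 = 0.
  apply/matrixP => i j; rewrite ord1 !mxE.
  have /rowP/(_ (rshift 1 j)) := rN; rewrite -rowE !mxE mulr0 => <-.
  by congr (N1 _ _); apply/val_inj.
pose C : 'M_(1 + n) := block_mx 1%:M 0 0 B.
pose D : 'M_(1 + n) := block_mx e%:M 0 (tw B *m dlsubmx N1) Q.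
exists D; split.
- apply: (@twconj_trans _ M N1); first by exists A.
  exists C; first by rewrite unitmxE (_ : \det C = \det B) -?unitmxE //; exact: (etrans (@det_ublock _ 1 n 1%:M 0 B) (etrans (congr1 (fun x => x * _) (det1 _ _)) (mul1r _))).
  have twC : tw C = block_mx 1%:M 0 0 (tw B) :> 'M_(1 + n).
    apply: etrans (@map_block_mx _ _ _ 1 n 1 n _ _ _ _) _.
    by rewrite !map_mx0 map_mx1.
  have eN : N1 = block_mx e%:M 0 (dlsubmx N1) (drsubmx N1).
    by rewrite -{1}[N1]submxK eul eur.
  rewrite twC {1}eN; apply: etrans (@mulmx_block _ 1 n 1 n 1 n _ _ _ _ _ _ _ _) _.
  apply: esym; apply: etrans (@mulmx_block _ 1 n 1 n 1 n _ _ _ _ _ _ _ _) _.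
  by rewrite !mul1mx !mulmx1 !mul0mx !mulmx0 !addr0 !add0r eB.
- have -> := @is_trig_block_mx k 1 n 1 n e%:M 0 (tw B *m dlsubmx N1) Q erefl.
  by rewrite eqxx Qt /= scalar_mx_is_trig.
- move=> i; rewrite -(@fintype.splitK 1 n i); case: (fintype.split _) => l /=.
    by rewrite /D (@block_mxEul k 1 n 1 n) mxE eqxx mulr1n.
  by rewrite /D (@block_mxEdr k 1 n 1 n).
Qed.

Definition m3 (a b c d e f g h i : k) : 'M[k]_3 :=
  \matrix_(r, s) (nth [::] [:: [:: a; b; c]; [:: d; e; f]; [:: g; h; i]] r)`_s.

Lemma m3M a b c d e f g h i a' b' c' d' e' f' g' h' i' :
  m3 a b c d e f g h i *m m3 a' b' c' d' e' f' g' h' i' =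
  m3 (a * a' + b * d' + c * g') (a * b' + b * e' + c * h') (a * c' + b * f' + c * i')
     (d * a' + e * d' + f * g') (d * b' + e * e' + f * h') (d * c' + e * f' + f * i')
     (g * a' + h * d' + i * g') (g * b' + h * e' + i * h') (g * c' + h * f' + i * i').
Proof.
apply/matrixP => r s; rewrite !mxE !big_ord_recl big_ord0 addr0 addrA !mxE.
by move: r s => [[|[|[|//]]] ?] [[|[|[|//]]] ?].
Qed.

Lemma m3_1 : 1%:M = m3 1 0 0 0 1 0 0 0 1.
Proof. by apply/matrixP => -[[|[|[|//]]] ?] [[|[|[|//]]] ?]; rewrite !mxE. Qed.

Lemma m3_tw a b c d e f g h i : tw (m3 a b c d e f g h i) =
  m3 (a ^+ 2) (b ^+ 2) (c ^+ 2) (d ^+ 2) (e ^+ 2) (f ^+ 2) (g ^+ 2) (h ^+ 2) (i ^+ 2).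
Proof.
apply/matrixP => r s; rewrite twE !mxE.
by move: r s => [[|[|[|//]]] ?] [[|[|[|//]]] ?].
Qed.

Lemma m3_trig (N : 'M[k]_3) : is_trig_mx N ->
  N = m3 (N 0 0) 0 0 (N 1 0) (N 1 1) 0 (N 2%R 0) (N 2%R 1) (N 2%R 2%R).
Proof.
move/is_trig_mxP => t; apply/matrixP => i j; rewrite [RHS]mxE.
case: (ord3E i) => ->; case: (ord3E j) => -> //=; exact: t.
Qed.

(** Solvable by an Artin-Schreier equation, a square root or a linear equation. *)
Lemma artin_schreier (e e' a : k) : (e = 0 \/ e = 1) -> (e' = 0 \/ e' = 1) ->
  exists t a', a + t ^+ 2 * e = a' + e' * t /\ ((e = 0 /\ e' = 0) \/ a' = 0).
Proof.
case=> -> [] ->; first by exists 0, a; split; [rewrite !mulr0 | left].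
- by exists a, 0; split; [rewrite mulr0 addr0 add0r mul1r | right].
- by exists (rt (- a)), 0; split; [rewrite rtK mulr1 mul0r addr0 subrr | right].
have := @solve_monicpoly k 2 (fun i => if i == 0%N then - a else 1) isT.
case=> t; rewrite big_ord_recl big_ord1 /= => et; exists t, 0; split; last by right.
by rewrite et; ring.
Qed.

Lemma twconj_m3 B C (N N' : 'M[k]_3) : B *m C = 1%:M -> tw B *m N = N' *m B -> twconj N N'.
Proof. by move=> /mulmx1_unit[Bu _] e; exists B. Qed.

(** Adding multiples of earlier basis vectors to later ones changes the entries
    below the diagonal by Artin-Schreier expressions. *)
Lemma twconj_elim e0 e1 e2 a b c a' b' c' t s u :
  a + t ^+ 2 * e0 = a' + e1 * t -> c + s ^+ 2 * e1 = c' + e2 * s ->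
  b + s ^+ 2 * a + u ^+ 2 * e0 = b' + c' * t + e2 * u ->
  twconj (m3 e0 0 0 a e1 0 b c e2) (m3 e0 0 0 a' e1 0 b' c' e2).
Proof.
move=> ha hc hb; apply: (@twconj_m3 (m3 1 0 0 t 1 0 u s 1)
  (m3 1 0 0 (- t) 1 0 (s * t - u) (- s) 1)).
  by rewrite m3M m3_1; congr m3; ring.
rewrite m3_tw !m3M; congr m3; rewrite ?(mul0r, mulr0, addr0, add0r, mul1r, mulr1, expr1n, expr0n) //=.
- by rewrite addrC.
- by rewrite -hb; ring.
- by rewrite addrC.
Qed.

Lemma rank_outer (u : 'cV[k]_3) (v : 'rV_3) : (\rank (u *m v) <= 1)%N.
Proof. exact: leq_trans (mxrankM_maxr _ _) (rank_leq_row _). Qed.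

Lemma m3_rank1 a b c x y z : (\rank (m3 (a * x) (a * y) (a * z) (b * x) (b * y) (b * z)
  (c * x) (c * y) (c * z)) <= 1)%N.
Proof.
rewrite (_ : m3 _ _ _ _ _ _ _ _ _ = (\col_i [:: a; b; c]`_i) *m (\row_i [:: x; y; z]`_i)).
  exact: rank_outer.
apply/matrixP => r s; rewrite !mxE big_ord1 !mxE.
by move: r s => [[|[|[|//]]] ?] [[|[|[|//]]] ?].
Qed.

(** A semilinear map is the sum of a part with a basis of fixed vectors and of a
    nilpotent part; for rank at least 2, the latter is one Jordan block, of size
    0, 1, 2 or 3. *)
Inductive normal_form : 'M[k]_3 -> Prop :=
| NF7A1 : normal_form (m3 1 0 0 0 1 0 0 0 1)
| NFD4 : normal_form (m3 0 0 0 0 1 0 0 0 1)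
| NFD6 : normal_form (m3 0 0 0 0 1 0 1 0 0)
| NFE7 : normal_form (m3 0 0 0 0 0 1 1 0 0).

Local Ltac m3_calc := rewrite ?m3_tw ?m3M ?m3_1; congr m3;
  rewrite ?(mul0r, mulr0, addr0, add0r, mul1r, mulr1, expr1n, expr0n); try done.

(** Starting from a triangular form, clear the entries that can be cleared; those
    between vectors with eigenvalue 0 remain, are nonzero by the rank condition,
    and can be scaled to 1. *)
Lemma semilinear_normal_form (M : 'M[k]_3) : (1 < \rank M)%N ->
  exists2 N, normal_form N & twconj M N.
Proof.
have [N0 [cN0 /m3_trig eN0 Nd]] := semilinear_trig M.
rewrite (twconj_rank cN0) => rN.
suff [N nN cN] : exists2 N, normal_form N & twconj N0 N.
  by exists N => //; apply: twconj_trans cN0 cN.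
move: (Nd 0) (Nd 1) (Nd 2%R) rN eN0 => {cN0 Nd}.
move: (N0 0 0) (N0 1 1) (N0 2%R 2%R) (N0 1 0) (N0 2%R 0) (N0 2%R 1) => e0 e1 e2 a b c.
move=> h0 h1 h2 rN eN0; move: h0 h1 h2 rN; rewrite {}eN0 {N0 M}.
have [[-> ->]|nz] := pselect (e0 = 0 /\ e1 = 0).
  move=> _ _ [] ->.
    have [->|a0] := eqVneq a 0.
      by have := m3_rank1 0 0 1 b c 0; rewrite !mul0r !mul1r => h; rewrite ltnNge h.
    have [->|c0] := eqVneq c 0.
      by have := m3_rank1 0 a b 1 0 0; rewrite !mul0r !mulr1 !mulr0 => h; rewrite ltnNge h.
    move=> _; exists (m3 0 0 0 0 0 1 1 0 0); first exact: NFE7.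
    have hs : (rt (- (b / a))) ^+ 2 * a = - b by rewrite rtK mulNr mulfVK.
    apply: (@twconj_trans _ _ (m3 0 0 0 a 0 0 0 c 0)).
      by apply: (@twconj_elim _ _ _ _ _ _ _ _ _ 0 (rt (- (b / a))) 0); rewrite ?hs; ring.
    apply: (@twconj_m3 (m3 (c ^+ 2 * a) 0 0 0 0 1 0 c 0) (m3 (c ^+ 2 * a)^-1 0 0 0 0 c^-1 0 1 0));
      m3_calc.
      by rewrite mulfV // mulf_neq0 ?expf_neq0.
    by rewrite mulfV.
  have [->|a0] := eqVneq a 0.
    by have := m3_rank1 0 0 1 b c 1; rewrite !mul0r !mul1r => h; rewrite ltnNge h.
  move=> _; exists (m3 0 0 0 0 1 0 1 0 0); first exact: NFD6.
  apply: (@twconj_trans _ _ (m3 0 0 0 a 0 0 0 0 1)).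
    by apply: (@twconj_elim _ _ _ _ _ _ _ _ _ 0 c (b + c ^+ 2 * a)); ring.
  apply: (@twconj_m3 (m3 a 0 0 0 0 1 0 1 0) (m3 a^-1 0 0 0 0 1 0 1 0)); m3_calc.
  by rewrite mulfV.
move=> h0 h1 h2.
have [t [a' [ha za]]] := artin_schreier a h0 h1; case: za => // za.
have [s [c' [hc zc]]] := artin_schreier c h1 h2.
have [u [b' [hb zb]]] := artin_schreier (b + s ^+ 2 * a - c' * t) h0 h2.
have cj : twconj (m3 e0 0 0 a e1 0 b c e2) (m3 e0 0 0 0 e1 0 b' c' e2).
  apply: (@twconj_elim _ _ _ _ _ _ _ _ _ t s u); rewrite ?hc ?ha ?za //.
  by rewrite [b' + _ + _]addrAC -hb; ring.
rewrite (twconj_rank cj) => rN.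
suff [N nN cN] : exists2 N, normal_form N & twconj (m3 e0 0 0 0 e1 0 b' c' e2) N.
  by exists N => //; apply: twconj_trans cj cN.
move: rN {cj ha hc hb za}; case: h0 h1 nz zb zc => -> [] -> nz.
- by case: nz.
- case: h2 => -> zb [[/eqP]|->]; rewrite ?oner_eq0 // => rN.
    exists (m3 0 0 0 0 1 0 1 0 0); first exact: NFD6.
    have b0 : b' != 0.
      apply: contraTneq rN => ->; rewrite -leqNgt.
      by have := m3_rank1 0 1 0 0 1 0; rewrite !mul0r !mulr1 !mulr0.
    apply: (@twconj_m3 (m3 b' 0 0 0 1 0 0 0 1) (m3 b'^-1 0 0 0 1 0 0 0 1)); m3_calc.
    by rewrite mulfV.
  case: zb => [[_ /eqP]|->]; rewrite ?oner_eq0 // .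
  exists (m3 0 0 0 0 1 0 0 0 1); first exact: NFD4.
  by apply: (@twconj_m3 (m3 1 0 0 0 1 0 0 0 1) (m3 1 0 0 0 1 0 0 0 1)); m3_calc.
- move=> [[/eqP]|->]; rewrite ?oner_eq0 //; case: h2 => -> zc rN.
    exists (m3 0 0 0 0 1 0 1 0 0); first exact: NFD6.
    have c0 : c' != 0.
      apply: contraTneq rN => ->; rewrite -leqNgt.
      by have := m3_rank1 1 0 0 1 0 0; rewrite !mul0r !mulr1 !mulr0.
    apply: (@twconj_m3 (m3 0 c' 0 1 0 0 0 0 1) (m3 0 1 0 c'^-1 0 0 0 0 1)); m3_calc.
    by rewrite mulfV.
  case: zc => [[_ /eqP]|->]; rewrite ?oner_eq0 // .
  exists (m3 0 0 0 0 1 0 0 0 1); first exact: NFD4.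
  by apply: (@twconj_m3 (m3 0 1 0 1 0 0 0 0 1) (m3 0 1 0 1 0 0 0 0 1)); m3_calc.
- move=> [[/eqP]|->]; rewrite ?oner_eq0 // => -[[/eqP]|->]; rewrite ?oner_eq0 //.
  case: h2 => -> rN.
    exists (m3 0 0 0 0 1 0 0 0 1); first exact: NFD4.
    by apply: (@twconj_m3 (m3 0 0 1 0 1 0 1 0 0) (m3 0 0 1 0 1 0 1 0 0)); m3_calc.
  exists (m3 1 0 0 0 1 0 0 0 1); first exact: NF7A1.
  by apply: (@twconj_m3 (m3 1 0 0 0 1 0 0 0 1) (m3 1 0 0 0 1 0 0 0 1)); m3_calc.
Qed.

End Semilinear.

(** * The configurations of singular points *)

Lemma Rloc_scale (k : closedFieldType) (b : 'I_3 -> {mpoly k[3]}) c v : c != 0 ->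
  Rloc b (c *: v) = Rloc b v.
Proof.
move=> c0; apply/seteqP; split=> f [d [p [q [hp hq qv e D]]]]; exists d, p, q; split=> //.
  by move: qv; rewrite (heval_scale _ _ hq) mulf_eq0 negb_or => /andP[].
by rewrite (heval_scale _ _ hq) mulf_neq0 ?expf_neq0.
Qed.

Lemma D4_equation (F : comNzRingType) (x y : F) : 0 ^+ 2 * x * y + x ^+ 2 * y + y ^+ 2 * x =
  \sum_(e <- rdp_exps (D0 2%N)) x ^+ e.1 * y ^+ e.2.
Proof. by rewrite !big_cons big_nil /=; ring. Qed.

Lemma D6_equation (F : comNzRingType) (x y : F) : y ^+ 2 * x * y + x ^+ 2 * y + 0 ^+ 2 * x =
  \sum_(e <- rdp_exps (D0 3%N)) x ^+ e.1 * y ^+ e.2.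
Proof. by rewrite !big_cons big_nil /=; ring. Qed.

Lemma E7_equation (F : comNzRingType) (x y : F) : y ^+ 2 * x * y + 0 ^+ 2 * y + x ^+ 2 * x =
  \sum_(e <- rdp_exps E70) x ^+ e.1 * y ^+ e.2.
Proof. by rewrite !big_cons big_nil /=; ring. Qed.

Section LinearForms.
Variable k : closedFieldType.
Hypothesis char_k : 2%N \in [pchar k].
Local Notation P := {mpoly k[3]}.

Lemma linear_form (p : P) : p \is 1.-homog -> p = \sum_j p@_(U_(j)) *: 'X_j.
Proof.
move=> hp; apply/mpolyP => m; rewrite raddf_sum /=.
under eq_bigr do rewrite mcoeffZ mcoeffX.
have [/mdeg1P[i /eqP ->]|m1] := boolP (mdeg m == 1%N).
  rewrite (bigD1 i) //= eqxx mulr1 big1 ?addr0 // => j ji.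
  by rewrite eq_mnm1 (negPf ji) mulr0.
rewrite (dhomog_nemf_coeff hp m1) big1 // => j _.
by case: eqP => [e|_]; rewrite ?mulr0 //; rewrite -e mdeg1 eqxx in m1.
Qed.

Lemma heval_linear (p : P) v : p \is 1.-homog -> heval p v = \sum_j v 0 j * p@_(U_(j)).
Proof.
move=> hp; rewrite {1}(linear_form hp) heval_sum.
by apply: eq_bigr => j _; rewrite hevalZ hevalXi mulrC.
Qed.

Lemma linear_ext (p q : P) : p \is 1.-homog -> q \is 1.-homog ->
  (forall v, heval p v = heval q v) -> p = q.
Proof.
move=> hp hq e; rewrite (linear_form hp) (linear_form hq); apply: eq_bigr => j _.
have := e (delta_mx 0 j); rewrite !heval_linear //.
rewrite (bigD1 j) //= [in RHS](bigD1 j) //= !big1; first by rewrite !mxE !eqxx !mul1r !addr0 => ->.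
all: by move=> i ij; rewrite !mxE eqxx (negPf ij) mul0r.
Qed.

Variable b : 'I_3 -> P.
Hypothesis bm : forall i, b i \is 1.-homog.
Hypothesis bp : forall p, prime_elt p -> exists i, ~ divides p (b i).

(** For linear forms, [dir b] is Frobenius-semilinear; this is its matrix. *)
Definition dirmx : 'M[k]_3 := \matrix_(j, i) (b i)@_(U_(j)) ^+ 2.

Lemma dirE v : dir b v = tw char_k v *m dirmx.
Proof.
apply/rowP => i; rewrite !mxE (heval_linear _ (bm i)) (sqr_sum char_k).
by apply: eq_bigr => j _; rewrite twE mxE exprMn.
Qed.

(** Otherwise the three forms would be multiples of one linear form. *)
Lemma dirmx_rank : (1 < \rank dirmx)%N.
Proof.
rewrite ltnNge; apply/negP => r1.
have outer r (C : 'M[k]_(3, r)) (D : 'M[k]_(r, 3)) : (r <= 1)%N ->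
    exists u v : 'I_3 -> k, forall j i, (C *m D) j i = u j * v i.
  case: r C D => [|[|//]] C D _.
    by exists (fun=> 0), (fun=> 0) => j i; rewrite mxE big_ord0 mul0r.
  by exists (C^~ 0), (D 0) => j i; rewrite mxE big_ord1.
have [u [v e]] := outer _ (col_base dirmx) (row_base dirmx) r1.
rewrite mulmx_base in e; pose l : P := \sum_j rt (u j) *: 'X_j.
have bl i : b i = rt (v i) *: l.
  rewrite (linear_form (bm i)) scaler_sumr; apply: eq_bigr => j _; rewrite scalerA.
  congr (_ *: _); apply: (sqr_inj2 char_k).
  by have := e j i; rewrite mxE exprMn !rtK mulrC.
have dl p : divides p l -> forall i, divides p (b i).
  by move=> pl i; rewrite bl -mul_mpolyC; apply: dividesMl.
have hl : l \is 1.-homog by apply: rpred_sum => j _; apply: rpredZ; apply: dhomog_Xi.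
have [l0|l0] := eqVneq l 0.
  have [p pp] := prime_exists k; have [i] := bp pp; apply; apply: dl.
  by rewrite l0; exact: divides0.
have [|p pp pl] := divides_prime_factor (@factorial_mpoly k 3) l0.
  by apply/negP => /mpoly_unit_const/(_ hl).
by have [i] := bp pp; apply; apply: dl.
Qed.

Section NormalForm.
Variables A N : 'M[k]_3.
Hypothesis Au : A \in unitmx.
Hypothesis AN : tw char_k A *m dirmx = N *m A.

Lemma dir_frame u : dir b (u *m A) = tw char_k u *m N *m A.
Proof. by rewrite dirE twM -!mulmxA AN. Qed.

(** Hence the columns of a normal form are the squared components of the vector
    field in the corresponding frame. *)
Lemma fcomp_frame i : fcomp b A i = \sum_j rt (N j i) *: frame A j.
Proof.
apply: linear_ext; first exact: fcomp_homog.
  by apply: rpred_sum => j _; apply: rpredZ; exact: frame_homog.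
move=> w; apply: (sqr_inj2 char_k); rewrite (fcomp_dir char_k).
rewrite -[in LHS](mulmxKV Au w) dir_frame mulmxK // mxE heval_sum (sqr_sum char_k).
apply: eq_bigr => j _; rewrite hevalZ exprMn rtK twE mulrC.
by rewrite /frame heval_subst hevalXi.
Qed.

Lemma fixed_A1 u : u != 0 -> tw char_k u *m N = u ->
  completion_iso (Rloc b (u *m A)) (rdp_eqn k A1) /\ ~ regular2 (Rloc b (u *m A)).
Proof.
move=> u0 eu; apply: (@Rloc_tangent _ char_k 1 b bm bp _ 1); rewrite ?oner_neq0 //.
  by apply: contraNneq u0 => e; rewrite -(mulmxK Au u) e mul0mx.
by rewrite dir_frame eu scale1r.
Qed.

Lemma gam_zero i : fcomp b A i = 0 -> gam 1 b A i = 0.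
Proof.
by move=> e; apply: hval_inj; rewrite (hval_gam bm Au) e rmorph0 mul0r rmorph0.
Qed.

Lemma gam_xc i : fcomp b A i = frame A 1 -> gam 1 b A i = xc A.
Proof. by rewrite /gam => ->. Qed.

Lemma gam_yc i : fcomp b A i = frame A 2%R -> gam 1 b A i = yc A.
Proof. by rewrite /gam => ->. Qed.

End NormalForm.

Lemma rt1 : rt 1 = 1 :> k.
Proof. by apply: (sqr_inj2 char_k); rewrite rtK expr1n. Qed.

Variable L : subsheafT k.
Hypothesis hL : forall v, v != 0 -> OY_stalk L v = Rloc b v.

(** By [Rloc_transverse] a point can only be singular if its vector is mapped to a
    multiple of itself. *)
Lemma config_of A N (s : set ('rV[k]_3 * rdp)) : A \in unitmx ->
  tw char_k A *m dirmx = N *m A ->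
  (forall wt, s wt -> wt.1 != 0 /\ completion_iso (Rloc b (wt.1 *m A)) (rdp_eqn k wt.2)
     /\ ~ regular2 (Rloc b (wt.1 *m A))) ->
  (forall u l, u != 0 -> tw char_k u *m N = l *: u ->
     exists2 wt, s wt & same_point u wt.1) ->
  sing_config L s.
Proof.
move=> Au AN hs hu.
have uA u : u != 0 -> u *m A != 0.
  by move=> u0; apply: contraNneq u0 => e; rewrite -(mulmxK Au u) e mul0mx.
exists A => //; split=> [v v0|wt /hs[w0 [h _]]]; last by rewrite /sing_of_type hL // uA.
rewrite /singular hL //; split=> [ns|[wt /hs[w0 [_ h]] [c c0 ->]]]; last by rewrite Rloc_scale.
have [l el] : exists l, dir b v = l *: v.
  apply: contrapT => nl; apply: ns; apply: (Rloc_transverse char_k bm bp) => // l el.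
  by apply: nl; exists l.
have u0 : v *m invmx A != 0.
  by apply: contraNneq v0 => e; rewrite -(mulmxKV Au v) e mul0mx.
have [|wt swt [c c0 ec]] := hu (v *m invmx A) l u0.
  by rewrite -[LHS](mulmxK Au) -(dir_frame AN) mulmxKV // el scalemxAl.
by exists wt => //; exists c => //; rewrite scalemxAl -ec mulmxKV.
Qed.


Lemma m3_row (u : 'rV[k]_3) (p q r p' q' r' p'' q'' r'' : k) :
  u *m m3 p q r p' q' r' p'' q'' r'' =
  pt (u 0 0 * p + u 0 1 * p' + u 0 2%R * p'') (u 0 0 * q + u 0 1 * q' + u 0 2%R * q'')
     (u 0 0 * r + u 0 1 * r' + u 0 2%R * r'').
Proof.
have e1 : lift ord0 ord0 = 1 :> 'I_3 by apply/val_inj.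
have e2 : lift ord0 (lift ord0 ord0) = 2%R :> 'I_3 by apply/val_inj.
apply/rowP => i; rewrite !mxE !big_ord_recl big_ord0 addr0 addrA !mxE e1 e2.
by move: i => [[|[|[|//]]] ?].
Qed.

Lemma pt_eta (u : 'rV[k]_3) : u = pt (u 0 0) (u 0 1) (u 0 2%R).
Proof. by apply/rowP => i; rewrite !mxE; case: (ord3E i) => ->. Qed.

Lemma pt_scale (c x y z : k) : c *: pt x y z = pt (c * x) (c * y) (c * z) :> 'rV[k]_3.
Proof. by apply/rowP => i; rewrite !mxE; case: (ord3E i) => ->. Qed.

Lemma pt_inj (x y z x' y' z' : k) : pt x y z = pt x' y' z' :> 'rV[k]_3 -> [/\ x = x', y = y' & z = z'].
Proof. by move/rowP => e; move: (e 0) (e 1) (e 2%R); rewrite !mxE. Qed.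

Lemma pt_tw (x y z : k) : tw char_k (pt x y z) = pt (x ^+ 2) (y ^+ 2) (z ^+ 2).
Proof. by apply/rowP => i; rewrite twE !mxE; case: (ord3E i) => ->. Qed.

Lemma pt_m3 (x y z p q r p' q' r' p'' q'' r'' : k) :
  pt x y z *m m3 p q r p' q' r' p'' q'' r'' =
  pt (x * p + y * p' + z * p'') (x * q + y * q' + z * q'') (x * r + y * r' + z * r'').
Proof. by rewrite m3_row !mxE. Qed.

Lemma pt_neq0 (x y z : k) : (x != 0) || (y != 0) || (z != 0) -> pt x y z != 0 :> 'rV[k]_3.
Proof.
apply: contraTneq => /rowP e; move: (e 0) (e 1) (e 2%R); rewrite !mxE /= => -> -> ->.
by rewrite eqxx.
Qed.

Lemma sqr_scale (l x : k) : x ^+ 2 = l * x -> x = 0 \/ x = l.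
Proof.
have [->|x0] := eqVneq x 0; [by left | right].
by apply: (mulIf x0); rewrite -expr2.
Qed.

Local Ltac calc := rewrite ?(mul0r, mulr0, mul1r, mulr1, add0r, addr0, expr1n, expr0n) /=.

Local Ltac listed l wt := exists wt; [by rewrite /=; tauto |
  exists l; rewrite // pt_scale; calc; congr pt].

Local Ltac fcalc fc := rewrite fc !big_ord_recl big_ord0 !mxE /= ?(rt0 char_k) ?rt1
  ?scale0r ?scale1r ?addr0 ?add0r //; congr frame; exact/val_inj.

Local Ltac fixpt h := apply: h; rewrite ?expr1n ?expr0n ?oner_neq0 //; apply: pt_neq0;
  rewrite oner_neq0 ?orbT.

(** In the coordinates [u] of the frame one has to solve [phi u = l u].  For [l]
    nonzero, rescaling gives the fixed vectors, with coordinates 0 and 1 and all of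
    type A1.  The kernel of [phi] is spanned by the first vector, if not zero, and
    there the function [ffun_loc] is exactly the equation of the singularity. *)
Lemma normal_form_config M : normal_form M -> twconj char_k dirmx M ->
  [\/ config_7A1 L, config_D4_3A1 L, config_D6_A1 L | config_E7 L].
Proof.
have one : (1 : k) != 0 by rewrite oner_neq0.
case=> -[A Au AN]; have fc := fcomp_frame Au AN; have fx := fixed_A1 Au AN.
- constructor 1; exists 1, 1, 1, 1, 1, 1, 1, 1, 1; split; first by rewrite /= one.
  apply: (config_of Au AN).
    have h x y z : pt x y z != 0 -> x ^+ 2 = x -> y ^+ 2 = y -> z ^+ 2 = z ->
      pt x y z != 0 /\ completion_iso (Rloc b (pt x y z *m A)) (rdp_eqn k A1) /\
      ~ regular2 (Rloc b (pt x y z *m A)).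
      move=> n ex ey ez; split=> //; apply: fx => //.
      by rewrite pt_tw pt_m3 ex ey ez; calc.
    by move=> wt [[[[[[->|->]|->]|->]|->]|->]|->] /=; apply: h; rewrite ?expr1n ?expr0n //;
      apply: pt_neq0; rewrite one ?orbT.
  move=> u l; rewrite [u]pt_eta; move: (u 0 0) (u 0 1) (u 0 2%R) => x y z n.
  rewrite pt_tw pt_m3 pt_scale; calc.
  case/pt_inj => /sqr_scale hx /sqr_scale hy /sqr_scale hz.
  have l0 : l != 0.
    by apply: contraNneq n => l0; rewrite l0 in hx hy hz; case: hx hy hz => -> [] -> [] ->;
      apply/eqP/rowP => i; rewrite !mxE; case: (ord3E i) => ->.
  case: hx hy hz => ex [] ey [] ez.
  + by case/eqP: n; rewrite ex ey ez;
      apply/rowP => i; rewrite !mxE; case: (ord3E i) => ->.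
  + by listed l (pt 0 0 1 : 'rV[k]_3, A1).
  + by listed l (pt 0 1 0 : 'rV[k]_3, A1).
  + by listed l (pt 0 1 1 : 'rV[k]_3, A1).
  + by listed l (pt 1 0 0 : 'rV[k]_3, A1).
  + by listed l (pt 1 0 1 : 'rV[k]_3, A1).
  + by listed l (pt 1 1 0 : 'rV[k]_3, A1).
  + by listed l (pt 1 1 1 : 'rV[k]_3, A1).
- constructor 2; exists 1, 1; split=> //; apply: (config_of Au AN).
    have h x y z : pt x y z != 0 -> x ^+ 2 = 0 -> y ^+ 2 = y -> z ^+ 2 = z -> x = 0 ->
      pt x y z != 0 /\ completion_iso (Rloc b (pt x y z *m A)) (rdp_eqn k A1) /\
      ~ regular2 (Rloc b (pt x y z *m A)).
      move=> n ex ey ez x0; split=> //; apply: fx => //.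
      by rewrite pt_tw pt_m3 ex ey ez x0; calc.
    move=> wt [[[->|->]|->]|->] /=; [ | by fixpt h | by fixpt h | by fixpt h].
    split; first by apply: pt_neq0; rewrite one.
    have g0 : gam 1 b A 0 = 0 by apply: (gam_zero Au); fcalc fc.
    have g1 : gam 1 b A 1 = xc A by apply: gam_xc; fcalc fc.
    have g2 : gam 1 b A 2%R = yc A by apply: gam_yc; fcalc fc.
    apply: (Rloc_rdp char_k bm bp Au (t := D0 2%N)) => //.
    rewrite /ffun_loc g0 g1 g2; exact: (D4_equation (xc A) (yc A)).
  move=> u l; rewrite [u]pt_eta; move: (u 0 0) (u 0 1) (u 0 2%R) => x y z n.
  rewrite pt_tw pt_m3 pt_scale; calc.
  case/pt_inj => hx /sqr_scale hy /sqr_scale hz.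
  have [l0|l0] := eqVneq l 0.
    rewrite l0 in hy hz.
    have ey : y = 0 by case: hy.
    have ez : z = 0 by case: hz.
    have x0 : x != 0 by apply: contraNneq n => x0; rewrite ey ez x0 (pt_eta 0) !mxE.
    by listed x (pt 1 0 0 : 'rV[k]_3, D0 2%N).
  have ex : x = 0 by apply/eqP; move/esym/eqP: hx; rewrite mulf_eq0 (negPf l0).
  case: hy hz => ey [] ez.
  + by case/eqP: n; rewrite ex ey ez (pt_eta 0) !mxE.
  + by listed l (pt 0 0 1 : 'rV[k]_3, A1).
  + by listed l (pt 0 1 0 : 'rV[k]_3, A1).
  + by listed l (pt 0 1 1 : 'rV[k]_3, A1).
- constructor 3; apply: (config_of Au AN).
    have h x y z : pt x y z != 0 -> x ^+ 2 = 0 -> y ^+ 2 = y -> z ^+ 2 = 0 -> x = 0 -> z = 0 ->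
      pt x y z != 0 /\ completion_iso (Rloc b (pt x y z *m A)) (rdp_eqn k A1) /\
      ~ regular2 (Rloc b (pt x y z *m A)).
      move=> n ex ey ez x0 z0; split=> //; apply: fx => //.
      by rewrite pt_tw pt_m3 ex ey ez x0 z0; calc.
    move=> wt [->|->] /=; [ | by fixpt h].
    split; first by apply: pt_neq0; rewrite one.
    have g0 : gam 1 b A 0 = yc A by apply: gam_yc; fcalc fc.
    have g1 : gam 1 b A 1 = xc A by apply: gam_xc; fcalc fc.
    have g2 : gam 1 b A 2%R = 0 by apply: (gam_zero Au); fcalc fc.
    apply: (Rloc_rdp char_k bm bp Au (t := D0 3%N)) => //.
    rewrite /ffun_loc g0 g1 g2; exact: (D6_equation (xc A) (yc A)).
  move=> u l; rewrite [u]pt_eta; move: (u 0 0) (u 0 1) (u 0 2%R) => x y z n.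
  rewrite pt_tw pt_m3 pt_scale; calc.
  case/pt_inj => hx /sqr_scale hy hz.
  have [l0|l0] := eqVneq l 0.
    rewrite l0 in hx hy; rewrite mul0r in hx.
    have ey : y = 0 by case: hy.
    have ez : z = 0 by move/eqP: hx; rewrite expf_eq0 => /eqP.
    have x0 : x != 0 by apply: contraNneq n => x0; rewrite ey ez x0 (pt_eta 0) !mxE.
    by listed x (pt 1 0 0 : 'rV[k]_3, D0 3%N).
  have ez : z = 0 by apply/eqP; move/esym/eqP: hz; rewrite mulf_eq0 (negPf l0).
  have ex : x = 0.
    by apply/eqP; move/esym/eqP: hx; rewrite ez expr0n /= mulf_eq0 (negPf l0).
  case: hy => ey; first by case/eqP: n; rewrite ex ey ez (pt_eta 0) !mxE.
  by listed l (pt 0 1 0 : 'rV[k]_3, A1).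
- constructor 4; apply: (config_of Au AN).
    move=> wt -> /=; split; first by apply: pt_neq0; rewrite one.
    have g0 : gam 1 b A 0 = yc A by apply: gam_yc; fcalc fc.
    have g1 : gam 1 b A 1 = 0 by apply: (gam_zero Au); fcalc fc.
    have g2 : gam 1 b A 2%R = xc A by apply: gam_xc; fcalc fc.
    apply: (Rloc_rdp char_k bm bp Au (t := E70)) => //.
    rewrite /ffun_loc g0 g1 g2; exact: (E7_equation (xc A) (yc A)).
  move=> u l; rewrite [u]pt_eta; move: (u 0 0) (u 0 1) (u 0 2%R) => x y z n.
  rewrite pt_tw pt_m3 pt_scale; calc.
  case/pt_inj => hx hy hz.
  have [l0|l0] := eqVneq l 0.
    rewrite l0 mul0r in hx; rewrite l0 mul0r in hz.
    have ey : y = 0 by move/eqP: hz; rewrite expf_eq0 => /eqP.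
    have ez : z = 0 by move/eqP: hx; rewrite expf_eq0 => /eqP.
    have x0 : x != 0 by apply: contraNneq n => x0; rewrite ey ez x0 (pt_eta 0) !mxE.
    by listed x (pt 1 0 0 : 'rV[k]_3, E70).
  have ey : y = 0 by apply/eqP; move/esym/eqP: hy; rewrite mulf_eq0 (negPf l0).
  have ez : z = 0.
    by apply/eqP; move/esym/eqP: hz; rewrite ey expr0n /= mulf_eq0 (negPf l0).
  have ex : x = 0.
    by apply/eqP; move/esym/eqP: hx; rewrite ez expr0n /= mulf_eq0 (negPf l0).
  by case/eqP: n; rewrite ex ey ez (pt_eta 0) !mxE.
Qed.

Theorem linear_config :
  [\/ config_7A1 L, config_D4_3A1 L, config_D6_A1 L | config_E7 L].
Proof.
have [N nN cN] := semilinear_normal_form char_k dirmx_rank.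
exact: normal_form_config nN cN.
Qed.

End LinearForms.

Section ConstantForms.
Variable k : closedFieldType.
Hypothesis char_k : 2%N \in [pchar k].
Variable b : 'I_3 -> {mpoly k[3]}.
Hypothesis bm : forall i, b i \is 0.-homog.
Hypothesis bp : forall p, prime_elt p -> exists i, ~ divides p (b i).
Variable L : subsheafT k.
Hypothesis hL : forall v, v != 0 -> OY_stalk L v = Rloc b v.

(** The field is constant; its direction is the only singular point. *)
Theorem constant_config : config_A1 L.
Proof.
have hb v : dir b v = dir b 0.
  apply/rowP => i; rewrite !mxE -[0 in RHS](scale0r v) (heval_scale _ _ (bm i)).
  by rewrite expr0 mul1r.
have d0 : dir b 0 != 0.
  apply/eqP => /rowP d0; have [p pp] := prime_exists k; have [i] := bp pp; apply.
  suff -> : b i = 0 by exact: divides0.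
  have := d0 i; rewrite !mxE (homog0_const (bm i)) hevalC => /eqP; rewrite expf_eq0 /= => /eqP ->.
  by rewrite mpolyC0.
have [A Au eA] := frame_of_vector d0; rewrite -e0E in eA.
have tan : completion_iso (Rloc b (dir b 0)) (rdp_eqn k A1) /\ ~ regular2 (Rloc b (dir b 0)).
  by apply: (Rloc_tangent char_k bm bp d0 (oner_neq0 k)); rewrite hb scale1r.
exists A => //; split=> [v v0|_ ->]; last by rewrite /sing_of_type hL /= [pt _ _ _ *m A]eA //; case: tan.
rewrite /singular hL //; split=> [ns|[_ -> [c c0 ->]]]; last first.
  by rewrite Rloc_scale //= [pt _ _ _ *m A]eA; case: tan.
have [l el] : exists l, dir b v = l *: v.
  apply: contrapT => nl; apply: ns; apply: (Rloc_transverse char_k bm bp) => // l el.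
  by apply: nl; exists l.
rewrite hb in el; have l0 : l != 0 by apply: contraNneq d0 => l0; rewrite el l0 scale0r.
exists (pt 1 0 0, A1) => //; exists l^-1; first by rewrite invr_neq0.
by rewrite /= [pt _ _ _ *m A]eA el scalerA mulVf // scale1r.
Qed.

End ConstantForms.

(** * p-closed vector fields *)

Lemma frac_square_dec (F : fieldType) (p q a0 a1 a2 a3 t u w : F) : q != 0 -> t != 0 ->
  p * q = a0 ^+ 2 + a1 ^+ 2 * t * u + a2 ^+ 2 * t * w + a3 ^+ 2 * u * w ->
  p / q = (a0 / q) ^+ 2 + (a1 * t / q) ^+ 2 * (u / t) + (a2 * t / q) ^+ 2 * (w / t)
    + (a3 * t / q) ^+ 2 * (u / t * (w / t)).
Proof.
move=> q0 t0 e; have -> : p / q = (p * q) / q ^+ 2 by field.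
by rewrite e; field; rewrite q0 t0.
Qed.

Section MorphismDec.
Variables (R S : comPzRingType) (f : {rmorphism R -> S}).

Lemma morph_square_dec (a0 a1 a2 a3 t u w : R) :
  f (a0 ^+ 2 + a1 ^+ 2 * t * u + a2 ^+ 2 * t * w + a3 ^+ 2 * u * w) =
  f a0 ^+ 2 + f a1 ^+ 2 * f t * f u + f a2 ^+ 2 * f t * f w + f a3 ^+ 2 * f u * f w.
Proof. by rewrite !rmorphD !rmorphM. Qed.

Lemma morph_basis (z0 z1 z2 z3 x y : R) :
  f (z0 ^+ 2 + z1 ^+ 2 * x + z2 ^+ 2 * y + z3 ^+ 2 * (x * y)) =
  f z0 ^+ 2 + f z1 ^+ 2 * f x + f z2 ^+ 2 * f y + f z3 ^+ 2 * (f x * f y).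
Proof. by rewrite !rmorphD !rmorphM. Qed.

Lemma morph_der (z1 z2 z3 x y dx dy : R) :
  f (z1 ^+ 2 * dx + z2 ^+ 2 * dy + z3 ^+ 2 * (x * dy + y * dx)) =
  f z1 ^+ 2 * f dx + f z2 ^+ 2 * f dy + f z3 ^+ 2 * (f x * f dy + f y * f dx).
Proof. by rewrite !(rmorphD, rmorphM). Qed.

Lemma morph_cross (b0 b1 t u : R) : f (b0 ^+ 2 * u + b1 ^+ 2 * t) = f b0 ^+ 2 * f u + f b1 ^+ 2 * f t.
Proof. by rewrite rmorphD !rmorphM. Qed.

Lemma morph_vf (a1 a2 a3 b0 b1 b2 t u w : R) :
  f (a1 ^+ 2 * (t * b1 ^+ 2 + u * b0 ^+ 2) + a2 ^+ 2 * (t * b2 ^+ 2 + w * b0 ^+ 2)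
    + a3 ^+ 2 * (u * b2 ^+ 2 + w * b1 ^+ 2)) =
  f a1 ^+ 2 * (f t * f b1 ^+ 2 + f u * f b0 ^+ 2) + f a2 ^+ 2 * (f t * f b2 ^+ 2 + f w * f b0 ^+ 2)
    + f a3 ^+ 2 * (f u * f b2 ^+ 2 + f w * f b1 ^+ 2).
Proof. by rewrite !(rmorphD, rmorphM). Qed.

Lemma morph_affine (l c d x : R) : f (l * (c ^+ 2 + d ^+ 2 * x)) = f l * (f c ^+ 2 + f d ^+ 2 * f x).
Proof. by rewrite rmorphM rmorphD !rmorphM. Qed.
End MorphismDec.

Lemma frac_vf (F : fieldType) (char2 : 2%N \in [pchar F]) (G q a1 a2 a3 b0 b1 b2 t u w : F) :
  q != 0 -> t != 0 ->
  (a1 * t / q) ^+ 2 * (G * (b0 ^+ 2 * u + b1 ^+ 2 * t) / t ^+ 2)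
  + (a2 * t / q) ^+ 2 * (G * (b0 ^+ 2 * w + b2 ^+ 2 * t) / t ^+ 2)
  + (a3 * t / q) ^+ 2 * (u / t * (G * (b0 ^+ 2 * w + b2 ^+ 2 * t) / t ^+ 2)
      + w / t * (G * (b0 ^+ 2 * u + b1 ^+ 2 * t) / t ^+ 2)) =
  G * (a1 ^+ 2 * (t * b1 ^+ 2 + u * b0 ^+ 2) + a2 ^+ 2 * (t * b2 ^+ 2 + w * b0 ^+ 2)
    + a3 ^+ 2 * (u * b2 ^+ 2 + w * b1 ^+ 2)) / q ^+ 2.
Proof.
move=> q0 t0.
have e : forall c : F, c + c = 0 by move=> c; apply: addxx.
apply/eqP; rewrite -subr_eq0; apply/eqP.
rewrite -(e (G * a3 ^+ 2 * u * w * b0 ^+ 2 / t / q ^+ 2)).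
by field; rewrite q0 t0.
Qed.

Lemma frac_cancel3 (F : fieldType) (p a b c : F) : a != 0 -> b != 0 -> c != 0 ->
  p / a = (p * b * c) / (a * b * c).
Proof. by move=> a0 b0 c0; field; rewrite a0 b0 c0. Qed.

Lemma frac_cancel3' (F : fieldType) (p a b c : F) : a != 0 -> b != 0 -> c != 0 ->
  p / b = (a * p * c) / (a * b * c).
Proof. by move=> a0 b0 c0; field; rewrite a0 b0 c0. Qed.

Lemma frac_cancel3'' (F : fieldType) (p a b c : F) : a != 0 -> b != 0 -> c != 0 ->
  p / c = (a * b * p) / (a * b * c).
Proof. by move=> a0 b0 c0; field; rewrite a0 b0 c0. Qed.

Lemma slope_expand (R : comPzRingType) (z1 z2 z3 x y v w : R) :
  ((z1 ^+ 2 + z3 ^+ 2 * y) * v + (z2 ^+ 2 + z3 ^+ 2 * x)) * w =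
  z1 ^+ 2 * (v * w) + z2 ^+ 2 * w + z3 ^+ 2 * (x * w + y * (v * w)).
Proof. by ring. Qed.

Section Derivations.
Variable k : closedFieldType.
Hypothesis char_k : 2%N \in [pchar k].
Local Notation K := (ratfun k).
Local Notation P := {mpoly k[3]}.
Let charP : 2%N \in [pchar P] := pchar_mpoly char_k 3.
Let charK := pchar_ratfun char_k.

Definition ax : K := rat 'X_1 'X_0.
Definition ay : K := rat 'X_2 'X_0.

Lemma hval_ax : hval ax = hfrac 'X_1 / hfrac 'X_0.
Proof. exact: (hval_rat (dhomog_Xi k 1) (dhomog_Xi k 0) (X_neq0 k 0)). Qed.

Lemma hval_ay : hval ay = hfrac 'X_2 / hfrac 'X_0.
Proof. exact: (hval_rat (dhomog_Xi k 2%R) (dhomog_Xi k 0) (X_neq0 k 0)). Qed.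

(** The expansion over the field of squares in the basis 1, [ax], [ay], [ax * ay],
    at the level of numerators and of functions. *)
Lemma ratfun_dec d (p q : P) : p \is d.-homog -> q \is d.-homog -> q != 0 ->
  exists (a0 a1 a2 a3 : P) (z0 z1 z2 z3 : K),
  [/\ p * q = a0 ^+ 2 + a1 ^+ 2 * 'X_0 * 'X_1 + a2 ^+ 2 * 'X_0 * 'X_2 + a3 ^+ 2 * 'X_1 * 'X_2,
      rat p q = z0 ^+ 2 + z1 ^+ 2 * ax + z2 ^+ 2 * ay + z3 ^+ 2 * (ax * ay),
      hval z1 = hfrac a1 * hfrac 'X_0 / hfrac q, hval z2 = hfrac a2 * hfrac 'X_0 / hfrac q &
      hval z3 = hfrac a3 * hfrac 'X_0 / hfrac q].
Proof.
move=> hp hq q0.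
have hpq : p * q \is (2 * d).-homog.
  by apply: (dhomog_cast _ (dhomogM hp hq)); rewrite addnn mul2n.
have [a0 [a1 [a2 [a3 [e h0 h1 h2 h3]]]]] := square_dec char_k hpq.
exists a0, a1, a2, a3, (rat a0 q), (rat (a1 * 'X_0) q), (rat (a2 * 'X_0) q), (rat (a3 * 'X_0) q).
have e0 := hval_rat h0 hq q0; have e1 := hval_rat h1 hq q0.
have e2 := hval_rat h2 hq q0; have e3 := hval_rat h3 hq q0.
rewrite hfracM in e1; rewrite hfracM in e2; rewrite hfracM in e3.
split=> //; apply: hval_inj.
rewrite (morph_basis (@hval k) _ _ _ _ ax ay : hval _ = hval _ ^+ 2 + hval _ ^+ 2 * hval ax
  + hval _ ^+ 2 * hval ay + hval _ ^+ 2 * (hval ax * hval ay)).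
rewrite e0 e1 e2 e3 hval_ax hval_ay (hval_rat hp hq q0).
apply: frac_square_dec; [exact: hfrac_neq0 | exact/hfrac_neq0/X_neq0 |].
rewrite -hfracM e.
exact: (morph_square_dec (@hfrac k) a0 a1 a2 a3 'X_0 'X_1 'X_2).
Qed.

Variable D : K -> K.
Hypothesis Dder : derivation D.

Lemma derD f g : D (f + g) = D f + D g. Proof. by case: Dder. Qed.
Lemma derM f g : D (f * g) = f * D g + g * D f. Proof. by case: Dder. Qed.

Lemma der_sqr f : D (f ^+ 2) = 0.
Proof. by rewrite expr2 derM; exact: (addxx charK). Qed.

Lemma der_sqrM f g : D (f ^+ 2 * g) = f ^+ 2 * D g.
Proof. by rewrite derM der_sqr mulr0 addr0. Qed.

Lemma der_dec z0 z1 z2 z3 :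
  D (z0 ^+ 2 + z1 ^+ 2 * ax + z2 ^+ 2 * ay + z3 ^+ 2 * (ax * ay)) =
  z1 ^+ 2 * D ax + z2 ^+ 2 * D ay + z3 ^+ 2 * (ax * D ay + ay * D ax).
Proof. by rewrite !derD der_sqr !der_sqrM derM add0r. Qed.

(** Both sides are derivations that agree on the coordinates [ax] and [ay]. *)
Lemma der_formula (b : 'I_3 -> P) (G : hfield k) :
  hval (D ax) = G * hfrac (cross b 0 1) / hfrac 'X_0 ^+ 2 ->
  hval (D ay) = G * hfrac (cross b 0 2%R) / hfrac 'X_0 ^+ 2 ->
  forall d (p q : P), p \is d.-homog -> q \is d.-homog -> q != 0 ->
  hval (D (rat p q)) = G * hfrac (vf b p * q + p * vf b q) / hfrac q ^+ 2.
Proof.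
move=> ex ey d p q hp hq q0.
have [a0 [a1 [a2 [a3 [z0 [z1 [z2 [z3 [e -> e1 e2 e3]]]]]]]]] := ratfun_dec hp hq q0.
rewrite der_dec (morph_der (@hval k) z1 z2 z3 ax ay (D ax) (D ay) : hval _ =
  hval z1 ^+ 2 * hval (D ax) + hval z2 ^+ 2 * hval (D ay)
  + hval z3 ^+ 2 * (hval ax * hval (D ay) + hval ay * hval (D ax))).
have -> : vf b p * q + p * vf b q = vf b (p * q) by rewrite vfM addrC [q * _]mulrC.
have -> : vf b (p * q) = a1 ^+ 2 * ('X_0 * b 1 ^+ 2 + 'X_1 * b 0 ^+ 2)
    + a2 ^+ 2 * ('X_0 * b 2%R ^+ 2 + 'X_2 * b 0 ^+ 2)
    + a3 ^+ 2 * ('X_1 * b 2%R ^+ 2 + 'X_2 * b 1 ^+ 2).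
  rewrite e -[a1 ^+ 2 * _ * _]mulrA -[a2 ^+ 2 * _ * _]mulrA -[a3 ^+ 2 * _ * _]mulrA.
  rewrite !vfD (vf_sqr char_k) add0r.
  rewrite (vf_sqrM char_k b a1) (vf_sqrM char_k b a2) (vf_sqrM char_k b a3).
  by rewrite (vfM b 'X_0 'X_1) (vfM b 'X_0 'X_2) (vfM b 'X_1 'X_2) !vfX.
rewrite (morph_vf (@hfrac k) a1 a2 a3 (b 0) (b 1) (b 2%R) 'X_0 'X_1 'X_2 : hfrac _ =
  hfrac a1 ^+ 2 * (hfrac 'X_0 * hfrac (b 1) ^+ 2 + hfrac 'X_1 * hfrac (b 0) ^+ 2)
  + hfrac a2 ^+ 2 * (hfrac 'X_0 * hfrac (b 2%R) ^+ 2 + hfrac 'X_2 * hfrac (b 0) ^+ 2)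
  + hfrac a3 ^+ 2 * (hfrac 'X_1 * hfrac (b 2%R) ^+ 2 + hfrac 'X_2 * hfrac (b 1) ^+ 2)).
rewrite ex ey e1 e2 e3 hval_ax hval_ay.
rewrite (morph_cross (@hfrac k) (b 0) (b 1) 'X_0 'X_1 : hfrac (cross b 0 1) =
  hfrac (b 0) ^+ 2 * hfrac 'X_1 + hfrac (b 1) ^+ 2 * hfrac 'X_0).
rewrite (morph_cross (@hfrac k) (b 0) (b 2%R) 'X_0 'X_2 : hfrac (cross b 0 2%R) =
  hfrac (b 0) ^+ 2 * hfrac 'X_2 + hfrac (b 2%R) ^+ 2 * hfrac 'X_0).
apply: frac_vf; [|exact: hfrac_neq0 | exact/hfrac_neq0/X_neq0].
exact: (rmorph_pchar (@hfrac k) charP).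
Qed.

Lemma ratfun_basis f : exists z0 z1 z2 z3 : K,
  f = z0 ^+ 2 + z1 ^+ 2 * ax + z2 ^+ 2 * ay + z3 ^+ 2 * (ax * ay).
Proof.
have [d [p [q [hp hq q0 e]]]] := ratfunP f.
have [_ [_ [_ [_ [z0 [z1 [z2 [z3 [_ ez _ _ _]]]]]]]]] := ratfun_dec hp hq q0.
exists z0, z1, z2, z3; rewrite -ez; apply: hval_inj.
by rewrite (hval_rat hp hq q0).
Qed.

(** Differentiate the equation between polynomials with respect to [X_2]. *)
Lemma ay_nonsquare w : w ^+ 2 <> ay.
Proof.
move/(congr1 (@hval k)); rewrite hvalX hval_ay.
have [d [p [q [hp hq q0 ->]]]] := ratfunP w.
rewrite expr_div_n -!hfracX => /eq_frac; rewrite expf_neq0 // X_neq0 => /(_ isT isT).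
move/(congr1 (mderiv (2%R : 'I_3))); rewrite [LHS]mderivM [RHS]mderivM !(mderiv_sqr char_k) mul0r mulr0 addr0.
rewrite !mderivXi /= !(mulr0, mulr1, mul1r, addr0, add0r) => /eqP.
by rewrite eq_sym expf_eq0 (negPf q0).
Qed.

(** A vector field with [D^2 = alpha * D] annihilates its own slope; expanding
    the slope over the field of squares gives the shape of [D]. *)
Lemma p_closed_form (alpha f0 : K) : (forall f, D (D f) = alpha * D f) -> D f0 != 0 ->
  exists l c0 c1 c2 : K, [/\ l != 0, ~ [/\ c0 = 0, c1 = 0 & c2 = 0],
    D ax = l * (c1 ^+ 2 + c0 ^+ 2 * ax) & D ay = l * (c2 ^+ 2 + c0 ^+ 2 * ay)].
Proof.
move=> DD f00.
have nz : ~ (D ax = 0 /\ D ay = 0).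
  move=> [ex ey]; have [z0 [z1 [z2 [z3 e]]]] := ratfun_basis f0.
  by move: f00; rewrite e der_dec ex ey !(mulr0, addr0) eqxx.
suff [l [c0 [c1 [c2 [l0 ex ey]]]]] : exists l c0 c1 c2 : K, [/\ l != 0,
    D ax = l * (c1 ^+ 2 + c0 ^+ 2 * ax) & D ay = l * (c2 ^+ 2 + c0 ^+ 2 * ay)].
  exists l, c0, c1, c2; split=> // -[e0 e1 e2]; apply: nz.
  by rewrite ex ey e0 e1 e2 expr0n !mul0r addr0 mulr0.
have [ey|y0] := eqVneq (D ay) 0.
  have x0 : D ax != 0 by apply/eqP => ex; apply: nz.
  by exists (D ax), 0, 1, 0; rewrite expr0n expr1n !mul0r !addr0 mulr0 mulr1.
pose v := D ax / D ay; have ev : D ax = v * D ay by rewrite /v divfK.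
(* Apply [D] to [D ax = v * D ay] and use [DD] on both sides. *)
have Dv : D v = 0.
  have e := DD ax; rewrite {1 2}ev derM DD mulrCA in e.
  by move/addrI: (etrans e (esym (addr0 _))) => /eqP; rewrite mulf_eq0 (negPf y0) => /eqP.
have [z0 [z1 [z2 [z3 e]]]] := ratfun_basis v.
have {}Dv : (z1 ^+ 2 + z3 ^+ 2 * ay) * v = z2 ^+ 2 + z3 ^+ 2 * ax.
  move: Dv; rewrite e der_dec -e ev => h.
  apply: (add_eq0_2 charK); apply: (mulIf y0); rewrite mul0r -[RHS]h.
  exact: slope_expand.
have [c0|c0] := eqVneq (z1 ^+ 2 + z3 ^+ 2 * ay) 0; last first.
  exists (D ay / (z1 ^+ 2 + z3 ^+ 2 * ay)), z3, z2, z1; split.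
  - exact: (mulf_neq0 y0 (invr_neq0 c0)).
  - by rewrite -Dv mulrA divfK // mulrC.
  - by rewrite divfK.
have z30 : z3 = 0.
  apply/eqP/negPn/negP => z30; apply: (@ay_nonsquare (z1 / z3)).
  by rewrite expr_div_n (add_eq0_2 charK c0) mulrC mulKf ?expf_neq0.
move: c0 Dv e; rewrite z30 expr0n !mul0r !addr0 => z10.
rewrite z10 !mul0r addr0 => <-; rewrite mul0r addr0 => e.
by exists (D ay), 0, z0, 1; rewrite expr0n expr1n !mul0r !addr0 mulr1 -e mulrC.
Qed.

Lemma common_denominator (c : 'I_3 -> K) : exists d (b : 'I_3 -> P) q,
  [/\ forall i, b i \is d.-homog, q \is d.-homog, q != 0 &
      forall i, hval (c i) = hfrac (b i) / hfrac q].
Proof.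
have [d0 [p0 [q0 [hp0 hq0 z0 e0]]]] := ratfunP (c 0).
have [d1 [p1 [q1 [hp1 hq1 z1 e1]]]] := ratfunP (c 1).
have [d2 [p2 [q2 [hp2 hq2 z2 e2]]]] := ratfunP (c 2%R).
exists (d0 + d1 + d2)%N,
  (fun i => [:: p0 * q1 * q2; q0 * p1 * q2; q0 * q1 * p2]`_i), (q0 * q1 * q2).
have h0 := hfrac_neq0 z0; have h1 := hfrac_neq0 z1; have h2 := hfrac_neq0 z2.
split.
- by move=> i; case: (ord3E i) => -> /=; apply: dhomogM => //; apply: dhomogM.
- by apply: dhomogM => //; apply: dhomogM.
- by rewrite !mulf_neq0.
move=> i; case: (ord3E i) => -> /=; rewrite !hfracM ?e0 ?e1 ?e2.
- exact: (frac_cancel3 (hfrac p0) h0 h1 h2).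
- exact: (frac_cancel3' (hfrac p1) h0 h1 h2).
- exact: (frac_cancel3'' (hfrac p2) h0 h1 h2).
Qed.

End Derivations.

(** * Vector fields without common factor *)

Lemma frac_affine (F : fieldType) (l b0 b1 q t u : F) : q != 0 -> t != 0 ->
  l * ((b1 / q) ^+ 2 + (b0 / q) ^+ 2 * (u / t)) =
  (l * t / q ^+ 2) * (b0 ^+ 2 * u + b1 ^+ 2 * t) / t ^+ 2.
Proof. by move=> q0 t0; field; rewrite q0 t0. Qed.

Lemma cross_scale (k : closedFieldType) (b r : 'I_3 -> {mpoly k[3]}) p i j :
  (forall i, b i = r i * p) -> cross b i j = p ^+ 2 * cross r i j.
Proof. by move=> e; rewrite /cross !e !exprMn; ring. Qed.

Lemma frac_assoc (F : fieldType) (g p c t : F) : g * (p ^+ 2 * c) / t = g * p ^+ 2 * c / t.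
Proof. by rewrite !mulrA. Qed.

Section PrimitiveForm.
Variable k : closedFieldType.
Hypothesis char_k : 2%N \in [pchar k].
Local Notation K := (ratfun k).
Local Notation P := {mpoly k[3]}.

Lemma divides_homog_quot d e (p q : P) : p != 0 -> p \is e.-homog -> q \is d.-homog ->
  divides p q -> exists2 r, q = r * p & r \is (d - e)%N.-homog.
Proof.
move=> p0 hp hq pq; have [->|q0] := eqVneq q 0.
  by exists 0; rewrite ?mul0r // rpred0.
have [i [j [r [hp' hr er ->]]]] := divides_dhomog q0 hq pq.
by exists r => //; rewrite (dhomog_uniq p0 hp hp') addKn.
Qed.

Variable D : K -> K.
Hypothesis Dder : derivation D.

(** [D] is [G] times the vector field [vf b] on quotients of forms of the same
    degree; it suffices to say so for the coordinates. *)
Definition represents m (b : 'I_3 -> P) (G : hfield k) : Prop :=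
  [/\ forall i, b i \is m.-homog, exists i, b i != 0, G != 0,
      hval (D (ax k)) = G * hfrac (cross b 0 1) / hfrac 'X_0 ^+ 2 &
      hval (D (ay k)) = G * hfrac (cross b 0 2%R) / hfrac 'X_0 ^+ 2].

Lemma p_closed_represents (alpha f0 : K) : (forall f, D (D f) = alpha * D f) ->
  D f0 != 0 -> exists m b G, represents m b G.
Proof.
move=> DD f00; have [l [c0 [c1 [c2 [l0 nc ex ey]]]]] := p_closed_form char_k Dder DD f00.
have [d [b [q [hb hq q0 eb]]]] := common_denominator (fun i : 'I_3 => [:: c0; c1; c2]`_i).
have h0 := hfrac_neq0 q0; have hX := hfrac_neq0 (X_neq0 k 0).
have e0 := eb 0; have e1 := eb 1; have e2 := eb 2%R; rewrite /= in e0 e1 e2.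
exists d, b, (hval l * hfrac 'X_0 / hfrac q ^+ 2); split.
- exact: hb.
- apply: contrapT => nb; apply: nc.
  have z i : b i = 0 by apply/eqP/negPn/negP => bi; apply: nb; exists i.
  rewrite z rmorph0 mul0r in e0; rewrite z rmorph0 mul0r in e1; rewrite z rmorph0 mul0r in e2.
  by split; apply: hval_inj; [rewrite e0|rewrite e1|rewrite e2]; rewrite rmorph0.
- have hl : hval l != 0.
    by apply: contra_neq l0 => e; apply: hval_inj; rewrite e rmorph0.
  exact: (mulf_neq0 (mulf_neq0 hl hX) (invr_neq0 (expf_neq0 2 h0))).
- rewrite ex (morph_affine (@hval k) l c1 c0 (ax k) : hval _ =
    hval l * (hval c1 ^+ 2 + hval c0 ^+ 2 * hval (ax k))) e0 e1 hval_ax.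
  rewrite (morph_cross (@hfrac k) (b 0) (b 1) 'X_0 'X_1 : hfrac (cross b 0 1) =
    hfrac (b 0) ^+ 2 * hfrac 'X_1 + hfrac (b 1) ^+ 2 * hfrac 'X_0).
  exact: (frac_affine _ _ _ _ h0 hX).
- rewrite ey (morph_affine (@hval k) l c2 c0 (ay k) : hval _ =
    hval l * (hval c2 ^+ 2 + hval c0 ^+ 2 * hval (ay k))) e0 e2 hval_ay.
  rewrite (morph_cross (@hfrac k) (b 0) (b 2%R) 'X_0 'X_2 : hfrac (cross b 0 2%R) =
    hfrac (b 0) ^+ 2 * hfrac 'X_2 + hfrac (b 2%R) ^+ 2 * hfrac 'X_0).
  exact: (frac_affine _ _ _ _ h0 hX).
Qed.

(** Take [m] minimal: a common prime factor of the [b i] is a form of positive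
    degree and could be moved into [G]. *)
Lemma primitive_form (alpha f0 : K) : (forall f, D (D f) = alpha * D f) -> D f0 != 0 ->
  exists m b G, represents m b G /\ forall p, prime_elt p -> exists i, ~ divides p (b i).
Proof.
move=> DD f00; pose S m := `[< exists b G, represents m b G >].
have exS : exists m, S m.
  by have [m [b [G h]]] := p_closed_represents DD f00; exists m; apply/asboolP; exists b, G.
case: (ex_minnP exS) => m /asboolP[b [G [hb [j bj] G0 ex ey]]] mmin.
exists m, b, G; split; first by split; [exact: hb | exists j | | | ].
move=> p pp; apply: contrapT => np.
have pb i : divides p (b i) by apply: contrapT => h; apply: np; exists i.
have [e [j' [r0 [hp hr0 er0 em]]]] := divides_dhomog bj (hb j) (pb j).
have p0 := prime_neq0 pp.
have e0 : (0 < e)%N.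
  rewrite lt0n; apply/eqP => e0; case: pp => _ /negP[]; rewrite e0 in hp.
  exact: homog0_unit.
have /fin_all_exists[r hr] i : exists r, b i = r * p /\ r \is (m - e)%N.-homog.
  by have [r er hr] := divides_homog_quot p0 hp (hb i) (pb i); exists r.
have er i : b i = r i * p by case: (hr i).
have : (m <= m - e)%N.
  apply: mmin; apply/asboolP; exists r, (G * hfrac p ^+ 2); split.
  - by move=> i; case: (hr i).
  - by exists j; apply: contraNneq bj => z; rewrite er z mul0r.
  - exact: (mulf_neq0 G0 (expf_neq0 2 (hfrac_neq0 p0))).
  - rewrite ex (cross_scale _ _ er) hfracM hfracX; exact: frac_assoc.
  - rewrite ey (cross_scale _ _ er) hfracM hfracX; exact: frac_assoc.
by rewrite em; move: e0; clear; lia.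
Qed.

End PrimitiveForm.

(** * Open sets and regular fractions *)

Section OpenSets.
Variable k : closedFieldType.
Local Notation P := {mpoly k[3]}.
Implicit Types (p q : P) (U V : set 'rV[k]_3).

Definition basic_open q : set 'rV[k]_3 := [set v | P2 v /\ heval q v != 0].

Lemma line_poly p (v w : 'rV[k]_3) : exists h : {poly k}, forall t, h.[t] = heval p (v + t *: w).
Proof.
pose f (i : 'I_3) : {poly k} := (v 0 i)%:P + (w 0 i)%:P * 'X.
exists (mmap (@polyC k) f p) => t; rewrite /mmap /heval mevalE horner_sum.
apply: eq_bigr => m _; rewrite hornerM hornerC; congr (_ * _); rewrite /mmap1 horner_prod.
by apply: eq_bigr => i _; rewrite horner_exp hornerD hornerM !hornerC hornerX !mxE mulrC.
Qed.

(** If [h] is not constant, it takes the value 1. *)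
Lemma poly_nonroot (h : {poly k}) : h != 0 -> exists t, h.[t] != 0.
Proof.
move=> h0; have [s1|s1] := boolP (size (h - 1) == 1%N); last first.
  have [t] := closed_rootP _ s1; rewrite /root hornerD hornerN hornerC subr_eq0 => /eqP e.
  by exists t; rewrite e oner_neq0.
have e : h = ((h - 1)`_0 + 1)%:P.
  by rewrite polyCD -(size1_polyC (eq_leq (eqP s1))) subrK.
by exists 0; rewrite e hornerC -polyC_eq0 -e.
Qed.

(** Irreducibility of the plane: two points are joined by a line, on which each of
    [p] and [q] vanishes at finitely many points. *)
Lemma basic_open_meet d e p q v w : p \is d.-homog -> q \is e.-homog ->
  v != 0 -> w != 0 -> heval p v != 0 -> heval q w != 0 ->
  exists2 u, u != 0 & heval (p * q) u != 0.
Proof.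
move=> hp hq v0 w0 pv qw.
have [[c ec]|ni] := pselect (exists c, w = c *: v).
  exists v => //; rewrite hevalM mulf_neq0 //; move: qw.
  by rewrite ec (heval_scale _ _ hq) mulf_eq0 negb_or => /andP[].
have [f hf] := line_poly p v (w - v); have [g hg] := line_poly q v (w - v).
have [|t ft] := @poly_nonroot (f * g).
  rewrite mulf_neq0 //.
    by apply: contraNneq pv => f0; have := hf 0; rewrite f0 horner0 scale0r addr0 => <-.
  by apply: contraNneq qw => g0; have := hg 1; rewrite g0 horner0 scale1r addrC subrK => <-.
exists (v + t *: (w - v)); last by rewrite hevalM -hf -hg -hornerM.
apply/eqP => z; apply: ni; have [t0|t0] := eqVneq t 0.
  by move: z v0; rewrite t0 scale0r addr0 => ->; rewrite eqxx.
exists (- t^-1 + 1); rewrite scalerDl scale1r scaleNr.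
have /eqP : t^-1 *: v + (w - v) = 0.
  by rewrite -[RHS](scaler0 _ t^-1) -z scalerDr scalerA mulVf // scale1r.
by rewrite addrC addr_eq0 => /eqP <-; rewrite subrK.
Qed.

Lemma basic_open_ne d q v : q \is d.-homog -> v != 0 -> heval q v != 0 -> open_ne (basic_open q).
Proof. by move=> hq v0 qv; apply: (open_neq0 hq); [exact: heval_neq0 qv | exists v]. Qed.

Lemma open_ne_P2 U : open_ne U -> U `<=` @P2 k.
Proof. by move=> [[S hS ->] _] v []. Qed.

Lemma open_ne_meet d q v U : open_ne U -> q \is d.-homog -> v != 0 -> heval q v != 0 ->
  open_ne (U `&` basic_open q).
Proof.
move=> [[S hS eU] [u Uu]] hq v0 qv.
have [u0 [p Sp pu]] : P2 u /\ exists2 p, S p & heval p u != 0 by move: Uu; rewrite eU.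
split.
  exists [set r | exists2 p, S p & r = p * q].
    by move=> _ [p' /hS[e hp'] ->]; exists (e + d)%N; apply: dhomogM.
  rewrite eU; apply/seteqP; split=> w /=.
    move=> [[w0 [p' Sp' pw]] [_ qw]]; split=> //; exists (p' * q); first by exists p'.
    by rewrite hevalM mulf_neq0.
  move=> [w0 [_ [p' Sp' ->]]]; rewrite hevalM mulf_eq0 negb_or => /andP[pw qw].
  by split; split=> //; exists p'.
have [e hp] := hS p Sp.
have [w w0] := basic_open_meet hp hq u0 v0 pu qv.
rewrite hevalM mulf_eq0 negb_or => /andP[pw qw].
by exists w; rewrite eU; split; split=> //; exists p.
Qed.

Lemma coordinate_neq0 (v : 'rV[k]_3) : v != 0 -> exists j, v 0 j != 0.
Proof.
move=> v0; apply: contrapT => h; case/eqP: v0; apply/rowP => j; rewrite mxE.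
by apply/eqP/negPn/negP => vj; apply: h; exists j.
Qed.

Lemma coordinate_open j : open_ne (basic_open ('X_j : P)).
Proof.
apply: (basic_open_ne (v := delta_mx 0 j) (dhomog_Xi k j)); last first.
  by rewrite hevalXi mxE !eqxx oner_neq0.
by apply/eqP => /rowP/(_ j); rewrite !mxE !eqxx => /eqP; rewrite oner_eq0.
Qed.

Lemma open_ne_coord U : open_ne U -> open_ne (U `&` basic_open 'X_0).
Proof.
move=> oU; apply: (open_ne_meet (v := delta_mx 0 0) oU (dhomog_Xi k 0)); last first.
  by rewrite hevalXi mxE !eqxx oner_neq0.
by apply/eqP => /rowP/(_ 0); rewrite !mxE !eqxx => /eqP; rewrite oner_eq0.
Qed.

End OpenSets.

Section Regular.
Variable k : closedFieldType.
Local Notation K := (ratfun k).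
Local Notation H := (hfield k).
Local Notation P := {mpoly k[3]}.
Implicit Types (p q : P) (w : 'rV[k]_3) (h g : H).

(** Regularity for fractions of any degree; homogeneity of the numerator then
    follows in degree 0, see [regular_Oloc]. *)
Definition regular_at w h : Prop := exists e p q,
  [/\ q \is e.-homog, heval q w != 0 & h = hfrac p / hfrac q].

Lemma regular_poly w p : regular_at w (hfrac p).
Proof.
exists 0%N, p, 1; split; [exact: dhomog1 | by rewrite heval1 oner_neq0 |].
by rewrite rmorph1 divr1.
Qed.

Lemma regular_inv w e q : q \is e.-homog -> heval q w != 0 -> regular_at w (hfrac q)^-1.
Proof. by move=> hq qw; exists e, 1, q; split=> //; rewrite rmorph1 div1r. Qed.

Lemma regularM w h g : regular_at w h -> regular_at w g -> regular_at w (h * g).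
Proof.
move=> [e [p [q [hq qw ->]]]] [e' [p' [q' [hq' qw' ->]]]].
exists (e + e')%N, (p * p'), (q * q'); split.
- exact: dhomogM.
- by rewrite hevalM mulf_neq0.
- by rewrite mulf_div !hfracM.
Qed.

Lemma regularD w h g : regular_at w h -> regular_at w g -> regular_at w (h + g).
Proof.
move=> [e [p [q [hq qw ->]]]] [e' [p' [q' [hq' qw' ->]]]].
have q0 := hfrac_neq0 (heval_neq0 qw); have q0' := hfrac_neq0 (heval_neq0 qw').
exists (e + e')%N, (p * q' + p' * q), (q * q'); split.
- exact: dhomogM.
- by rewrite hevalM mulf_neq0.
- by rewrite addf_div // hfracD !hfracM.
Qed.

Lemma regular_Xz w j (z : int) : w 0 j != 0 -> regular_at w (hfrac 'X_j ^ z).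
Proof.
move=> wj; case: z => n.
  by have := regular_poly w ('X_j ^+ n); rewrite hfracX.
have := @regular_inv w _ _ (dhomogMn n.+1 (dhomog_Xi k j)).
rewrite heval_exp hevalXi expf_neq0 // hfracX; exact.
Qed.

Lemma regular_Oloc w (f : K) : regular_at w (hval f) -> Oloc w f.
Proof.
move=> [e [p [q [hq qw ef]]]]; have q0 := heval_neq0 qw.
have [d [a [c [ha hc c0 ea]]]] := ratfunP f.
have E : a * q = p * c by apply: eq_frac => //; rewrite -ea.
have [p0|p0] := eqVneq p 0.
  by exists e, p, q; split=> //; rewrite p0 rpred0.
have hpc : p * c \is (e + d).-homog by rewrite -E addnC; apply: dhomogM.
have [i hp /(_ p0) ei] := dhomog_factor_r c0 hpc hc.
by exists e, p, q; split=> //; rewrite (addIn ei).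
Qed.

Lemma Oloc_regular w (f : K) : Oloc w f -> regular_at w (hval f).
Proof. by move=> [d [p [q [_ hq qw e]]]]; exists d, p, q. Qed.

(** A prime factor of [C] has a zero [v], and does not divide the denominator of
    the expression that is regular at [v]. *)
Lemma regular_everywhere d (A C : P) : C \is d.-homog -> C != 0 ->
  (forall v, v != 0 -> regular_at v (hfrac A / hfrac C)) -> divides C A.
Proof.
move=> hC C0 hr.
have hv (v : {v : 'rV[k]_3 | v != 0}) : exists q, heval q (val v) != 0 /\ divides C (q * A).
  have [e [p [q [hq qv E]]]] := hr _ (valP v); exists q; split=> //.
  by exists p; rewrite mulrC; apply: eq_frac => //; exact: heval_neq0 qv.
have [Q hQ] := choice hv.
apply: (divides_cancel (A := Q)) => //; first exact: factorial_mpoly.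
  by move=> v; case: (hQ v).
move=> p pp pC; have [e [j [r [hp _ _ _]]]] := divides_dhomog C0 hC pC.
have e0 : (0 < e)%N.
  rewrite lt0n; apply/eqP => e0; case: pp => p0 /negP[]; rewrite e0 in hp.
  exact: homog0_unit.
have [v v0 pv] := homog_zero hp e0; exists (exist _ v v0) => -[c ec].
by case: (hQ (exist _ v v0)) => /eqP[]; rewrite ec hevalM pv mulr0.
Qed.

End Regular.

(** * Sections of an invertible foliation *)

Lemma frac_untwist (F : fieldType) (p q x : F) : p / q / x = p / (q * x).
Proof. by rewrite -mulrA invfM. Qed.

Lemma frac_untwistV (F : fieldType) (p q x : F) : p / q / x^-1 = p * x / q.
Proof. by rewrite invrK mulrAC. Qed.

Section Twist.
Variable k : closedFieldType.
Local Notation K := (ratfun k).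
Local Notation P := {mpoly k[3]}.
Variable n : int.

(** The section of O(n) that generates it where [X_j] does not vanish. *)
Definition Xpow (j : 'I_3) : hfield k := hfrac 'X_j ^ n.

Lemma hfracXi_neq0 (j : 'I_3) : hfrac ('X_j : P) != 0.
Proof. exact: (hfrac_neq0 (X_neq0 k j)). Qed.

Lemma Xpow_neq0 j : Xpow j != 0.
Proof. exact: (expfz_neq0 n (hfracXi_neq0 j)). Qed.

Lemma hquot_untwist z j s p q : hquot z s p q -> exists p' q', hquot (z - n) (s / Xpow j) p' q' /\
  forall v, heval q v != 0 -> v 0 j != 0 -> heval q' v != 0.
Proof.
move=> [d [e [hp hq q0 de ->]]]; rewrite /Xpow.
have XN N := dhomogXn k j N.
case: n de => N de.
  exists p, (q * 'X_j ^+ N); split; last first.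
    by move=> v qv vj; rewrite hevalM heval_exp hevalXi mulf_neq0 // expf_neq0.
  exists d, (e + N)%N; split.
  - exact: hp.
  - by apply: dhomogM.
  - by rewrite mulf_neq0 // expf_neq0 // X_neq0.
  - by rewrite de PoszD addrA addrAC addrK.
  - rewrite hfracM hfracX; exact: frac_untwist.
exists (p * 'X_j ^+ N.+1), q; split => //; exists (d + N.+1)%N, e; split.
- by apply: dhomogM.
- exact: hq.
- exact: q0.
- by rewrite PoszD de NegzE opprK addrA.
- rewrite hfracM hfracX; exact: frac_untwistV.
Qed.

Lemma twist_untwist j U s (f : K) : twist n U s -> (forall v, U v -> v 0 j != 0) ->
  hval f * Xpow j = s -> OX U f.
Proof.
move=> ts Uj ef v Uv; have [p [q [hs qv]]] := ts v Uv.
have [p' [q' []]] := hquot_untwist j hs; rewrite subrr => h h'; exists p', q'; split; last by apply: h' => //; exact: Uj.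
by move: h; rewrite -ef (mulfK (Xpow_neq0 j)).
Qed.

Lemma twist_quot j U s : U !=set0 -> twist n U s -> exists f : K, hval f * Xpow j = s.
Proof.
move=> [v Uv] /(_ v Uv)[p [q [hs _]]]; have [p' [q' []]] := hquot_untwist j hs; rewrite subrr => h _.
have hin : s / Xpow j \in @hdeg0 k by apply/asboolP; exists p', q'.
by exists (SubfieldOf hin); rewrite [hval _]/(s / Xpow j) (divfK (Xpow_neq0 j)).
Qed.

Lemma twist_Xpow (j : 'I_3) (U : set 'rV[k]_3) : (forall v, U v -> v 0 j != 0) -> twist n U (Xpow j).
Proof.
move=> Uj v /Uj vj; rewrite /Xpow.
have XN N := dhomogXn k j N.
case: n => N.
  exists ('X_j ^+ N), 1; rewrite heval1 oner_neq0; split=> //.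
  exists N, 0%N; split; first exact: XN.
  - exact: dhomog1.
  - exact: oner_neq0.
  - by rewrite add0r.
  - by rewrite hfracX rmorph1 divr1.
exists 1, ('X_j ^+ N.+1); rewrite heval_exp hevalXi expf_neq0 //; split=> //.
exists 0%N, N.+1; split; first exact: dhomog1.
- exact: XN.
- by rewrite expf_neq0 // X_neq0.
- by rewrite NegzE subrr.
- by rewrite hfracX rmorph1 div1r.
Qed.

Lemma twist_sub (U V : set 'rV[k]_3) (s : hfield k) : V `<=` U -> twist n U s -> twist n V s.
Proof. by move=> VU ts v /VU; apply: ts. Qed.

Lemma twist0 (U : set 'rV[k]_3) (s : hfield k) : twist n U s -> twist n U 0.
Proof.
move=> ts v /ts[p [q [[d [e [hp hq q0 de _]]] qv]]]; exists 0, q; split=> //.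
by exists d, e; rewrite rpred0 rmorph0 mul0r.
Qed.

Lemma twist_regular (U : set 'rV[k]_3) (s : hfield k) v : twist n U s -> U v -> regular_at v s.
Proof. by move=> ts /ts[p [q [[d [e [hp hq q0 de es]]] qv]]]; exists e, p, q. Qed.

End Twist.

(** The condition on the isomorphism [phi] from O(n) to [L] in [has_degree]. *)
Definition trivialization (k : closedFieldType) (L : subsheafT k) (n : int)
    (phi : set 'rV[k]_3 -> hfield k -> ratfun k -> ratfun k) : Prop :=
  forall U, open_ne U -> U `<=` @P2 k ->
    [/\ set_bij (twist n U) (L U) (phi U),
        forall s t, twist n U s -> twist n U t ->
          phi U (s + t) = (fun g => phi U s g + phi U t g),
        forall f s, OX U f -> twist n U s ->
          phi U (hval f * s) = (fun g => f * phi U s g) &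
        forall V, open_ne V -> V `<=` U -> forall s, twist n U s ->
          phi V s = phi U s].

Section Foliation.
Variable k : closedFieldType.
Local Notation K := (ratfun k).
Local Notation P := {mpoly k[3]}.
Variables (L : subsheafT k) (n : int).
Local Notation s := (@Xpow k n).
Local Notation D_ j := (basic_open ('X_j : P)).
Variable phi : set 'rV[k]_3 -> hfield k -> K -> K.
Hypothesis phiP : trivialization L n phi.

(** The generator of [L] over the first affine chart, as a rational vector field. *)
Definition generator : K -> K := phi (D_ 0) (s 0).
Local Notation Delta := generator.

Lemma D_coord j v : D_ j v -> v 0 j != 0.
Proof. by case=> _; rewrite hevalXi. Qed.

(** Restrict to the part of [U] in the first chart, where [f] is regular, and use
    linearity there. *)
Lemma phiE U t f : open_ne U -> twist n U t -> hval f * s 0 = t ->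
  phi U t = (fun g => f * Delta g).
Proof.
move=> oU tU ef; pose V := U `&` D_ 0.
have oV : open_ne V := open_ne_coord oU.
have VU : V `<=` U by move=> v [].
have VD : V `<=` D_ 0 by move=> v [].
have Vj v : V v -> v 0 0 != 0 by move/VD/D_coord.
have tV := twist_sub VU tU.
have fV := twist_untwist tV Vj ef.
have sV : twist n V (s 0) := twist_Xpow n Vj.
have [_ _ sc _] := phiP oV (open_ne_P2 oV).
have [_ _ _ rU] := phiP oU (open_ne_P2 oU).
have oD := coordinate_open k 0.
have [_ _ _ rD] := phiP oD (open_ne_P2 oD).
rewrite -(rU V oV VU t tU) -ef (sc f _ fV sV); apply/funext => g.
by rewrite (rD V oV VD _ (twist_Xpow n (@D_coord 0))).
Qed.

Lemma sectionP U D : open_ne U -> L U D <->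
  exists2 f, twist n U (hval f * s 0) & D = (fun g => f * Delta g).
Proof.
move=> oU; have [[fn _ sj] _ _ _] := phiP oU (open_ne_P2 oU); split=> [LD|[f tf ->]].
  have [t tU <-] := sj D LD.
  have [f ef] := twist_quot 0 (proj2 oU) tU.
  by exists f; rewrite ?ef //; apply: phiE.
by rewrite -(phiE oU tf erefl); apply: fn.
Qed.

Lemma generator_section : L (D_ 0) Delta.
Proof.
have oD := coordinate_open k 0; have [[fn _ _] _ _ _] := phiP oD (open_ne_P2 oD).
by apply: fn; exact: (twist_Xpow n (@D_coord 0)).
Qed.

Lemma generator_der : derivation Delta.
Proof. by case: (sec_sub (coordinate_open k 0) generator_section). Qed.

Lemma generator_neq0 : exists f, Delta f != 0.
Proof.
apply: contrapT => h; have z f : Delta f = 0.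
  by apply/eqP/negPn/negP => hf; apply: h; exists f.
have oD := coordinate_open k 0; have [[_ inj _] _ _ _] := phiP oD (open_ne_P2 oD).
have ts := twist_Xpow n (@D_coord 0).
suff e : s 0 = 0 by move: (Xpow_neq0 k n 0); rewrite e eqxx.
apply: (inj (s 0) 0 (mem_set ts) (mem_set (twist0 ts))).
rewrite (phiE (f := 0) oD (twist0 ts)) ?rmorph0 ?mul0r //.
by apply/funext => g; rewrite mul0r; exact: z.
Qed.

End Foliation.

(** * The degree and the stalks of the quotient *)

Lemma cross_coord (F : fieldType) (G s0 f sj c x : F) : s0 != 0 -> sj != 0 -> x != 0 ->
  f * s0 = sj -> G / s0 * c = f * (G * c / x ^+ 2) * x ^+ 2 * sj^-1.
Proof.
move=> s00 sj0 x0 e; have f0 : f != 0 by apply: contraNneq sj0 => f0; rewrite -e f0 mul0r.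
by rewrite -e; field; rewrite x0 f0 s00.
Qed.

Lemma cross_third (F : fieldType) (g c c1 c2 x y z : F) : z != 0 ->
  c * z = c1 * x + c2 * y -> g * c = (g * c1 * x + g * c2 * y) * z^-1.
Proof. by move=> z0 e; apply: (mulIf z0); rewrite divfK // -[LHS]mulrA e; ring. Qed.

Lemma quot_cross (F : fieldType) (g c p q : F) : c != 0 -> g * c = p / q -> g = p / (q * c).
Proof. by move=> c0 e; apply: (mulIf c0); rewrite e invfM mulrA divfK. Qed.

Lemma quot_cross' (F : fieldType) (p a c : F) : p / a * c = c * p / a.
Proof. by rewrite mulrC mulrA. Qed.

Lemma quot_square (F : fieldType) (p x q : F) : p / q * x = p * x / q.
Proof. by rewrite mulrAC. Qed.

Lemma section_quot (F : fieldType) (f s0 sj z x q r G c : F) : z != 0 -> x != 0 -> q != 0 ->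
  f * s0 = sj -> G = s0 * (r * z) ->
  (z / x)^-1 * (f * (G * c / q ^+ 2)) = x * sj * r * c * q^-1 * q^-1.
Proof. by move=> z0 x0 q0 <- ->; field; rewrite z0 x0 q0. Qed.

Lemma inv_quot (F : fieldType) (f s0 sj z x : F) : z != 0 -> x != 0 -> sj != 0 ->
  f * s0 = sj -> z^-1 = (z / x)^-1 * f * s0 * sj^-1 * x^-1.
Proof. by move=> z0 x0 s0' e; rewrite -[_ * f * s0]mulrA e; field; rewrite z0 x0 s0'. Qed.

Lemma scale_leibniz (R : comPzRingType) (g a c x y : R) :
  g * (a * x + c * y) = a * (g * x) + c * (g * y).
Proof. by ring. Qed.

Lemma quot_mul (F : fieldType) (g s : F) : s != 0 -> g = s * (g / s).
Proof. by move=> s0; rewrite mulrC divfK. Qed.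

Lemma frac_eq0 (F : fieldType) (g c q : F) : g != 0 -> q != 0 -> g * c / q ^+ 2 = 0 -> c = 0.
Proof.
by move=> g0 q0 /eqP; rewrite !mulf_eq0 invr_eq0 expf_eq0 (negPf g0) (negPf q0) orbF => /eqP.
Qed.

Lemma frac_zero (F : fieldType) (g q : F) : g * 0 / q = 0.
Proof. by rewrite mulr0 mul0r. Qed.

Section PolynomialFactor.
Variable k : closedFieldType.
Hypothesis char_k : 2%N \in [pchar k].
Local Notation K := (ratfun k).
Local Notation P := {mpoly k[3]}.
Let charP : 2%N \in [pchar P] := pchar_mpoly char_k 3.
Variables (L : subsheafT k) (n : int).
Local Notation s := (@Xpow k n).
Local Notation D_ j := (basic_open ('X_j : P)).
Variable phi : set 'rV[k]_3 -> hfield k -> K -> K.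
Hypothesis phiP : trivialization L n phi.
Local Notation Delta := (generator n phi).

Variables (m : nat) (b : 'I_3 -> P) (G : hfield k).
Hypothesis rep : represents Delta m b G.
Hypothesis bp : forall p, prime_elt p -> exists i, ~ divides p (b i).

Let bm i : b i \is m.-homog. Proof. by case: rep. Qed.
Let G0 : G != 0. Proof. by case: rep. Qed.
Let Dder : derivation Delta := generator_der phiP.

Lemma generatorE d (p q : P) (f : K) : p \is d.-homog -> q \is d.-homog -> q != 0 ->
  hval f = hfrac p / hfrac q ->
  hval (Delta f) = G * hfrac (vf b p * q + p * vf b q) / hfrac q ^+ 2.
Proof.
move=> hp hq q0 ef; have -> : f = rat p q by apply: hval_inj; rewrite (hval_rat hp hq q0).
case: rep => _ _ _ ex ey; exact: (der_formula char_k Dder ex ey hp hq q0).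
Qed.

(** The factor that relates [vf b] to generators of [L]: it is homogeneous of degree
    [1 - n - 2m], and will turn out to be a nonzero constant. *)
Definition cofactor : hfield k := G / s 0.

Lemma coord_section j : exists2 f : K, hval f * s 0 = s j & L (D_ j) (fun g => f * Delta g).
Proof.
have oD := coordinate_open k j; have tj := twist_Xpow n (@D_coord k j).
have [f ef] := twist_quot 0 (proj2 oD) tj; exists f => //.
by apply/(sectionP phiP _ oD); exists f; rewrite ?ef.
Qed.

(** The values of the local generators of [L] on the coordinates of their charts. *)
Lemma coord_cross i j (f : K) : hval f * s 0 = s j ->
  cofactor * hfrac (cross b i j) =
  hval (f * Delta (rat 'X_i 'X_j)) * hfrac 'X_j ^+ 2 * hfrac 'X_j ^ (- n).
Proof.
move=> ef; have Xj := X_neq0 k j.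
have hr := hval_rat (dhomog_Xi k i) (dhomog_Xi k j) Xj.
rewrite hvalM (generatorE (dhomog_Xi k i) (dhomog_Xi k j) Xj hr) !vfX ['X_i * _]mulrC.
rewrite -invr_expz.
exact: (cross_coord _ _ (Xpow_neq0 k n 0) (Xpow_neq0 k n j) (hfracXi_neq0 k j) ef).
Qed.

Lemma cross_homog i j : cross b i j \is (m + m + 1).-homog.
Proof.
have h l l' : b l ^+ 2 * 'X_l' \is (m + m + 1).-homog.
  by apply: dhomogM; [rewrite expr2; apply: dhomogM | exact: dhomog_Xi].
exact: (rpredD (h i j) (h j i)).
Qed.

Lemma cross_coord3 i i' j : cross b i i' * 'X_j = cross b i j * 'X_i' + cross b i' j * 'X_i.
Proof.
symmetry; apply: (@eq_mod2 _ charP (b j ^+ 2 * 'X_i * 'X_i')).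
by rewrite /cross; ring.
Qed.

Lemma cofactor_regular v i i' : v != 0 -> regular_at v (cofactor * hfrac (cross b i i')).
Proof.
move=> v0; have [j vj] := coordinate_neq0 v0.
have hj l : regular_at v (cofactor * hfrac (cross b l j)).
  have [f ef Lf] := coord_section j; rewrite (coord_cross l ef).
  apply: regularM; last exact: regular_Xz.
  apply: regularM; last by rewrite -hfracX; exact: regular_poly.
  apply: Oloc_regular; rewrite -OX_stalkE //.
  case: (sec_sub (coordinate_open k j) Lf) => _; apply.
    by split; rewrite // hevalXi.
  rewrite OX_stalkE //; exists 1%N, 'X_l, 'X_j.
  rewrite !dhomog_Xi hevalXi vj; split=> //.
  exact: (hval_rat (dhomog_Xi k l) (dhomog_Xi k j) (X_neq0 k j)).
have e : hfrac (cross b i i') * hfrac 'X_j =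
    hfrac (cross b i j) * hfrac 'X_i' + hfrac (cross b i' j) * hfrac 'X_i.
  by rewrite -(hfracM (cross b i i')) -(hfracM (cross b i j)) -(hfracM (cross b i' j)) -hfracD cross_coord3.
rewrite (cross_third _ (hfracXi_neq0 k j) e).
apply: regularM; last by exact: (regular_Xz (-1) vj).
by apply: regularD; apply: regularM => //; exact: regular_poly.
Qed.

Lemma cross_hquot : exists i j, cross b i j != 0 /\
  exists p q, hquot (2%:Z - n) (cofactor * hfrac (cross b i j)) p q.
Proof.
have [p pp] := prime_exists k; have [i [j c0]] := prime_cross char_k pp (bp pp).
exists i, j; split; first by apply: contra_notN c0 => /eqP ->; exact: divides0.
have [f ef _] := coord_section j; rewrite (coord_cross i ef).
have [d [a [c [ha hc c0' ->]]]] := ratfunP (f * Delta (rat 'X_i 'X_j)).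
have h2 : hquot 2%:Z (hfrac a / hfrac c * hfrac 'X_j ^+ 2) (a * 'X_j ^+ 2) c.
  exists (d + 2)%N, d; split=> //.
  - by apply: dhomogM => //; apply: (dhomogMn 2 (dhomog_Xi k j)).
  - by rewrite hfracM hfracX; exact: quot_square.
have [p' [q' [h _]]] := hquot_untwist n j h2.
by exists p', q'; move: h; rewrite /Xpow invr_expz.
Qed.

(** All products of the cofactor with the forms [cross b i j] are regular, so they
    are polynomials, and the forms [cross b i j] have no common prime factor. *)
Lemma cofactor_poly : exists2 p : P, cofactor = hfrac p & exists2 d, p \is d.-homog & p != 0.
Proof.
have [i [j [c0 [p [q [d [e [hp hq q0 _ ec]]]]]]]] := cross_hquot.
have C0 : q * cross b i j != 0 by rewrite mulf_neq0.
have hC : q * cross b i j \is (e + (m + m + 1)).-homog.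
  by apply: dhomogM => //; exact: cross_homog.
have ecof : cofactor = hfrac p / hfrac (q * cross b i j).
  by rewrite (hfracM q); exact: (quot_cross (hfrac_neq0 c0) ec).
have [r er] : divides (q * cross b i j) p.
  apply: (divides_cancel (A := fun ij : 'I_3 * 'I_3 => cross b ij.1 ij.2)) => //.
  - exact: factorial_mpoly.
  - move=> [i' j'] /=; apply: (regular_everywhere hC C0) => v v0.
    have := cofactor_regular i' j' v0; rewrite ecof.
    by rewrite (quot_cross' (hfrac p)) -(hfracM (cross b i' j')).
  - move=> z zp _; have [i' [j' h]] := prime_cross char_k zp (bp zp).
    by exists (i', j').
exists r.
  by rewrite ecof er (hfracM r) (mulfK (hfrac_neq0 C0)).
have cof0 : cofactor != 0 by exact: (mulf_neq0 G0 (invr_neq0 (Xpow_neq0 k n 0))).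
have p0 : p != 0.
  by apply: contraNneq cof0 => p0; rewrite ecof p0 rmorph0 mul0r.
have hr := hp; rewrite er in hr p0.
have [i' [j' [h _ _]]] := dhomog_factor p0 hr.
by exists i' => //; apply: contraNneq p0 => ->; rewrite mul0r.
Qed.

(** Dividing [generator] by a nonconstant common factor would give a section of
    the saturation that is not in [L]. *)
Lemma cofactor_saturated (r : P) d : saturated L -> cofactor = hfrac r -> r \is d.-homog ->
  r != 0 -> forall z, prime_elt z -> ~ divides z r.
Proof.
move=> sat er hr r0 z zp zr.
have [e [d' [r' [hz hr' er' ed]]]] := divides_dhomog r0 hr zr.
have z0 := prime_neq0 zp; have hz0 := hfrac_neq0 z0.
have e0 : (0 < e)%N.
  rewrite lt0n; apply/eqP => e0; case: zp => _ /negP[]; rewrite e0 in hz.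
  exact: homog0_unit.
have [v v0 zv] := homog_zero hz e0; have [j vj] := coordinate_neq0 v0.
have [f ef Lf] := coord_section j; have oD := coordinate_open k j.
have XN := dhomogXn k j e.
have XN0 : ('X_j : P) ^+ e != 0 by rewrite expf_neq0 // X_neq0.
have eg := hval_rat hz XN XN0; pose g := rat z ('X_j ^+ e).
have g0 : g != 0.
  apply/eqP => g0; move: eg; rewrite -/g g0 rmorph0 => /esym/eqP.
  by rewrite mulf_eq0 invr_eq0 (negPf hz0) (negPf (hfrac_neq0 XN0)).
have gO : OX (D_ j) g.
  move=> w [_ wj]; exists z, ('X_j ^+ e); rewrite heval_exp expf_neq0 //; split=> //.
  by apply/hquot0; exists e.
pose E := fun h => g^-1 * (f * Delta h).
have TE : TX (D_ j) E.
  split.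
    case: (sec_sub oD Lf) => -[dD dM dC] _; split=> [a c|a c|c].
    - by rewrite /E dD mulrDr.
    - by rewrite /E dM; exact: scale_leibniz.
    - by rewrite /E dC mulr0.
  move=> w [w0 wj]; rewrite OX_stalkE // => a [d1 [p [q [hp hq qw ea]]]].
  apply: regular_Oloc; have q0 := heval_neq0 qw.
  have -> : hval (E a) = hfrac ('X_j ^+ e) * s j * hfrac r' *
      hfrac (vf b p * q + p * vf b q) * (hfrac q)^-1 * (hfrac q)^-1.
    rewrite /E !hvalM hvalV (generatorE hp hq q0 ea) /g eg.
    have eG : G = s 0 * (hfrac r' * hfrac z).
      have ec : cofactor = hfrac r' * hfrac z by rewrite er er' (hfracM r').
      by rewrite -ec; exact: (quot_mul G (Xpow_neq0 k n 0)).
    exact: (section_quot _ hz0 (hfrac_neq0 XN0) (hfrac_neq0 q0) ef eG).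
  rewrite hevalXi in wj.
  apply: regularM; last by exact: (regular_inv hq qw).
  apply: regularM; last by exact: (regular_inv hq qw).
  apply: regularM; last exact: regular_poly.
  apply: regularM; last exact: regular_poly.
  by apply: regularM; [exact: regular_poly | exact: (regular_Xz n wj)].
have LE : L (D_ j) E.
  apply: (sat _ oD g) => //.
  have -> : (fun h => g * E h) = (fun h => f * Delta h).
    by apply/funext => h; rewrite /E mulrA mulfV // mul1r.
  exact: Lf.
have [f2 t2 e2] := iffLR (sectionP phiP _ oD) LE.
have [h0 Dh0] := generator_neq0 phiP.
have ef2 : f2 = g^-1 * f.
  apply: (mulIf Dh0); rewrite -mulrA.
  exact: (esym (congr1 (fun F : K -> K => F h0) e2)).
have Dv : D_ j v by split; rewrite // hevalXi.
have rg := twist_regular t2 Dv.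
have [c [p [q [hq qv eq]]]] : regular_at v (hfrac z)^-1.
  have -> : (hfrac z)^-1 = hval f2 * s 0 * (s j)^-1 * (hfrac ('X_j ^+ e))^-1.
    rewrite ef2 hvalM hvalV /g eg.
    exact: (inv_quot hz0 (hfrac_neq0 XN0) (Xpow_neq0 k n j) ef).
  apply: regularM; last first.
    by apply: (regular_inv XN); rewrite heval_exp hevalXi expf_neq0.
  apply: regularM => //; rewrite /Xpow invr_expz; exact: regular_Xz.
have E1 : 1 * q = p * z.
  apply: (eq_frac z0 (heval_neq0 qv)); rewrite -eq rmorph1 div1r.
  by [].
by move: qv; rewrite -[q]mul1r E1 hevalM zv mulr0 eqxx.
Qed.

(** The cofactor is constant; compare degrees in [coord_cross]. *)
Lemma degree_formula : saturated L -> n = 1 - (m + m)%:Z.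
Proof.
move=> sat; have [r er [d hr r0]] := cofactor_poly.
have d0 : d = 0%N.
  apply: (@mpoly_unit_const k r) => //; apply/negPn/negP => rU.
  have [z zp zr] := divides_prime_factor (@factorial_mpoly k 3) r0 rU.
  exact: (cofactor_saturated sat er hr r0 zp zr).
have [i [j [c0 [p [q [dp [dq [hp hq q0 ed ec]]]]]]]] := cross_hquot.
have E1 : (r * cross b i j) * q = p * 1.
  apply: (eq_frac (oner_neq0 _) q0); rewrite -ec er rmorph1 divr1; exact: hfracM.
rewrite mulr1 in E1; rewrite d0 in hr.
have hE : p \is (0 + (m + m + 1) + dq).-homog.
  by rewrite -E1; apply: dhomogM => //; apply: dhomogM => //; exact: cross_homog.
have p0 : p != 0 by rewrite -E1 !mulf_neq0.
have e := dhomog_uniq p0 hp hE; move: ed; rewrite e; clear.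
by move=> ?; lia.
Qed.

(** A function is annihilated by [L] iff its numerator and denominator satisfy the
    equation in [Rloc]. *)
Lemma stalkE v : v != 0 -> OY_stalk L v = Rloc b v.
Proof.
move=> v0; apply/seteqP; split=> f.
  move=> [U [oU Uv [fU kill]]].
  have [p [q [/hquot0[d [hp hq q0 ef]] qv]]] := fU v Uv.
  exists d, p, q; split=> //.
  have oV := open_ne_coord oU.
  have LV : L (U `&` D_ 0) Delta.
    apply: (sec_res (coordinate_open k 0) oV); last exact: (generator_section phiP).
    by move=> w [].
  have := kill _ oV (@subIsetl _ _ _) _ LV => /(congr1 (@hval k)).
  rewrite (generatorE hp hq q0 ef) rmorph0 => z.
  apply: (add_eq0_2 charP); apply: (@hfrac_inj k); rewrite rmorph0.
  exact: (frac_eq0 G0 (hfrac_neq0 q0) z).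
move=> [d [p [q [hp hq qv ef kr]]]]; have q0 := heval_neq0 qv.
exists (basic_open q); split; [exact: (basic_open_ne hq v0 qv) | by [] |].
split=> [w [_ qw]|V oV VU D LD].
  by exists p, q; split=> //; apply/hquot0; exists d.
have [g _ ->] := iffLR (sectionP phiP _ oV) LD.
suff -> : Delta f = 0 by rewrite mulr0.
apply: hval_inj; rewrite (generatorE hp hq q0 ef) kr (addxx charP) !rmorph0.
exact: frac_zero.
Qed.

End PolynomialFactor.

(** By [p_closed_form] and [primitive_form], a generator of [L] is proportional to
    a vector field [vf b] without common factor. *)
Theorem foliation_form (k : closedFieldType) (char_k : 2%N \in [pchar k])
    (L : subsheafT k) (n : int) : one_foliation L -> has_degree L n ->
  exists m (b : 'I_3 -> {mpoly k[3]}), [/\ forall i, b i \is m.-homog,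
    forall p, prime_elt p -> exists i, ~ divides p (b i), n = 1 - (m + m)%:Z &
    forall v, v != 0 -> OY_stalk L v = Rloc b v].
Proof.
move=> [sat _ pcl] [phi phiP].
have oD := coordinate_open k 0; have LD := generator_section phiP.
have [alpha _ ea] := iffLR (sectionP phiP _ oD) (pcl _ oD _ LD).
have [f0 Df0] := generator_neq0 phiP.
have DD f : generator n phi (generator n phi f) = alpha * generator n phi f.
  exact: (congr1 (fun F : ratfun k -> ratfun k => F f) ea).
have [m [b [G [rep bp]]]] := primitive_form char_k (generator_der phiP) DD Df0.
exists m, b; split=> //; first by case: rep.
  exact: (degree_formula char_k phiP rep bp sat).
exact: (stalkE char_k phiP rep).
Qed.

Theorem theorem3p4 (k : closedFieldType) (char_k : 2%N \in [pchar k]) :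
  (forall L : subsheafT k, one_foliation L -> invertible L ->
     has_degree L 1 -> config_A1 L) /\
  ~ (exists L : subsheafT k,
       [/\ one_foliation L, invertible L & has_degree L 0]) /\
  (forall L : subsheafT k, one_foliation L -> invertible L ->
     has_degree L (-1) ->
     [\/ config_7A1 L, config_D4_3A1 L, config_D6_A1 L | config_E7 L]).
Proof.
split=> [L fol _ deg|].
  have [m [b [bm bp em hL]]] := foliation_form char_k fol deg.
  have m0 : m = 0%N by move: em; clear; lia.
  by rewrite m0 in bm; exact: (constant_config char_k bm bp hL).
split=> [[L [fol _ deg]]|L fol _ deg].
  have [m [_ [_ _ em _]]] := foliation_form char_k fol deg.
  by move: em; clear; lia.
have [m [b [bm bp em hL]]] := foliation_form char_k fol deg.
have m1 : m = 1%N by move: em; clear; lia.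
by rewrite m1 in bm; exact: (linear_config char_k bm bp hL).
Qed.
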